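(* Let $\Gamma\subset\mathbb{R}^3$ be a bounded surface, $\kappa\ge0$, $\mathcal{I}=\mathcal{J}=\{1,\dots,N\}$, $(\varphi_i)_{i=1}^N$ a family of shape functions on $\Gamma$, and let $$\mathbf{K}_{i,j}=\int_{x\in\Gamma}\int_{y\in\Gamma}k_{Helm}(x,y)\,\varphi_j(y)\varphi_i(x)\,dy\,dx,\qquad k_{Helm}(x,y)=\frac{\exp(\mathbf{i}\kappa\|x-y\|)}{4\pi\|x-y\|},$$ be the stiffness matrix. Let cluster trees, bounding boxes, the leaf sets $\mathcal{L}^{standard,+}_{\mathcal{I}\times\mathcal{I}}$ (admissible) and $\mathcal{L}^{standard,-}_{\mathcal{I}\times\mathcal{I}}$ (inadmissible), and the butterfly approximation $\widetilde{\mathbf{K}}\in\mathbb{C}^{\mathcal{I}\times\mathcal{I}}$ of $\mathbf{K}$ with polynomial degree $m$ be as defined in the context, and assume: (A1) every $(\widehat\sigma,\widehat\tau)\in\mathcal{L}^{standard,+}_{\mathcal{I}\times\mathcal{I}}$ satisfies $\max(\operatorname{diam}B_{\widehat\sigma},\operatorname{diam}B_{\widehat\tau})\le\eta_1\operatorname{dist}(B_{\widehat\sigma},B_{\widehat\tau})$ with a fixed parameter $\eta_1>0$; (A2) there is a fixed parameter $\eta_2>0$ such that for every $(\widehat\sigma,\widehat\tau)\in\mathcal{L}^{standard,+}_{\mathcal{I}\times\mathcal{I}}$ of level $\ell$ and every $r\in\{-L_\ell,\dots,L_\ell\}$, $$\kappa\,\operatorname{diam}B_{\sigma'}\,\operatorname{diam}B_{\tau'}\le\eta_2\operatorname{dist}(B_{\widehat\sigma},B_{\widehat\tau})$$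 for all descendants $\sigma'$ of $\widehat\sigma$ on level $L_\ell^{middle}+r$ and all descendants $\tau'$ of $\widehat\tau$ on level $L_\ell^{middle}-r$; (A3) (shrinking condition) there is $\overline q\in(0,1)$ such that for every $(\widehat\sigma,\widehat\tau)\in\mathcal{L}^{standard,+}_{\mathcal{I}\times\mathcal{I}}$, all descendants $\sigma$ of $\widehat\sigma$ and $\sigma'\in\operatorname{sons}(\sigma)$, and all descendants $\tau$ of $\widehat\tau$ and $\tau'\in\operatorname{sons}(\tau)$, one has $\operatorname{diam}_iB_{\sigma'}\le\overline q\operatorname{diam}_iB_\sigma$ and $\operatorname{diam}_iB_{\tau'}\le\overline q\operatorname{diam}_iB_\tau$ for $i=1,2,3$. Then there are constants $C,b,b'>0$ depending solely on $\eta_1$, $\eta_2$, $\overline q$ (and on the constants $C_\Lambda,\lambda$ of the interpolation scheme) such that, if $m\ge b'\log(2+\operatorname{depth}\mathcal{T}_{\mathcal{I}})$, then for all $(i,j)\in\widehat\sigma\times\widehat\tau$: $$|\mathbf{K}_{i,j}-\widetilde{\mathbf{K}}_{i,j}|\le C\,\frac{\|\varphi_i\|_{L^1(\Gamma)}\|\varphi_j\|_{L^1(\Gamma)}}{\operatorname{dist}(B_{\widehat\sigma},B_{\widehat\tau})}\exp(-bm)\quad\text{if }(\widehat\sigma,\widehat\tau)\in\mathcal{L}^{standard,+}_{\mathcal{I}\times\mathcal{I}},$$ and $\mathbf{K}_{i,j}-\widetilde{\mathbf{K}}_{i,j}=0$ if $(\widehat\sigma,\widehat\tau)\in\mathcal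{L}^{standard,-}_{\mathcal{I}\times\mathcal{I}}$.
   Context: Here $d=3$. A box is a product $\prod_{i=1}^3[a_i,b_i]$ with $a_i<b_i$; $\operatorname{diam}$, $\operatorname{dist}$, $\|\cdot\|$ are Euclidean, and $\operatorname{diam}_iB=b_i-a_i$ is the extent of $B$ in the $i$-th coordinate direction. Cluster trees. $\mathcal{T}_{\mathcal{I}}$ and $\mathcal{T}_{\mathcal{J}}$ are cluster trees for $\mathcal{I}$, $\mathcal{J}$: the nodes (clusters) are subsets of the index set, the root (level $0$) is the whole index set, and each non-leaf cluster is the disjoint union of its sons, which lie on the next level; the number of sons is bounded. All leaves of both trees are on the same level $p:=\operatorname{depth}\mathcal{T}_{\mathcal{I}}=\operatorname{depth}\mathcal{T}_{\mathcal{J}}$. ''Descendants'' of a cluster include the cluster itself. Each cluster $\sigma$ has a bounding box $B_\sigma$ with $\operatorname{supp}\varphi_i\subset B_\sigma$ for all $i\in\sigma$, and $B_{\sigma'}\subset B_\sigma$ for $\sigma'\in\operatorname{sons}(\sigma)$. Points $x_\sigma\in B_\sigma$ ($\sigma\in\mathcal{T}_{\mathcal{I}}$) and $y_\tau\in B_\tau$ ($\tau\in\mathcal{T}_{\mathcal{J}}$) are fixed. Block partition. Starting from the root $(\mathcal{I},\mathcal{J})$, a block $(\sigma,\tau)$ is an admissible leaf (element of $\mathcal{L}^{standard,+}_{\mathcal{I}\times\mathcal{I}}$) if $\max(\operatorname{diam}B_\sigma,\operatorname{diam}B_\tau)\le\eta_1\operatorname{dist}(B_\sigma,B_\tau)$;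 otherwise, if $\sigma,\tau$ are leaves of their trees it is an inadmissible leaf (element of $\mathcal{L}^{standard,-}_{\mathcal{I}\times\mathcal{I}}$), and else it is subdivided into $\operatorname{sons}(\sigma)\times\operatorname{sons}(\tau)$. Thus both clusters of a block lie on the same level, called the level of the block, and the leaf blocks partition $\mathcal{I}\times\mathcal{J}$. For level $\ell$ set $L_\ell:=\lfloor(p-\ell)/2\rfloor$ and $L_\ell^{middle}:=p-L_\ell$. Interpolation. For each $m\in\mathbb{N}_0$, $I_m:C([-1,1])\to\mathcal{P}_m$ is polynomial interpolation at $m+1$ distinct points (e.g. Chebyshev interpolation) into polynomials of degree at most $m$, with Lebesgue constant (operator norm) $\Lambda_m\le C_\Lambda(m+1)^\lambda$ for all $m$, with fixed $C_\Lambda,\lambda>0$. For a box $B$, $I_m^B$ is the tensor product interpolation operator transformed affinely to $B$. With $\Phi(x,y)=\|x-y\|$ set $$\mathfrak{I}^{B,x}_z[f]:=e^{\mathbf{i}\kappa\Phi(\cdot,z)}I_m^B[e^{-\mathbf{i}\kappa\Phi(\cdot,z)}f],\qquad \mathfrak{I}^{B,y}_z[f]:=e^{\mathbf{i}\kappa\Phi(z,\cdot)}I_m^B[e^{-\mathbf{i}\kappa\Phi(z,\cdot)}f].$$ Butterfly approximation $\widetilde{\mathbf{K}}$. If $(\widehat\sigma,\widehat\tau)$ is an inadmissible leaf block, $\widetilde{\mathbf{K}}|_{\widehat\sigma\times\widehat\tau}:=\mathbf{K}|_{\widehat\sigma\times\widehat\tau}$. If $(\widehat\sigma,\widehat\tau)$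 is an admissible leaf block of level $\ell$, write $L=L_\ell$; for $(i,j)\in\widehat\sigma\times\widehat\tau$ let $\sigma_L\ni i$ and $\tau_L\ni j$ be the leaf clusters (level $p=L_\ell^{middle}+L$) containing $i$ and $j$, and for $r=-L,\dots,L$ let $\sigma_r$, $\tau_r$ be the unique ancestors (or the clusters themselves) of $\sigma_L$, $\tau_L$ on level $L_\ell^{middle}+r$ (these are descendants of $\widehat\sigma$, $\widehat\tau$). Then $$\widetilde{\mathbf{K}}_{i,j}:=\int_{\Gamma}\int_{\Gamma}k^{BF}(x,y)\varphi_i(x)\varphi_j(y)\,dy\,dx,\qquad k^{BF}:=\Big(\mathfrak{I}^{B_{\sigma_L},x}_{y_{\tau_{-L}}}\circ\cdots\circ\mathfrak{I}^{B_{\sigma_0},x}_{y_{\tau_0}}\Big)\otimes\Big(\mathfrak{I}^{B_{\tau_L},y}_{x_{\sigma_{-L}}}\circ\cdots\circ\mathfrak{I}^{B_{\tau_0},y}_{x_{\sigma_0}}\Big)[k_{Helm}],$$ a function on $B_{\sigma_L}\times B_{\tau_L}$; the first factor acts on the variable $x$, the second on $y$, and intermediate results are restricted to the next smaller box. (This is the function-level form of the matrix factorization into leaf, transfer and coupling matrices.) *)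

(* Defs.v *)
From mathcomp Require Import all_boot all_order all_algebra.
From mathcomp Require Import complex.
From mathcomp Require Import all_classical all_reals all_analysis.

Set Implicit Arguments.
Unset Strict Implicit.
Unset Printing Implicit Defensive.

Import Order.TTheory GRing.Theory Num.Theory.
Import numFieldNormedType.Exports.

Local Open Scope classical_set_scope.
Local Open Scope ring_scope.
Local Open Scope complex_scope.

Notation normc := ComplexField.Normc.normc.

Section Euclidean.
Context {R : realType}.

(* The library norm on 'rV[R]_d is the maximum norm. *)
Definition enorm (d : nat) (x : 'rV[R]_d) : R :=
  Num.sqrt (\sum_(i < d) x 0 i ^+ 2).

(* Meaningful for bounded A, with diam set0 = 0, and for nonempty A and B. *)
Definition diam (A : set 'rV[R]_3) : R :=
  sup [set enorm (xy.1 - xy.2) | xy in A `*` A].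

Definition dist (A B : set 'rV[R]_3) : R :=
  inf [set enorm (xy.1 - xy.2) | xy in A `*` B].

End Euclidean.

Notation borel3 R := (g_sigma_algebraType (@open 'rV[R]_3)).

Section Surface.
Context {R : realType}.

(* Two-dimensional Hausdorff outer measure on R^3. The factor pi / 4
   normalizes it so that it is the area on planes. *)
Definition hausdorff2_delta (delta : R) (A : set 'rV[R]_3) : \bar R :=
  ereal_inf [set (\sum_(0 <= k <oo) (pi / 4 * diam (U k) ^+ 2)%:E)%E |
    U in [set U : nat -> set 'rV[R]_3 | A `<=` \bigcup_k U k /\
      forall k x y, U k x -> U k y -> enorm (x - y) <= delta]].

Definition hausdorff2 (A : set 'rV[R]_3) : \bar R :=
  ereal_sup [set hausdorff2_delta delta A | delta in [set delta | 0 < delta]].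

(* Surfaces are taken in the widest sense in which surface integrals make
   sense, as Borel sets that are countably 2-rectifiable. *)
Definition rectifiable2 (Gamma : set 'rV[R]_3) : Prop :=
  exists chi : nat -> 'rV[R]_2 -> 'rV[R]_3,
    (forall k, [lipschitz chi k u | u in [set: 'rV[R]_2]]) /\
    hausdorff2 (Gamma `\` \bigcup_k range (chi k)) = 0%E.

Definition bounded_surface (Gamma : set 'rV[R]_3) : Prop :=
  [/\ measurable (Gamma : set (borel3 R)), bounded_set Gamma &
      rectifiable2 Gamma].

(* The Hausdorff measure restricted to Gamma; for rectifiable Gamma it is
   sigma-finite, hence of type {sigma_finite_measure _ -> _}. *)
Definition is_surface_measure (Gamma : set 'rV[R]_3)
    (mu : set (borel3 R) -> \bar R) : Prop :=
  forall A : set (borel3 R), measurable A -> mu A = hausdorff2 (A `&` Gamma).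

Definition integrablec (mu : {measure set (borel3 R) -> \bar R})
    (D : set 'rV[R]_3) (f : 'rV[R]_3 -> R[i]) : Prop :=
  mu.-integrable D (fun x : borel3 R => (complex.Re (f x))%:E) /\
  mu.-integrable D (fun x : borel3 R => (complex.Im (f x))%:E).

Definition integralc (mu : {measure set (borel3 R) -> \bar R})
    (D : set 'rV[R]_3) (f : 'rV[R]_3 -> R[i]) : R[i] :=
  (\int[mu]_(x in D) complex.Re (f x)) +i*
  (\int[mu]_(x in D) complex.Im (f x)).

Definition L1norm (mu : {measure set (borel3 R) -> \bar R})
    (D : set 'rV[R]_3) (f : 'rV[R]_3 -> R[i]) : R :=
  \int[mu]_(x in D) normc (f x).

Definition supp (Gamma : set 'rV[R]_3) (f : 'rV[R]_3 -> R[i]) :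
    set 'rV[R]_3 :=
  closure [set x | Gamma x /\ f x <> 0].

End Surface.

Section Boxes.
Context {R : realType}.

Record box := Box {
  lo : 'rV[R]_3;
  hi : 'rV[R]_3;
  lo_lt_hi : forall i, lo 0 i < hi 0 i }.

Definition box_set (B : box) : set 'rV[R]_3 :=
  [set x | forall i, lo B 0 i <= x 0 i <= hi B 0 i].

Definition diam_dir (i : 'I_3) (B : box) : R := hi B 0 i - lo B 0 i.

End Boxes.
Arguments box : clear implicits.
Coercion box_set : box >-> set.

Section ClusterTrees.

(* Nodes are kept apart from their index sets: a cluster with a single son
   has the same index set as this son, but another level and possibly another
   bounding box. The value of [parent] at the root is irrelevant. *)
Record cluster_tree (N : nat) := ClusterTree {
  node :> finType;
  root : node;
  parent : node -> node;
  level : node -> nat;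
  idx : node -> {set 'I_N} }.

Context {N : nat} (T : cluster_tree N).

Definition sons (t : T) : {set T} :=
  [set s | (s != root T) && (parent s == t)].

Definition leaf (t : T) : bool := sons t == finset.set0.

Definition depth : nat := \max_(t : T) level t.

Record is_cluster_tree : Prop := {
  level_root : level (root T) = 0%N;
  level_parent : forall t : T, t != root T -> level t = (level (parent t)).+1;
  idx_root : idx (root T) = finset.setT;
  idx_sons : forall t : T, ~~ leaf t -> idx t = (\bigcup_(s in sons t) idx s)%SET;
  idx_disjoint : forall t s s' : T, s \in sons t -> s' \in sons t -> s != s' ->
    (idx s :&: idx s')%SET = finset.set0;
  leaf_level : forall t : T, leaf t -> level t = depth }.

Definition ancestor (t : T) (l : nat) : T := iter (level t - l) (@parent N T) t.

Definition descendant (t s : T) : bool :=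
  (level t <= level s)%N && (ancestor s (level t) == t).

Definition leaf_of (i : 'I_N) : T :=
  odflt (root T) [pick t : T | leaf t && (i \in idx t)].

End ClusterTrees.

Section Blocks.
Context {R : realType} {N : nat} {TI TJ : cluster_tree N}.
Variables (eta1 : R) (BI : TI -> box R) (BJ : TJ -> box R).

Definition admissible (s : TI) (t : TJ) : Prop :=
  Num.max (diam (BI s)) (diam (BJ t)) <= eta1 * dist (BI s) (BJ t).

Inductive block : TI -> TJ -> Prop :=
| block_root : block (root TI) (root TJ)
| block_sons (s : TI) (t : TJ) (s' : TI) (t' : TJ) :
    block s t -> ~ admissible s t -> ~~ (leaf s && leaf t) ->
    s' \in sons s -> t' \in sons t -> block s' t'.

Definition adm_leaf (s : TI) (t : TJ) : Prop := block s t /\ admissible s t.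

Definition inadm_leaf (s : TI) (t : TJ) : Prop :=
  [/\ block s t, ~ admissible s t, leaf s & leaf t].

End Blocks.

(* L_l and L_l^middle, for trees of depth p. *)
Definition Lhalf (p l : nat) : nat := (p - l)./2.
Definition Lmid (p l : nat) : nat := p - Lhalf p l.

Section Interpolation.
Context {R : realType}.

Definition lagrange (m : nat) (xi : 'I_m.+1 -> R) (j : 'I_m.+1) : {poly R} :=
  \prod_(k < m.+1 | k != j) ((xi j - xi k)^-1 *: ('X - (xi k)%:P)).

Definition interp (m : nat) (xi : 'I_m.+1 -> R) (f : R -> R[i]) (t : R) :
    R[i] :=
  \sum_(j < m.+1) f (xi j) * ((lagrange xi j).[t])%:C.

(* Operator norm of [interp] on the complex-valued C([-1, 1]). *)
Definition lebesgue_const (m : nat) (xi : 'I_m.+1 -> R) : \bar R :=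
  ereal_sup [set (normc (interp xi ft.1 ft.2))%:E |
    ft in [set ft : (R -> R[i]) * R |
      [/\ {within `[-1, 1], continuous (fun s : R => complex.Re (ft.1 s))},
          {within `[-1, 1], continuous (fun s : R => complex.Im (ft.1 s))},
          (forall s : R, s \in `[-1, 1] -> normc (ft.1 s) <= 1) &
          ft.2 \in `[-1, 1]]]].

(* Component i of the affine map from [-1, 1]^3 onto B, and its inverse. *)
Definition to_box (B : box R) (i : 'I_3) (t : R) : R :=
  (lo B 0 i + hi B 0 i) / 2 + (hi B 0 i - lo B 0 i) / 2 * t.
Definition from_box (B : box R) (i : 'I_3) (t : R) : R :=
  (2 * t - (lo B 0 i + hi B 0 i)) / (hi B 0 i - lo B 0 i).

Definition tensor_interp (m : nat) (xi : 'I_m.+1 -> R) (B : box R)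
    (f : 'rV[R]_3 -> R[i]) (x : 'rV[R]_3) : R[i] :=
  \sum_(nu : {ffun 'I_3 -> 'I_m.+1})
    f (\row_i to_box B i (xi (nu i))) *
    (\prod_(i < 3) (lagrange xi (nu i)).[from_box B i (x 0 i)])%:C.

Definition expi (t : R) : R[i] := cos t +i* sin t.

(* The modulated interpolation operator on B, for the phase function [psi]
   (that is, x |-> Phi x z or y |-> Phi z y). *)
Definition phase_interp (m : nat) (xi : 'I_m.+1 -> R) (kappa : R) (B : box R)
    (psi : 'rV[R]_3 -> R) (f : 'rV[R]_3 -> R[i]) (x : 'rV[R]_3) : R[i] :=
  expi (kappa * psi x) *
  tensor_interp xi B (fun x' => expi (- (kappa * psi x')) * f x') x.

(* op r \o ... \o op 1 \o op 0 *)
Fixpoint chain (F : Type) (op : nat -> F -> F) (r : nat) (f : F) : F :=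
  if r is r'.+1 then op r (chain op r' f) else op 0%N f.

Definition Phi (x y : 'rV[R]_3) : R := enorm (x - y).

Definition kHelm (kappa : R) (x y : 'rV[R]_3) : R[i] :=
  expi (kappa * Phi x y) / (4 * pi * Phi x y)%:C.

End Interpolation.

Section Matrices.
Context {R : realType} {N : nat}.
Variables (kappa : R) (Gamma : set 'rV[R]_3).
Variables (mu : {measure set (borel3 R) -> \bar R}).
Variables (phi : 'I_N -> 'rV[R]_3 -> R[i]).

Definition galerkin (k : 'rV[R]_3 -> 'rV[R]_3 -> R[i]) (i j : 'I_N) : R[i] :=
  integralc mu Gamma (fun x =>
    integralc mu Gamma (fun y => k x y * phi j y * phi i x)).

Definition stiffness : 'M[R[i]]_N := \matrix_(i, j) galerkin (kHelm kappa) i j.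

Context {TI TJ : cluster_tree N}.
Variables (eta1 : R) (BI : TI -> box R) (BJ : TJ -> box R).
Variables (px : TI -> 'rV[R]_3) (py : TJ -> 'rV[R]_3).
Variables (m : nat) (xi : 'I_m.+1 -> R).

(* [l] is the level of the admissible leaf block containing (i, j). *)
Definition kBF (l : nat) (i j : 'I_N) (x y : 'rV[R]_3) : R[i] :=
  let p := depth TI in
  let sigma q : TI := ancestor (leaf_of TI i) q in
  let tau q : TJ := ancestor (leaf_of TJ j) q in
  let opx r := phase_interp xi kappa (BI (sigma (Lmid p l + r)%N))
                 (fun x' => Phi x' (py (tau (Lmid p l - r)%N))) in
  let opy r := phase_interp xi kappa (BJ (tau (Lmid p l + r)%N))
                 (fun y' => Phi (px (sigma (Lmid p l - r)%N)) y') in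
  chain opy (Lhalf p l)
    (fun y' => chain opx (Lhalf p l) (fun x' => kHelm kappa x' y') x) y.

Definition butterfly : 'M[R[i]]_N := \matrix_(i, j)
  if [pick b : TI * TJ | `[< adm_leaf eta1 BI BJ b.1 b.2 >]
                         && (i \in idx b.1) && (j \in idx b.2)] is Some b
  then galerkin (kBF (level b.1) i j) i j
  else stiffness i j.

End Matrices.

(* Main.v *)
Require Import Defs.
From mathcomp Require Import all_boot all_order all_algebra.
From mathcomp Require Import cyclic separable cyclotomic.
From mathcomp Require Import complex ring lra zify.
From mathcomp Require Import all_classical all_reals all_analysis.
From mathcomp Require Import measurable_realfun.

(* On a line through a box, the distance to a point of the opposite cluster
   extends analytically, with modulus and argument under control, to a complex
   neighbourhood of the box whose size relative to the box depends only on
   eta1; the phase difference of two points of the opposite cluster has there an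
   imaginary part bounded by eta2. No complex integration is needed: the extended
   functions are uniform limits of polynomials, and for a polynomial the decay
   of the Chebyshev coefficients on a Bernstein ellipse follows from
   orthogonality on finitely many roots of unity. Hence the first interpolation
   of a chain has error O(rho^-m). Each later interpolation is applied to a
   slowly varying phase times a polynomial of degree m; because the boxes shrink
   by the factor qbar, that polynomial grows on the ellipse of the smaller box
   only like r^m with r < rho, so the relative error is O((r / rho)^m) and the
   product of the depth-many stability factors stays bounded as soon as m is at
   least a multiple of log(2 + depth). The two chains act on different variables
   and are combined by Id - Y X = (Id - Y) + Y (Id - X); Fubini's theorem turns
   the bound on the kernel into the bound on the matrix entry. *)

Set Implicit Arguments.
Unset Strict Implicit.
Unset Printing Implicit Defensive.

Import Order.TTheory GRing.Theory Num.Theory.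
Import numFieldNormedType.Exports.
Import ComplexField.Normc.

Local Open Scope classical_set_scope.
Local Open Scope ring_scope.
Local Open Scope complex_scope.

(** Two obstacles shape the proof. Stability constants must not multiply along a chain: a factor
    La^3 per level would give La^(3L), which m >= b' log(2 + depth) cannot absorb. So every later
    interpolation is compared with the identity on the function it receives, and contributes only 1
    plus an exponentially small term. And no constant may depend on kappa. The continuation of a
    single distance has an imaginary part of the size of the displacement, which kappa would
    amplify; for the difference of two distances the imaginary part gains the factor |y - y'| /
    dist, and (A2) bounds exactly this product. It applies because two successive points of a chain
    both lie in the coarser of their two nested boxes, whose level mirrors that of the box being
    interpolated on. The growth rate on the smaller ellipse involves the square root of qbar since a
    radius enters through rho + 1/rho - 2 = (rho - 1)^2 / rho. Reciprocal, square root and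
    exponential remain within the uniform limits of polynomials by the Neumann series, Visser's
    iteration and (1 + w/n)^n. *)

Local Notation lagrange := Defs.lagrange.

(** * Complex numbers and Chebyshev polynomials *)

Section NormC.
Context {R : realType}.
Implicit Types (x y z : R[i]) (a : R).

Lemma normcEsqrt x : normc x = Num.sqrt (complex.Re x ^+ 2 + complex.Im x ^+ 2).
Proof. by case: x. Qed.

Lemma normc_ge0 x : 0 <= normc x.
Proof. by rewrite normcEsqrt sqrtr_ge0. Qed.

Lemma sqr_normcE x : normc x ^+ 2 = complex.Re x ^+ 2 + complex.Im x ^+ 2.
Proof. by rewrite normcEsqrt sqr_sqrtr// addr_ge0// sqr_ge0. Qed.

Lemma normcR a : normc a%:C = `|a|.
Proof. by rewrite normcEsqrt /= expr0n addr0 sqrtr_sqr. Qed.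

Lemma normc_eq0 x : (normc x == 0) = (x == 0).
Proof.
by apply/eqP/eqP => [/eq0_normc//|->]; exact: normc0.
Qed.

Lemma normc_gt0 x : (0 < normc x) = (x != 0).
Proof. by rewrite lt_neqAle normc_ge0 andbT eq_sym normc_eq0. Qed.

Lemma normcX x n : normc (x ^+ n) = normc x ^+ n.
Proof. by elim: n => [|n IH]; rewrite ?normc1// !exprS normcM IH. Qed.

Lemma normc_div x y : normc (x / y) = normc x / normc y.
Proof. by rewrite normcM normcV. Qed.

Lemma le_normcB x y : normc (x - y) <= normc x + normc y.
Proof. by rewrite -(normcN y); exact: le_normcD. Qed.

Lemma normcBC x y : normc (x - y) = normc (y - x).
Proof. by rewrite -normcN opprB. Qed.

Lemma normc_distD x y z : normc (x - y) <= normc (x - z) + normc (z - y).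
Proof. by rewrite -[x - y](subrKA z); exact: le_normcD. Qed.

Lemma ler_sum_normc (I : Type) (r : seq I) (P : pred I) (F : I -> R[i]) :
  normc (\sum_(i <- r | P i) F i) <= \sum_(i <- r | P i) normc (F i).
Proof.
elim/big_rec2: _ => [|i a y _ h]; first by rewrite normc0.
exact: le_trans (le_normcD _ _) (lerD (lexx _) h).
Qed.

Lemma Re_le_normc x : `|complex.Re x| <= normc x.
Proof.
by rewrite normcEsqrt -sqrtr_sqr ler_wsqrtr// lerDl sqr_ge0.
Qed.

Lemma Im_le_normc x : `|complex.Im x| <= normc x.
Proof.
by rewrite normcEsqrt -sqrtr_sqr ler_wsqrtr// lerDr sqr_ge0.
Qed.

Lemma normc_le_ReIm x : normc x <= `|complex.Re x| + `|complex.Im x|.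
Proof.
case: x => a b; rewrite normcEsqrt -[leRHS]ger0_norm ?addr_ge0//= -sqrtr_sqr.
rewrite ler_wsqrtr// sqrrD !real_normK ?num_real// -addrA lerD2l lerDr.
by rewrite mulrn_wge0// mulr_ge0.
Qed.

Lemma cReD x y : complex.Re (x + y) = complex.Re x + complex.Re y.
Proof. by case: x; case: y. Qed.

Lemma cImD x y : complex.Im (x + y) = complex.Im x + complex.Im y.
Proof. by case: x; case: y. Qed.

Lemma cReN x : complex.Re (- x) = - complex.Re x.
Proof. by case: x. Qed.

Lemma cImN x : complex.Im (- x) = - complex.Im x.
Proof. by case: x. Qed.

Lemma cReM x y : complex.Re (x * y) =
  complex.Re x * complex.Re y - complex.Im x * complex.Im y.
Proof. by case: x; case: y. Qed.

Lemma cImM x y : complex.Im (x * y) =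
  complex.Re x * complex.Im y + complex.Im x * complex.Re y.
Proof. by case: x => a b; case: y. Qed.

End NormC.

Section Chebyshev.
Context {R : realType}.
Local Notation C := R[i].

(* The Joukowski map; circles of radius rho > 1 are mapped to Bernstein
   ellipses, the unit circle to [-1, 1]. *)
Definition jouk (z : C) : C := (z + z^-1) / 2.

(** Two consecutive Chebyshev polynomials are carried along, so that their three-term recurrence
    becomes structural recursion. *)
Fixpoint cheb2 (n : nat) : {poly C} * {poly C} :=
  if n is n'.+1 then
    let: (p, q) := cheb2 n' in (q, 2 *: ('X * q) - p)
  else (1, 'X).

Definition cheb n := (cheb2 n).1.

Lemma cheb0 : cheb 0 = 1. Proof. by []. Qed.
Lemma cheb1 : cheb 1 = 'X. Proof. by []. Qed.
Lemma chebSS n : cheb n.+2 = 2 *: ('X * cheb n.+1) - cheb n.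
Proof. by rewrite /cheb /=; case: (cheb2 n). Qed.

Lemma nat2_ind (P : nat -> Prop) :
  P 0%N -> P 1%N -> (forall n, P n -> P n.+1 -> P n.+2) -> forall n, P n.
Proof.
move=> p0 p1 h n; suff: P n /\ P n.+1 by case.
by elim: n => // n [? ?]; split=> //; exact: h.
Qed.

Lemma two_neq0 : (2 : C) != 0. Proof. by rewrite pnatr_eq0. Qed.

Lemma horner_cheb n (z : C) : z != 0 ->
  (cheb n).[jouk z] = (z ^+ n + z^-1 ^+ n) / 2.
Proof.
move=> z0; elim/nat2_ind: n => [||n IH0 IH1].
- by rewrite cheb0 hornerC !expr0; field.
- by rewrite cheb1 hornerX !expr1.
- rewrite chebSS hornerD hornerN hornerZ hornerM hornerX IH0 IH1 /jouk.
  by rewrite !exprVn !exprS; field; rewrite z0 expf_neq0.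
Qed.

Lemma size_lead_cheb n : size (cheb n) = n.+1 /\ lead_coef (cheb n) != 0.
Proof.
elim/nat2_ind: n => [||n [s0 _] [s1 l1]].
- by rewrite cheb0 size_poly1 lead_coef1 oner_neq0.
- by rewrite cheb1 size_polyX lead_coefX oner_neq0.
- have c0 : cheb n.+1 != 0 by rewrite -size_poly_gt0 s1.
  have sX : size (2 *: ('X * cheb n.+1)) = n.+3.
    by rewrite size_scale ?two_neq0// mulrC size_mulX// s1.
  have lt : (size (- cheb n) < size (2 *: ('X * cheb n.+1)))%N.
    by rewrite size_polyN s0 sX.
  rewrite chebSS size_polyDl// sX lead_coefDl// lead_coefZ (mulrC 'X) lead_coefMX.
  by rewrite mulf_neq0// two_neq0.
Qed.

Lemma cheb_expansion n (P : {poly C}) : (size P <= n)%N ->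
  exists a : nat -> C, P = \sum_(k < n) a k *: cheb k.
Proof.
elim: n P => [|n IH] P sP.
  exists (fun=> 0); rewrite big_ord0; apply/eqP.
  by rewrite -size_poly_eq0 -leqn0.
have [sc lc] := size_lead_cheb n.
pose c := P`_n / lead_coef (cheb n).
have s' : (size (P - c *: cheb n)%R <= n)%N.
  apply/leq_sizeP => j; rewrite leq_eqVlt => /predU1P[<-|nj].
    rewrite coefB coefZ /c lead_coefE sc /= mulfVK ?subrr//.
    by move: lc; rewrite lead_coefE sc.
  rewrite coefB coefZ !nth_default ?mulr0 ?subrr ?sc//.
  exact: leq_trans sP nj.
have [a ea] := IH _ s'.
exists (fun k => if k == n then c else a k); rewrite big_ord_recr /= eqxx.
rewrite -[LHS](subrK (c *: cheb n)) ea; congr (_ + _).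
by apply: eq_bigr => i _; rewrite ltn_eqF.
Qed.

(** [X^n - 1] splits over [C] and is separable in characteristic 0; its n distinct roots include a
    primitive one. *)
Lemma exists_prim_root n : (0 < n)%N -> exists w : C, n.-primitive_root w.
Proof.
move=> n0; pose p : {poly C} := 'X^n - 1.
have [r Dp] := closed_field_poly_normal p.
move: Dp; rewrite /p lead_coefXnsubC// scale1r => Dp.
have rn1 : all n.-unity_root r.
  by apply/allP => z; rewrite -root_prod_XsubC -Dp.
have sz : (n < (size r).+1)%N.
  by rewrite -(size_prod_XsubC r id) -Dp size_XnsubC.
have [|z] := hasP (has_prim_root n0 rn1 _ sz); last by exists z.
by rewrite -separable_prod_XsubC -Dp separable_Xn_sub_1// pnatr_eq0 -lt0n.
Qed.

Lemma unity_root_sum n (w : C) k : w ^+ n = 1 -> w ^+ k != 1 ->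
  \sum_(j < n) (w ^+ j) ^+ k = 0.
Proof.
move=> wn wk.
under eq_bigr do rewrite -exprM mulnC exprM.
have := subrX1 (w ^+ k) n; rewrite -exprM mulnC exprM wn.
rewrite expr1n subrr => /esym/eqP; rewrite mulf_eq0 => /orP[|/eqP//].
by rewrite subr_eq0 (negbTE wk).
Qed.

Lemma scaled_unity_sum n (c w : C) k : w ^+ n = 1 -> w ^+ k != 1 ->
  \sum_(j < n) (c * w ^+ j) ^+ k = 0.
Proof.
move=> wn wk; under eq_bigr do rewrite exprMn.
by rewrite -mulr_sumr unity_root_sum ?mulr0.
Qed.

(* Discrete orthogonality of the Chebyshev polynomials on the image under
   jouk of N equispaced points of a circle; exact for degrees below N / 2. *)
Lemma cheb_orthogonality n (c w : C) k l : c != 0 ->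
  (n.*2.+1).-primitive_root w -> (k <= n)%N -> (l <= n)%N ->
  \sum_(j < n.*2.+1)
     (cheb l).[jouk (c * w ^+ j)] * ((c * w ^+ j)^-1) ^+ k =
  if l == k then ((n.*2.+1)%:R * (1 + (k == 0%N)%:R)) / 2 else 0.
Proof.
move=> c0 pw kn ln; set N := n.*2.+1.
have w0 : w != 0.
  by apply/eqP => e; move: (prim_expr_order pw) => /eqP; rewrite e expr0n eq_sym oner_eq0.
have wN : w ^+ N = 1 := prim_expr_order pw.
have vN : w^-1 ^+ N = 1 by rewrite exprVn wN invr1.
have wk e : (0 < e < N)%N -> w ^+ e != 1.
  case/andP=> e0 eN; rewrite -(prim_order_dvd pw).
  by apply/negP => /(dvdn_leq e0); rewrite leqNgt eN.
have vk e : (0 < e < N)%N -> w^-1 ^+ e != 1.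
  by move=> /wk; rewrite exprVn invr_eq1.
have E j : (c * w ^+ j)^-1 = c^-1 * w^-1 ^+ j.
  by rewrite invfM exprVn.
have z0 j : c * w ^+ j != 0 by rewrite mulf_neq0// expf_neq0.
have bN e : (e <= n.*2)%N -> (e < N)%N by [].
(* [T1] and [T2] are the two halves of [horner_cheb]. Their exponents l - k and -(l + k) have
   modulus at most 2n < N, so each sum vanishes unless its exponent is 0. *)
have T1 : \sum_(j < N) (c * w ^+ j) ^+ l * ((c * w ^+ j)^-1) ^+ k =
    if l == k then N%:R else 0.
  case: (ltngtP l k) => lk.
  - rewrite (eq_bigr (fun j : 'I_N => (c^-1 * w^-1 ^+ j) ^+ (k - l))); last first.
      move=> j _; rewrite -E -{1}(subnK (ltnW lk)) addnC exprD mulrA [in X in _ * X * _]exprVn.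
      by rewrite mulfV ?expf_neq0// mul1r.
    apply: scaled_unity_sum => //; apply: vk.
    by rewrite subn_gt0 lk bN// (leq_trans (leq_subr _ _))// (leq_trans kn)// -addnn leq_addr.
  - rewrite (eq_bigr (fun j : 'I_N => (c * w ^+ j) ^+ (l - k))); last first.
      move=> j _; rewrite -{1}(subnK (ltnW lk)) exprD -mulrA [in X in _ * (_ * X)]exprVn.
      by rewrite mulfV ?expf_neq0// mulr1.
    apply: scaled_unity_sum => //; apply: wk.
    by rewrite subn_gt0 lk bN// (leq_trans (leq_subr _ _))// (leq_trans ln)// -addnn leq_addr.
  - under eq_bigr => j _ do rewrite lk exprVn mulfV ?expf_neq0//.
    by rewrite sumr_const card_ord.
have T2 : \sum_(j < N) ((c * w ^+ j)^-1) ^+ l * ((c * w ^+ j)^-1) ^+ k =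
    if (l == k) && (k == 0%N) then N%:R else 0.
  under eq_bigr do rewrite -exprD.
  case: (posnP (l + k)) => [|lk].
    move/eqP; rewrite addn_eq0 => /andP[/eqP-> /eqP->] /=.
    by under eq_bigr do rewrite expr0; rewrite sumr_const card_ord.
  rewrite ifF; last first.
    by apply/negP => /andP[/eqP lk' /eqP k0]; move: lk; rewrite lk' k0.
  under eq_bigr do rewrite E.
  by apply: scaled_unity_sum => //; apply: vk; rewrite lk bN// -addnn leq_add.
rewrite (eq_bigr (fun j : 'I_N => 2^-1 *
  ((c * w ^+ j) ^+ l * ((c * w ^+ j)^-1) ^+ k +
   ((c * w ^+ j)^-1) ^+ l * ((c * w ^+ j)^-1) ^+ k))); last first.
  by move=> j _; rewrite horner_cheb//; ring.
rewrite -mulr_sumr big_split /= T1 T2.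
case: (eqVneq l k) => [_|_] /=; last by rewrite addr0 mulr0.
by case: (k == 0%N) => /=; rewrite ?addr0 mulrC; congr (_ / _); rewrite -?mulr2n; ring.
Qed.

(** Orthogonality expresses the coefficient k as a mean of P(jouk u) u^-k over scaled roots of
    unity, with terms of size at most M rho^-k; the 2 undoes the half in [horner_cheb]. The radius 1
    is allowed because [bernstein_growth] takes rho = 1. *)
Lemma cheb_coef_bound n (a : nat -> C) (rho M : R) : 0 < rho ->
  (forall z, normc z = rho ->
    normc (\sum_(k < n.+1) a k *: cheb k).[jouk z] <= M) ->
  forall k, (k <= n)%N -> normc (a k) <= 2 * M * rho^-1 ^+ k.
Proof.
move=> rho0 hM k kn.
have [w pw] := exists_prim_root (isT : (0 < n.*2.+1)%N).
set N := n.*2.+1 in pw *.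
have c0 : rho%:C != 0 :> C by rewrite -normc_eq0 normcR gtr0_norm// gt_eqF.
have nw j : normc (w ^+ j) = 1.
  have : normc w ^+ N = 1 by rewrite -normcX (prim_expr_order pw) normc1.
  by move/eqP; rewrite pexpr_eq1 ?normc_ge0// normcX => /eqP ->; rewrite expr1n.
have nz j : normc (rho%:C * w ^+ j) = rho.
  by rewrite normcM nw mulr1 normcR gtr0_norm.
pose S : C := \sum_(j < N) (\sum_(k < n.+1) a k *: cheb k).[jouk (rho%:C * w ^+ j)]
  * ((rho%:C * w ^+ j)^-1) ^+ k.
have SE : S = a k * (N%:R * (1 + (k == 0%N)%:R) / 2).
  rewrite /S; under eq_bigr do rewrite horner_sum mulr_suml.
  rewrite exchange_big /= (bigD1 (inord k)) //= [X in _ + X]big1 ?addr0 => [|l lk].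
       under eq_bigr do rewrite hornerZ -mulrA.
    by rewrite -mulr_sumr cheb_orthogonality ?inordK ?ltnS// eqxx.
  under eq_bigr do rewrite hornerZ -mulrA.
  rewrite -mulr_sumr cheb_orthogonality//; last by rewrite -ltnS ltn_ord.
  rewrite ifF ?mulr0//.
  by apply: contraNF lk => /eqP <-; rewrite inord_val.
have nS : normc S <= N%:R * (M * rho^-1 ^+ k).
  rewrite /S (le_trans (ler_sum_normc _ _ _))//.
  apply: le_trans (_ : \sum_(j < N) M * rho^-1 ^+ k <= _).
    apply: ler_sum => j _; rewrite normcM normcX normcV nz ler_wpM2r//.
      by rewrite exprn_ge0// invr_ge0 ltW.
    exact: hM.
  by rewrite sumr_const card_ord mulr_natl.
have N0 : 0 < N%:R :> R by rewrite ltr0n.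
have t : 1 <= 1 + (k == 0%N)%:R :> R by rewrite lerDl.
have -> : normc (a k) = 2 * normc S / (N%:R * (1 + (k == 0%N)%:R)).
  rewrite SE !normcM.
  have nn (j : nat) : normc (j%:R : C) = j%:R.
    by rewrite -(rmorph_nat (real_complex R)) normcR ger0_norm.
  have -> : normc (1 + (k == 0%N)%:R : C) = 1 + (k == 0%N)%:R.
    by have := nn (1 + (k == 0))%N; rewrite !natrD.
  rewrite normcV !nn; field.
  by rewrite (gt_eqF N0) gt_eqF// (lt_le_trans _ t).
rewrite ler_pdivrMr ?mulr_gt0// ?(lt_le_trans _ t)//.
rewrite (le_trans (ler_wpM2l _ nS))// mulrCA mulrA (mulrC _ (N%:R * _)) -!mulrA ler_wpM2l//.
rewrite ler_peMl// mulr_ge0// mulr_ge0 ?exprn_ge0 ?invr_ge0 ?(ltW rho0)//.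
apply: le_trans (hM rho%:C _); first exact: normc_ge0.
by rewrite normcR gtr0_norm.
Qed.

Lemma geometric_tail (x : R) (m n : nat) :
  (1 - x) * \sum_(k < n | (m < k)%N) x ^+ k = if (m < n)%N then x ^+ m.+1 - x ^+ n else 0.
Proof.
elim: n => [|n IH]; first by rewrite big_ord0 mulr0.
rewrite big_mkcond big_ord_recr -big_mkcond /= mulrDr IH ltnS.
case: (ltngtP m n) => [mn|mn|->]; rewrite ?mulr0 ?addr0 ?add0r ?subrr//.
by rewrite (exprS x n); ring.
Qed.

Lemma jouk_unit (z : C) : normc z = 1 -> jouk z = (complex.Re z)%:C.
Proof.
case: z => a b; move/(congr1 (fun x => x ^+ 2)).
rewrite sqr_normcE expr1n /= /jouk => h.
have -> : (a +i* b)^-1 = a -i* b.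
  rewrite -[LHS]mulr1 -[a -i* b]mul1r; apply/eqP.
  have z0 : a +i* b != 0 :> C.
    by rewrite -normc_eq0 -sqrf_eq0 sqr_normcE /= h oner_eq0.
  rewrite eq_sym -(inj_eq (mulfI z0)) mulVKf// mul1r; apply/eqP.
  by apply/eqP; rewrite eq_complex /= mulrN opprK -!expr2 h eqxx mulrN mulrC addNr eqxx.
rewrite -[2]/(1 + 1) -[X in X / _]/((a + a) +i* (b - b)) subrr.
have -> : (a + a) +i* 0 = (1 + 1) * a%:C :> C.
  by rewrite mulrDl !mul1r -[RHS]/((a + a) +i* (0 + 0)) addr0.
by rewrite mulrAC mulfV ?mul1r// (two_neq0 : 1 + 1 != 0).
Qed.

Lemma jouk_unit_onto (t : R) : -1 <= t <= 1 ->
  exists2 z : C, normc z = 1 & jouk z = t%:C.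
Proof.
move=> /andP[t1 t2]; have n1 : normc (t +i* Num.sqrt (1 - t ^+ 2)) = 1.
  rewrite normcEsqrt /= sqr_sqrtr; last by nra.
  by rewrite addrCA subrr addr0 sqrtr1.
by exists (t +i* Num.sqrt (1 - t ^+ 2)) => //; rewrite jouk_unit.
Qed.

Lemma cheb_le1 n (t : R) : -1 <= t <= 1 -> normc (cheb n).[t%:C] <= 1.
Proof.
case/jouk_unit_onto => z z1 <-.
rewrite horner_cheb; last by rewrite -normc_eq0 z1 oner_neq0.
rewrite normc_div -[2]/(2%:R) -(rmorph_nat (real_complex R)) normcR ger0_norm//.
rewrite ler_pdivrMr// mul1r (le_trans (le_normcD _ _))// !normcX normcV z1.
by rewrite invr1 !expr1n.
Qed.

Lemma cheb_le n (z : C) (r : R) : 1 <= normc z <= r ->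
  normc (cheb n).[jouk z] <= r ^+ n.
Proof.
case/andP => z1 zr; have z0 := lt_le_trans ltr01 z1.
rewrite horner_cheb; last by rewrite -normc_gt0.
rewrite normc_div -[2]/(2%:R) -(rmorph_nat (real_complex R)) normcR ger0_norm//.
rewrite ler_pdivrMr// (le_trans (le_normcD _ _))// !normcX normcV.
have : normc z ^+ n <= r ^+ n by rewrite lerXn2r// nnegrE ltW// (lt_le_trans z0).
have : (normc z)^-1 ^+ n <= normc z ^+ n.
  by rewrite lerXn2r// ?nnegrE ?invr_ge0 ?(ltW z0)// (le_trans _ z1)// invf_le1.
by lra.
Qed.

(** [Q] truncates the Chebyshev expansion, and rho^-m / (rho - 1) is the sum of rho^-k over k > m.
    The bound does not see the degree of [P], which lets [limit_truncation] pass to uniform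
    limits. *)
Lemma cheb_truncation (P : {poly C}) (rho M : R) (m : nat) : 1 < rho ->
  (forall z, normc z = rho -> normc P.[jouk z] <= M) ->
  exists2 Q : {poly C}, (size Q <= m.+1)%N &
    forall t : R, -1 <= t <= 1 ->
      normc (P.[t%:C] - Q.[t%:C]) <= 2 * M * rho^-1 ^+ m / (rho - 1).
Proof.
move=> rho1 hM; have rho0 := lt_trans ltr01 rho1.
have [a Pa] := cheb_expansion (leqnSn (size P)).
move: (size P) Pa => n Pa.
have M0 : 0 <= M.
  apply: le_trans (hM rho%:C _); first exact: normc_ge0.
  by rewrite normcR gtr0_norm.
have ha k : (k <= n)%N -> normc (a k) <= 2 * M * rho^-1 ^+ k.
  by move=> kn; apply: (cheb_coef_bound rho0) kn; rewrite -Pa.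
exists (\sum_(k < n.+1 | (k <= m)%N) a k *: cheb k).
  rewrite (leq_trans (size_sum _ _ _))//; apply/bigmax_leqP => k km.
  rewrite (leq_trans (size_scale_leq _ _))//.
  by rewrite (size_lead_cheb k).1 ltnS.
move=> t t1; rewrite Pa (bigID (fun k : 'I_n.+1 => (k <= m)%N)) /= hornerD.
rewrite addrC addKr horner_sum (le_trans (ler_sum_normc _ _ _))//.
apply: le_trans (_ : \sum_(k < n.+1 | (m < k)%N) 2 * M * rho^-1 ^+ k <= _).
  under eq_bigl do rewrite -ltnNge.
  apply: ler_sum => k mk; rewrite hornerZ normcM.
  rewrite -[leRHS]mulr1 ler_pM ?normc_ge0 ?cheb_le1//.
  by apply: ha; rewrite -ltnS ltn_ord.
rewrite -mulr_sumr -!mulrA ler_wpM2l// ler_wpM2l//.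
have x1 : 0 < 1 - rho^-1 by rewrite subr_gt0 invf_lt1.
have -> : rho^-1 ^+ m / (rho - 1) = rho^-1 ^+ m.+1 / (1 - rho^-1).
  rewrite exprS; field; rewrite (gt_eqF rho0)/= subr_eq0 (gt_eqF rho1)/=.
  by [].
rewrite ler_pdivlMr// mulrC geometric_tail.
have p0 k : 0 <= rho^-1 ^+ k by rewrite exprn_ge0// invr_ge0 ltW.
by case: ifP => _ //; rewrite lerBlDr lerDl.
Qed.

(** A weak Bernstein inequality: the coefficients are at most 2A by [cheb_coef_bound] on the unit
    circle, and the k-th Chebyshev polynomial is at most r^k. The extra factor n + 1 is absorbed by
    exponential decay in [error_constants]. *)
Lemma bernstein_growth (P : {poly C}) n (A r : R) (z : C) :
  (size P <= n.+1)%N -> (forall t : R, -1 <= t <= 1 -> normc P.[t%:C] <= A) ->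
  1 <= normc z <= r -> normc P.[jouk z] <= 2 * n.+1%:R * A * r ^+ n.
Proof.
move=> sP hA zr; have [a Pa] := cheb_expansion sP.
have /andP[z1 zr'] := zr; have r1 := le_trans z1 zr'.
have A0 : 0 <= A by apply: le_trans (hA 0 _); rewrite ?normc_ge0// lerN10 ler01.
have ha k : (k <= n)%N -> normc (a k) <= 2 * A.
  move=> kn; have := @cheb_coef_bound n a 1 A ltr01 _ k kn.
  rewrite invr1 expr1n mulr1; apply => u u1.
  by rewrite -Pa jouk_unit//; apply: hA; rewrite -ler_norml -u1 Re_le_normc.
rewrite Pa horner_sum (le_trans (ler_sum_normc _ _ _))//.
apply: le_trans (_ : \sum_(k < n.+1) 2 * A * r ^+ n <= _).
  apply: ler_sum => k _; rewrite hornerZ normcM ler_pM ?normc_ge0//.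
    by apply: ha; rewrite -ltnS ltn_ord.
  rewrite (le_trans (cheb_le _ zr))// ler_weXn2l// -ltnS ltn_ord//.
by rewrite sumr_const card_ord [leLHS](_ : _ = 2 * n.+1%:R * A * r ^+ n)// -[LHS]mulr_natr; ring.
Qed.

(** The candidates w + s and w - s, with s^2 = w^2 - 1, are inverse to each other, so one of them
    has modulus at least 1. *)
Lemma jouk_surj (w : C) : exists2 z : C, 1 <= normc z & jouk z = w.
Proof.
pose s := sqrtc (w ^+ 2 - 1); have s2 : s ^+ 2 = w ^+ 2 - 1 by exact: sqr_sqrtc.
have h : (w + s) * (w - s) = 1.
  have -> : (w + s) * (w - s) = w ^+ 2 - s ^+ 2 by ring.
  by rewrite s2; ring.
have z0 : w + s != 0.
  by apply/eqP => e; move: h; rewrite e mul0r => /eqP; rewrite eq_sym oner_eq0.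
have zV : (w + s)^-1 = w - s.
  by apply: (mulfI z0); rewrite h mulfV.
have jz : jouk (w + s) = w by rewrite /jouk zV; field.
have [?|lt1] := lerP 1 (normc (w + s)); first by exists (w + s).
exists (w + s)^-1; last by rewrite -[RHS]jz /jouk invrK addrC.
by rewrite normcV invf_ge1 ?normc_gt0// ltW.
Qed.

(** The focal distances are |z - 1|^2 / (2|z|) and |z + 1|^2 / (2|z|); the parallelogram law adds
    them up. *)
Lemma focal_sum (z : C) : z != 0 ->
  normc (jouk z - 1) + normc (jouk z + 1) = normc z + (normc z)^-1.
Proof.
move=> z0; have n0 : normc z != 0 by rewrite normc_eq0.
have n2 : normc (2 : C) = 2.
  by rewrite -(rmorph_nat (real_complex R)) normcR ger0_norm.
have -> : jouk z - 1 = (z - 1) ^+ 2 / (2 * z) by rewrite /jouk; field.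
have -> : jouk z + 1 = (z + 1) ^+ 2 / (2 * z) by rewrite /jouk; field.
rewrite !normc_div (normcM 2) n2 !normcX -mulrDl.
have -> : normc (z - 1) ^+ 2 + normc (z + 1) ^+ 2 = 2 * normc z ^+ 2 + 2.
  by rewrite !sqr_normcE !cReD !cImD !cReN !cImN /=; ring.
by field.
Qed.

(* The ellipse of parameter r + 1 / r = |w - 1| + |w + 1| is convex in w,
   which is what makes reinterpolation on a smaller interval contract. *)
Lemma jouk_affine (al be q rho : R) (z : C) : 0 < al -> al <= q -> q < 1 ->
  `|be| <= 1 - al -> 1 < rho -> normc z = rho ->
  exists2 u : C, 1 <= normc u <= 1 + Num.sqrt q * (rho - 1) &
    jouk u = al%:C * jouk z + be%:C.
Proof.
move=> al0 alq q1 hbe rho1 zrho.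
have z0 : z != 0 by rewrite -normc_eq0 zrho gt_eqF// (lt_trans ltr01).
have [u u1 ju] := jouk_surj (al%:C * jouk z + be%:C).
exists u => //; rewrite u1 /=; set x := normc u in u1 *.
have u0 : u != 0 by rewrite -normc_gt0 (lt_le_trans ltr01).
have x0 : 0 < x by exact: lt_le_trans u1.
have rho0 : 0 < rho by exact: lt_trans rho1.
(* Triangle inequality for both focal distances: since [|be| <= 1 - al], the shifts contribute 1 -
   al - be and 1 - al + be, both non-negative, with sum 2 (1 - al). *)
have E : x + x^-1 <= al * (rho + rho^-1) + 2 * (1 - al).
  rewrite -zrho -focal_sum// -focal_sum// ju.
  have -> : al%:C * jouk z + be%:C - 1 = al%:C * (jouk z - 1) + (al + be - 1)%:C.
    by rewrite !rmorphB !rmorphD rmorph1; ring.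
  have -> : al%:C * jouk z + be%:C + 1 = al%:C * (jouk z + 1) + (1 + be - al)%:C.
    by rewrite !rmorphB !rmorphD rmorph1; ring.
  have h1 := le_normcD (al%:C * (jouk z - 1)) (al + be - 1)%:C.
  have h2 := le_normcD (al%:C * (jouk z + 1)) (1 + be - al)%:C.
  move: h1 h2; rewrite !normcM !normcR (gtr0_norm al0).
  move: hbe; rewrite ler_norml => /andP[b1 b2].
  rewrite (ler0_norm (_ : al + be - 1 <= 0)); last by lra.
  rewrite (ger0_norm (_ : 0 <= 1 + be - al)); last by lra.
  by lra.
have q0 : 0 <= q := ltW (lt_le_trans al0 alq).
set s := Num.sqrt q; have s2 : s ^+ 2 = q by rewrite sqr_sqrtr.
have s0 : 0 <= s by rewrite sqrtr_ge0.
have s1 : s <= 1 by rewrite -sqrtr1 ler_wsqrtr// ltW.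
(* After subtracting 2 the focal sum is (x - 1)^2 / x, and this quantity shrinks by the factor q;
   hence the square root for the radius. *)
have E2 : (x - 1) ^+ 2 / x <= q * ((rho - 1) ^+ 2 / rho).
  have -> : (x - 1) ^+ 2 / x = x + x^-1 - 2 by field; rewrite gt_eqF.
  have e : (rho - 1) ^+ 2 / rho = rho + rho^-1 - 2 by field; rewrite gt_eqF.
  have : 0 <= (rho - 1) ^+ 2 / rho by rewrite divr_ge0 ?sqr_ge0 ?ltW.
  rewrite e => h; nra.
rewrite leNgt; apply/negP => xr.
(* (x - 1)^2 / x increases for x >= 1; knowing x <= rho then removes the denominators from [E2]. *)
have xrho : x <= rho.
  rewrite leNgt; apply/negP => rx.
  have : (rho - 1) ^+ 2 / rho < (x - 1) ^+ 2 / x.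
    rewrite ltr_pdivrMr// mulrAC ltr_pdivlMr//.
    have : 0 < (x - rho) * (x * rho - 1) by rewrite mulr_gt0; nra.
    by nra.
  have : 0 <= (rho - 1) ^+ 2 / rho by rewrite divr_ge0 ?sqr_ge0 ?ltW.
  nra.
have : (x - 1) ^+ 2 <= (s * (rho - 1)) ^+ 2.
  rewrite exprMn s2; move: E2; rewrite ler_pdivrMr// => /le_trans; apply.
  rewrite -mulrA ler_wpM2l// mulrAC ler_pdivrMr// ler_wpM2l// sqr_ge0//.
have : 0 <= s * (rho - 1) by rewrite mulr_ge0// subr_ge0 ltW.
nra.
Qed.

End Chebyshev.

(** * Uniform limits of polynomials and the continued distance *)

Section CExp.
Context {R : realType}.
Implicit Types (x y a b : R) (w z : R[i]).

Definition cexp w : R[i] := (expR (complex.Re w))%:C * expi (complex.Im w).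

Lemma expiD a b : expi (a + b) = expi a * expi b :> R[i].
Proof.
by apply/eqP; rewrite eq_complex /= cosD sinD addrC mulrC eqxx /= addrC mulrC [X in _ + X]mulrC.
Qed.

Lemma expi0 : expi 0 = 1 :> R[i].
Proof. by rewrite /expi cos0 sin0. Qed.

Lemma normc_expi a : normc (expi a : R[i]) = 1.
Proof. by rewrite normcEsqrt /= cos2Dsin2 sqrtr1. Qed.

Lemma cexpD w z : cexp (w + z) = cexp w * cexp z.
Proof. by rewrite /cexp cReD cImD expRD expiD rmorphM mulrACA. Qed.

Lemma cexp_natmul w n : cexp (w *+ n) = cexp w ^+ n.
Proof.
elim: n => [|n IH]; first by rewrite mulr0n /cexp /= expR0 expi0 mulr1.
by rewrite mulrS exprS cexpD IH.
Qed.

Lemma normc_cexp w : normc (cexp w) = expR (complex.Re w).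
Proof. by rewrite normcM normc_expi mulr1 normcR gtr0_norm ?expR_gt0. Qed.

Lemma cexp_imag a : cexp (0 +i* a) = expi a.
Proof. by rewrite /cexp /= expR0 mul1r. Qed.

Lemma norm_sin_le x : `|sin x| <= `|x|.
Proof.
have aux y : 0 <= y -> `|sin y| <= y.
  rewrite le_eqVlt => /predU1P[<-|y0]; first by rewrite sin0 normr0.
  have [c _] : exists2 c, c \in `]0, y[%R & sin y - sin 0 = cos c * (y - 0).
    by apply: MVT => //; apply/continuous_subspaceT/continuous_sin.
  rewrite sin0 !subr0 => ->; rewrite normrM (gtr0_norm y0) ler_piMl ?(ltW y0)//.
  by rewrite ler_norml cos_geN1 cos_le1.
have [x0|x0] := lerP 0 x; first by rewrite (ger0_norm x0); exact: aux.
by rewrite -normrN -sinN -(normrN x) (gtr0_norm (x := - x)) ?oppr_gt0// aux// oppr_ge0 ltW.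
Qed.

Lemma norm_cosB1_le x : `|cos x - 1| <= x ^+ 2.
Proof.
have -> : cos x - 1 = - (2 * sin (x / 2) ^+ 2).
  rewrite {1}(_ : x = x / 2 + x / 2); last by field.
  by rewrite cosD -!expr2 cos2sin2; ring.
rewrite normrN ger0_norm; last by rewrite mulr_ge0// sqr_ge0.
have : sin (x / 2) ^+ 2 <= (x / 2) ^+ 2.
  rewrite -[leLHS]real_normK ?num_real// -[leRHS]real_normK ?num_real//.
  by rewrite lerXn2r ?nnegrE// norm_sin_le.
have := sqr_ge0 x; rewrite !expr2; nra.
Qed.

Lemma norm_sinB_le x : `|x| <= 1 -> `|sin x - x| <= x ^+ 2.
Proof.
have aux y : 0 <= y <= 1 -> `|sin y - y| <= y ^+ 2.
  case/andP; rewrite le_eqVlt => /predU1P[<-|y0 y1].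
    by rewrite sin0 subr0 normr0 expr0n.
  have [c /[!in_itv]/= /andP[c0 cy]] : exists2 c, c \in `]0, y[%R & sin y - sin 0 = cos c * (y - 0).
    by apply: MVT => //; apply/continuous_subspaceT/continuous_sin.
  rewrite sin0 !subr0 => ->; rewrite -[X in _ - X]mul1r -mulrBl normrM (gtr0_norm y0).
  rewrite expr2 ler_wpM2r ?(ltW y0)// (le_trans (norm_cosB1_le c))//.
  by nra.
move=> x1; have [x0|x0] := lerP 0 x.
  by apply: aux; rewrite x0 (le_trans (ler_norm _)).
rewrite -normrN opprB addrC -sqrrN -[X in `|_ + X|]opprK.
rewrite -sinN; apply: aux.
by rewrite oppr_ge0 (ltW x0) /= (le_trans (ler_norm _))// normrN.
Qed.

Lemma expRB1x_le a : `|a| <= 1 / 2 -> 0 <= expR a - 1 - a <= 2 * a ^+ 2.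
Proof.
rewrite ler_norml => /andP[a1 a2]; have h1 := expR_ge1Dx a.
apply/andP; split; first by lra.
have h2 := expR_ge1Dx (- a); have e := expRxMexpNx_1 a.
have : expR a * (1 - a) <= 1 by rewrite -[leRHS]e ler_wpM2l ?expR_ge0.
have := expR_gt0 a; nra.
Qed.

Lemma cexpB1x_le w : normc w <= 1 / 2 -> normc (cexp w - 1 - w) <= 8 * normc w ^+ 2.
Proof.
move=> w1; have := Re_le_normc w; have := Im_le_normc w; have := sqr_normcE w.
rewrite /cexp; set r := normc w in w1 *; set a := complex.Re w.
set b := complex.Im w => r2 hb ha; have r1 := w1.
have /andP[e1 e2] := expRB1x_le (le_trans ha r1).
have c1 := norm_cosB1_le b.
have s1 := norm_sinB_le (_ : `|b| <= 1).
have {}s1 : `|sin b - b| <= b ^+ 2 by apply: s1; lra.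
apply: le_trans (normc_le_ReIm _) _.
rewrite !cReD !cImD !cReN !cImN cReM cImM /= !mul0r !subr0 !addr0 -/a -/b.
move: ha hb c1 s1; rewrite !ler_norml => /andP[a1 a2] /andP[b1 b2] /andP[c1 c2] /andP[s1 s2].
have eup : expR a <= 2 by nra.
have elo := expR_gt0 a.
have : `|expR a * cos b - 1 - a| <= 4 * r ^+ 2.
  by rewrite ler_norml; apply/andP; split; nra.
have : `|expR a * sin b - 0 - b| <= 4 * r ^+ 2.
  have ab : `|(expR a - 1) * b| <= 2 * r ^+ 2.
    rewrite normrM expr2 mulrA ler_pM//.
      by rewrite ler_norml; apply/andP; split; nra.
    by rewrite ler_norml b1.
  move: ab; rewrite !ler_norml => /andP[ab1 ab2]; apply/andP; split; nra.
by rewrite oppr0 addr0; lra.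
Qed.

Lemma power_diff_le (A B : R[i]) (M : R) n : normc A <= M -> normc B <= M ->
  normc (A ^+ n.+1 - B ^+ n.+1) <= n.+1%:R * normc (A - B) * M ^+ n.
Proof.
move=> hA hB; have M0 : 0 <= M := le_trans (normc_ge0 A) hA.
rewrite subrXX normcM [n.+1%:R * _]mulrC -mulrA ler_wpM2l ?normc_ge0//.
apply: le_trans (ler_sum_normc _ _ _) _.
apply: le_trans (_ : \sum_(i < n.+1) M ^+ n <= _); last first.
  by rewrite sumr_const card_ord mulr_natl.
apply: ler_sum => i _; rewrite normcM !normcX /=.
have -> : M ^+ n = M ^+ (n - i) * M ^+ i by rewrite -exprD subnK// -ltnS.
by rewrite ler_pM ?exprn_ge0 ?normc_ge0// lerXn2r// nnegrE normc_ge0.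
Qed.

(** [cexp w] is the power n + 1 of cexp (w / (n + 1)), which differs from 1 + w / (n + 1) by a term
    quadratic in 1/n; [power_diff_le] multiplies this by n + 1 and a bounded factor. [N] makes the
    argument at most 1/2. *)
Lemma cexp_approx (K : R) : 0 < K -> exists N : nat, forall n, (N <= n)%N ->
  forall w, normc w <= K ->
  normc (cexp w - (1 + w / n.+1%:R) ^+ n.+1) <=
    8 * K ^+ 2 * expR K / n.+1%:R.
Proof.
move=> K0; exists (`|Num.ceil (2 * K)|%N) => n Nn w wK.
have n0 : 0 < n.+1%:R :> R by rewrite ltr0n.
have nK : 2 * K <= n.+1%:R.
  rewrite (le_trans (ceil_ge _))// -(ger0_norm (_ : 0 <= (Num.ceil (2 * K))%:~R :> R)); last first.
    by rewrite ler0z -(ceil0 R) le_ceil// mulr_ge0 ?ltW.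
  by rewrite -intr_norm -abszE -pmulrn ler_nat (leq_trans Nn).
have nn : normc (n.+1%:R : R[i]) = n.+1%:R.
  by rewrite -(rmorph_nat (real_complex R)) normcR gtr0_norm.
have nz : n.+1%:R != 0 :> R[i] by rewrite pnatr_eq0.
set v := w / n.+1%:R.
have nv : normc v = normc w / n.+1%:R by rewrite normc_div nn.
have vK : normc v <= K / n.+1%:R by rewrite nv ler_wpM2r// invr_ge0 ltW.
have v1 : normc v <= 1 / 2.
  by rewrite (le_trans vK)// ler_pdivrMr//; lra.
have wv : w = v *+ n.+1 by rewrite -mulr_natr mulfVK.
rewrite {1}wv cexp_natmul.
have hA : normc (cexp v) <= expR (K / n.+1%:R).
  rewrite normc_cexp ler_expR (le_trans _ vK)//.
  exact: le_trans (ler_norm _) (Re_le_normc v).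
have hB : normc (1 + v) <= expR (K / n.+1%:R).
  rewrite (le_trans (le_normcD _ _))// normc1 (le_trans _ (expR_ge1Dx _))//.
  by rewrite lerD2l.
apply: le_trans (power_diff_le _ hA hB) _.
have e1 : expR (K / n.+1%:R) ^+ n <= expR K.
  rewrite -expRM_natl ler_expR.
  rewrite mulrCA ler_piMr ?(ltW K0)// ler_pdivrMr// mul1r ler_nat//.
have e2 : normc (cexp v - (1 + v)) <= 8 * (K / n.+1%:R) ^+ 2.
  rewrite opprD addrA (le_trans (cexpB1x_le v1))// ler_wpM2l//.
  by rewrite lerXn2r// nnegrE ?normc_ge0// divr_ge0// ltW.
apply: le_trans (ler_pM _ _ (ler_wpM2l (ltW n0) e2) e1) _.
- by rewrite mulr_ge0 ?normc_ge0// ltW.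
- by rewrite exprn_ge0// expR_ge0.
rewrite [leLHS](_ : _ = 8 * K ^+ 2 * expR K / n.+1%:R)//.
by field; rewrite gt_eqF.
Qed.

End CExp.

(** * Calculus of uniform limits of polynomials *)

Section PolyLimit.
Context {R : realType}.
Variable Om : set R[i].
Implicit Types (F G : R[i] -> R[i]).

(** Stands in for analyticity: Chebyshev coefficients are only ever estimated for the approximating
    polynomials, whose degree does not matter. *)
Definition poly_limit F := forall e : R, 0 < e -> exists P : {poly R[i]},
  forall t, Om t -> normc (P.[t] - F t) <= e.

Lemma poly_limit_poly (P : {poly R[i]}) : poly_limit (fun t => P.[t]).
Proof. by move=> e e0; exists P => t _; rewrite subrr normc0 ltW. Qed.

Lemma poly_limit_eq F G : (forall t, Om t -> F t = G t) ->
  poly_limit F -> poly_limit G.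
Proof.
by move=> FG h e /h[P hP]; exists P => t Ot; rewrite -FG// hP.
Qed.

Lemma poly_limit_cst (c : R[i]) : poly_limit (fun=> c).
Proof. by apply: poly_limit_eq (poly_limit_poly c%:P) => t _; rewrite hornerC. Qed.

Lemma poly_limit_closed F : (forall e : R, 0 < e -> exists2 G, poly_limit G &
  forall t, Om t -> normc (G t - F t) <= e) -> poly_limit F.
Proof.
move=> h e e0; have e2 : 0 < e / 2 by rewrite divr_gt0.
have [G hG GF] := h _ e2; have [P hP] := hG _ e2; exists P => t Ot.
rewrite (le_trans (normc_distD _ _ (G t)))//.
by have := hP t Ot; have := GF t Ot; lra.
Qed.

Lemma poly_limitD F G : poly_limit F -> poly_limit G ->
  poly_limit (fun t => F t + G t).
Proof.
move=> hF hG e e0; have e2 : 0 < e / 2 by rewrite divr_gt0.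
have [P hP] := hF _ e2; have [Q hQ] := hG _ e2; exists (P + Q) => t Ot.
rewrite hornerD opprD addrACA (le_trans (le_normcD _ _))//.
by have := hP t Ot; have := hQ t Ot; lra.
Qed.

Lemma poly_limitM F G (K : R) : (forall t, Om t -> normc (F t) <= K) ->
  (forall t, Om t -> normc (G t) <= K) -> poly_limit F -> poly_limit G ->
  poly_limit (fun t => F t * G t).
Proof.
move=> FK GK hF hG e e0.
pose K' := `|K| + 1; have K'0 : 0 < K' by rewrite ltr_wpDl.
have KK' : K <= K' by rewrite (le_trans (ler_norm _))// lerDl.
pose d := Num.min 1 (e / (2 * K' + 1)).
have d0 : 0 < d by rewrite lt_min ltr01 divr_gt0//; lra.
have d1 : d <= 1 by rewrite ge_min lexx.
have dK : d * (2 * K' + 1) <= e.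
  by rewrite -ler_pdivlMr ?ge_min ?lexx ?orbT//; lra.
have [P hP] := hF _ d0; have [Q hQ] := hG _ d0; exists (P * Q) => t Ot.
rewrite hornerM.
have -> : P.[t] * Q.[t] - F t * G t =
  (P.[t] - F t) * (Q.[t] - G t) + (P.[t] - F t) * G t + F t * (Q.[t] - G t) by ring.
rewrite (le_trans (le_normcD _ _))// (le_trans (lerD (le_normcD _ _) (lexx _)))//.
rewrite !normcM.
have h1 := hP t Ot; have h2 := hQ t Ot; have h3 := FK t Ot; have h4 := GK t Ot.
have n1 := normc_ge0 (P.[t] - F t); have n2 := normc_ge0 (Q.[t] - G t).
have n3 := normc_ge0 (F t); have n4 := normc_ge0 (G t).
have m1 : normc (P.[t] - F t) * normc (Q.[t] - G t) <= d * 1.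
  by rewrite ler_pM// (le_trans h2).
have m2 : normc (P.[t] - F t) * normc (G t) <= d * K'.
  by rewrite ler_pM// (le_trans h4).
have m3 : normc (F t) * normc (Q.[t] - G t) <= K' * d.
  by rewrite ler_pM// (le_trans h3).
lra.
Qed.

Lemma poly_limitZ (c : R[i]) F : poly_limit F -> poly_limit (fun t => c * F t).
Proof.
move=> hF e e0; have c1 : 0 < normc c + 1 by rewrite ltr_wpDl ?normc_ge0.
have [P hP] := hF _ (divr_gt0 e0 c1); exists (c *: P) => t Ot.
rewrite hornerZ -mulrBr normcM.
have := hP t Ot; rewrite ler_pdivlMr// => h.
have := normc_ge0 (P.[t] - F t); nra.
Qed.

Lemma poly_limitX F (K : R) n : (forall t, Om t -> normc (F t) <= K) ->
  poly_limit F -> poly_limit (fun t => F t ^+ n).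
Proof.
move=> FK hF; elim: n => [|n IH].
  by apply: poly_limit_eq (poly_limit_cst 1) => t _; rewrite expr0.
have K0 : 0 <= `|K| by [].
have FK' t : Om t -> normc (F t) <= `|K|.
  by move=> /FK h; rewrite (le_trans h)// ler_norm.
apply: (@poly_limit_eq (fun t => F t * F t ^+ n)) => [t _|]; first by rewrite exprS.
apply: (@poly_limitM _ _ (Num.max `|K| (`|K| ^+ n))) => // t Ot.
  by rewrite le_max FK'.
by rewrite normcX le_max lerXn2r ?orbT ?nnegrE ?normc_ge0// FK'.
Qed.

Lemma poly_limit_sum_pow F (K : R) n : (forall t, Om t -> normc (F t) <= K) ->
  poly_limit F -> poly_limit (fun t => \sum_(k < n) F t ^+ k).
Proof.
move=> FK hF; elim: n => [|n IH].
  by apply: poly_limit_eq (poly_limit_cst 0) => t _; rewrite big_ord0.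
apply: (@poly_limit_eq (fun t => \sum_(k < n) F t ^+ k + F t ^+ n)) => [t _|].
  by rewrite big_ord_recr.
by apply: poly_limitD => //; exact: poly_limitX FK hF.
Qed.

Lemma exists_pow_le (th e : R) : 0 <= th < 1 -> 0 < e -> exists n, th ^+ n <= e.
Proof.
case/andP => th0 th1 e0.
have : `|th| < 1 by rewrite ger0_norm.
move/cvg_expr/cvgrPdist_le => /(_ e e0)[N _ h]; exists N.
by have := h N (leqnn N); rewrite sub0r normrN ger0_norm// exprn_ge0.
Qed.

(* Points of a compact part of the open right half plane lie, up to a
   scaling, in a disc about 1 of radius less than 1. *)
Lemma right_half_contract (mu K : R) : 0 < mu -> exists2 k0 : R, 0 < k0 &
  exists2 th : R, 0 <= th < 1 & forall z : R[i],
    mu <= complex.Re z -> normc z <= K -> normc (1 - z / k0%:C) <= th.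
Proof.
move=> mu0; pose K' := Num.max K mu.
have K'0 : 0 < K' by rewrite lt_max mu0 orbT.
(* |1 - z/k0|^2 is at most 1 - 2 mu / k0 + K'^2 / k0^2. This k0 minimizes the bound, with value 1 -
   (mu / K')^2. *)
exists (K' ^+ 2 / mu); first by rewrite divr_gt0// exprn_gt0.
have kn : K' ^+ 2 != 0 by rewrite expf_neq0// gt_eqF.
have x0 : 0 < (mu / K') ^+ 2 by rewrite exprn_gt0// divr_gt0.
exists (Num.sqrt (1 - (mu / K') ^+ 2)).
  by rewrite sqrtr_ge0 /= -[ltRHS]sqrtr1 ltr_sqrt// gtrBl.
move=> z zmu zK; rewrite normcEsqrt ler_wsqrtr//.
have zK' : normc z ^+ 2 <= K' ^+ 2.
  by rewrite lerXn2r ?nnegrE ?normc_ge0 ?(ltW K'0)// (le_trans zK)// le_max lexx.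
rewrite -fmorphV cReD cImD cReN cImN cReM cImM /= ?(mulr0, subr0, add0r, addr0).
set k := (K' ^+ 2 / mu)^-1; have k0 : 0 < k by rewrite invr_gt0 divr_gt0// exprn_gt0.
have mk : (mu / K') ^+ 2 = mu * k.
  by rewrite /k; field; rewrite (gt_eqF mu0) (gt_eqF K'0).
have Kk : K' ^+ 2 * k = mu by rewrite /k; field; rewrite (gt_eqF mu0) (gt_eqF K'0).
rewrite mk; move: zK'; rewrite sqr_normcE => zK'.
have h1 : (complex.Re z ^+ 2 + complex.Im z ^+ 2) * k <= mu by rewrite -Kk ler_wpM2r// ltW.
have h2 : (complex.Re z ^+ 2 + complex.Im z ^+ 2) * k * k <= mu * k by rewrite ler_wpM2r// ltW.
have h3 : mu * k <= complex.Re z * k by rewrite ler_wpM2r// ltW.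
by rewrite !expr2 in h1 h2 *; nra.
Qed.

(** Neumann series: F = k0 (1 - v) with |v| <= th < 1 by [right_half_contract], so the partial sums
    of the powers of v converge uniformly. *)
Lemma poly_limit_inv F (mu K : R) : 0 < mu ->
  (forall t, Om t -> mu <= complex.Re (F t)) ->
  (forall t, Om t -> normc (F t) <= K) ->
  poly_limit F -> poly_limit (fun t => (F t)^-1).
Proof.
move=> mu0 Fmu FK hF.
have [k0 k00 [th /andP[th0 th1] hth]] := right_half_contract K mu0.
pose v t := 1 + - (k0%:C)^-1 * F t.
have vE t : v t = 1 - F t / k0%:C by rewrite /v mulNr mulrC.
have k0n : k0%:C != 0 :> R[i] by rewrite -normc_eq0 normcR gtr0_norm// gt_eqF.
have vth t : Om t -> normc (v t) <= th by move=> Ot; rewrite vE hth ?Fmu ?FK.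
have hv : poly_limit v by apply: poly_limitD; [exact: poly_limit_cst|exact: poly_limitZ].
have th1' : 0 < 1 - th by rewrite subr_gt0.
apply: poly_limit_closed => e e0.
have [||n hn] := @exists_pow_le th (e * (k0 * (1 - th))).
- by rewrite th0.
- by rewrite !mulr_gt0.
exists (fun t => (k0%:C)^-1 * \sum_(k < n) v t ^+ k).
  by apply: poly_limitZ; exact: poly_limit_sum_pow vth hv.
move=> t Ot; have vt := vth t Ot.
have lo : 1 - th <= normc (1 - v t).
  have := le_normcD (1 - v t) (v t); rewrite subrK normc1; lra.
have vn : 1 - v t != 0 by rewrite -normc_gt0 (lt_le_trans th1').
have FE : F t = k0%:C * (1 - v t).
  by rewrite vE opprB addrCA subrr addr0 mulrC divfK.
have SE : \sum_(k < n) v t ^+ k = (1 - v t ^+ n) / (1 - v t).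
  apply: (mulIf vn); rewrite divfK// mulrC -[LHS]opprK -mulNr opprB.
  by rewrite -subrX1 opprB.
rewrite SE FE invfM.
have -> : (k0%:C)^-1 * ((1 - v t ^+ n) / (1 - v t)) - (k0%:C)^-1 / (1 - v t) =
  - (v t ^+ n / (k0%:C * (1 - v t))) by field; rewrite vn.
rewrite normcN normc_div normcX normcM normcR gtr0_norm//.
have p0 : 0 < k0 * normc (1 - v t) by rewrite mulr_gt0// normc_gt0.
rewrite ler_pdivrMr//.
apply: le_trans (_ : th ^+ n <= _).
  by rewrite lerXn2r// nnegrE normc_ge0.
by rewrite (le_trans hn)// ler_pM2l// ler_pM2l.
Qed.

(** Visser's iteration, with limit 1 - sqrt(1 - v) for |v| < 1. All iterates are polynomials in v,
    which Newton's iteration for the root would not give. *)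
Fixpoint visser (v : R[i]) n : R[i] :=
  if n is n'.+1 then (v + visser v n' ^+ 2) / 2 else 0.

Lemma normc_nat n : normc (n%:R : R[i]) = n%:R.
Proof. by rewrite -(rmorph_nat (real_complex R)) normcR ger0_norm. Qed.

Lemma visser_le (v : R[i]) (th : R) n : 0 <= th < 1 -> normc v <= th ->
  normc (visser v n) <= th.
Proof.
case/andP => th0 th1 vth; elim: n => [|n IH]; first by rewrite normc0.
rewrite /= normc_div normc_nat ler_pdivrMr// (le_trans (le_normcD _ _))//.
rewrite normcX; have := normc_ge0 (visser v n); nra.
Qed.

(** Consecutive differences factor through the mean of two iterates, whose modulus is at most th. *)
Lemma visser_diff (v : R[i]) (th : R) n : 0 <= th < 1 -> normc v <= th ->
  normc (visser v n.+1 - visser v n) <= th ^+ n.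
Proof.
move=> hth vth; have /andP[th0 th1] := hth; elim: n => [|n IH].
  have := visser_le 1 hth vth; rewrite expr0 [visser v 0]/= subr0 => h.
  by rewrite (le_trans h)// ltW.
have -> : visser v n.+2 - visser v n.+1 =
  (visser v n.+1 - visser v n) * ((visser v n.+1 + visser v n) / 2).
  transitivity ((v + visser v n.+1 ^+ 2) / 2 - (v + visser v n ^+ 2) / 2) => //.
  by move: (visser v n.+1) (visser v n) => a b; field.
rewrite normcM exprSr ler_pM ?normc_ge0// normc_div normc_nat ler_pdivrMr//.
rewrite (le_trans (le_normcD _ _))//.
by have := visser_le n hth vth; have := visser_le n.+1 hth vth; lra.
Qed.

Lemma Re_sqrtc_ge0 (z : R[i]) : 0 <= complex.Re (sqrtc z).
Proof. by case: z => a b; rewrite /= sqrtr_ge0. Qed.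

Lemma poly_limit_sqrt F (mu K : R) : 0 < mu ->
  (forall t, Om t -> mu <= complex.Re (F t)) ->
  (forall t, Om t -> normc (F t) <= K) ->
  poly_limit F -> poly_limit (fun t => sqrtc (F t)).
Proof.
move=> mu0 Fmu FK hF.
have [k0 k00 [th hth' hth]] := right_half_contract K mu0.
have /andP[th0 th1] := hth'.
pose v t := 1 + - (k0%:C)^-1 * F t.
have vE t : v t = 1 - F t / k0%:C by rewrite /v mulNr mulrC.
have k0n : k0%:C != 0 :> R[i] by rewrite -normc_eq0 normcR gtr0_norm// gt_eqF.
have vth t : Om t -> normc (v t) <= th by move=> Ot; rewrite vE hth ?Fmu ?FK.
have hv : poly_limit v by apply: poly_limitD; [exact: poly_limit_cst|exact: poly_limitZ].
have th1' : 0 < 1 - th by rewrite subr_gt0.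
have hy n : poly_limit (fun t => visser (v t) n).
  elim: n => [|n IH]; first exact: poly_limit_cst.
  apply: (@poly_limit_eq (fun t => 2^-1 * (v t + visser (v t) n ^+ 2))) => [t _|].
    by rewrite mulrC.
  apply/poly_limitZ/poly_limitD => //; apply: poly_limitX IH => t Ot.
  by apply: visser_le (vth t Ot).
set s := Num.sqrt k0; have s0 : 0 < s by rewrite sqrtr_gt0.
have s2 : s ^+ 2 = k0 by rewrite sqr_sqrtr// ltW.
apply: poly_limit_closed => e e0.
have [||n hn] := @exists_pow_le th (e * (s * (1 - th)) / (2 * k0)).
- by rewrite th0.
- by rewrite divr_gt0 ?mulr_gt0.
exists (fun t => s%:C * (1 + (- 1) * visser (v t) n)).
  by apply/poly_limitZ/poly_limitD; [exact: poly_limit_cst|exact: poly_limitZ].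
move=> t Ot; have vt := vth t Ot; set y := visser (v t) n.
set S := sqrtc (F t); have S2 : S ^+ 2 = F t := sqr_sqrtc (F t).
have FE : F t = (s ^+ 2)%:C * (1 - v t).
  by rewrite s2 vE opprB addrCA subrr addr0 mulrC divfK.
have yth : normc y <= th := visser_le n hth' vt.
(* Both summands have non-negative real part, the first one at least s (1 - th). This singles out
   the principal root as the limit. *)
have Rs : s * (1 - th) <= normc (s%:C * (1 + -1 * y) + S).
  apply: le_trans (Re_le_normc _); apply: le_trans (ler_norm _).
  rewrite cReD -[leLHS]addr0 lerD ?Re_sqrtc_ge0// cReM /= mul0r subr0 ler_pM2l//.
  rewrite mulN1r cReD cReN /= lerD2l lerN2 (le_trans _ yth)//.
  exact: le_trans (ler_norm _) (Re_le_normc _).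
(* The difference of squares is k0 (y^2 - 2y + v), that is 2 k0 times the next increment of the
   iteration. *)
have E : (s%:C * (1 + -1 * y) - S) * (s%:C * (1 + -1 * y) + S) =
    k0%:C * (2 * (visser (v t) n.+1 - y)).
  have -> : (s%:C * (1 + -1 * y) - S) * (s%:C * (1 + -1 * y) + S) =
    s%:C ^+ 2 * (1 - y) ^+ 2 - S ^+ 2 by ring.
  rewrite S2 FE -rmorphXn /= -/y s2; by field.
have D := visser_diff n hth' vt; rewrite -/y in D.
have p0 : 0 < s * (1 - th) by rewrite mulr_gt0.
rewrite -(ler_pM2r p0) (le_trans (ler_wpM2l (normc_ge0 _) Rs))//.
rewrite -normcM E normcM normcR normcM normc_nat (gtr0_norm k00).
move: hn; rewrite ler_pdivlMr ?mulr_gt0// => hn; apply: le_trans hn.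
have k2 : 0 <= 2 * k0 by rewrite mulr_ge0// ltW.
by have := ler_wpM2r k2 D; lra.
Qed.

Lemma poly_limit_cexp F (K : R) : (forall t, Om t -> normc (F t) <= K) ->
  poly_limit F -> poly_limit (fun t => cexp (F t)).
Proof.
move=> FK hF; pose K' := Num.max K 1.
have K'0 : 0 < K' by rewrite lt_max ltr01 orbT.
have FK' t : Om t -> normc (F t) <= K' by move=> /FK h; rewrite le_max h.
have [N hN] := cexp_approx K'0.
apply: poly_limit_closed => e e0.
set c := 8 * K' ^+ 2 * expR K'.
have c0 : 0 < c by rewrite !mulr_gt0 ?exprn_gt0 ?expR_gt0.
pose n := maxn N (Num.truncn (c / e)).
exists (fun t => (1 + n.+1%:R^-1 * F t) ^+ n.+1).
  apply: (@poly_limitX _ (1 + normc (n.+1%:R^-1 : R[i]) * K')) => [t Ot|].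
    rewrite (le_trans (le_normcD _ _))// normc1 lerD2l normcM.
    by rewrite ler_wpM2l ?normc_ge0 ?FK'.
  by apply: poly_limitD; [exact: poly_limit_cst|exact: poly_limitZ].
move=> t Ot; rewrite normcBC [_^-1 * _]mulrC.
apply: le_trans (hN _ (leq_maxl _ _) _ (FK' t Ot)) _.
rewrite -/c ler_pdivrMr ?ltr0n// mulrC -ler_pdivrMr//.
by rewrite (le_trans (ltW (truncnS_gt _)))// ler_nat ltnS leq_maxr.
Qed.

End PolyLimit.

(** * Analytic continuation of distances along a line *)

Section LineDistance.
Context {R : realType}.

(* d is the distance of a point p of a line to a point outside, al the
   component of this vector along the line, and w a complex displacement of p
   along the line; sqrtc u is the distance continued to p + w. *)
Lemma dist_branch (d al D : R) (w u : R[i]) : 0 < D -> D <= d -> `|al| <= d ->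
  normc w <= D / 8 ->
  u = (d ^+ 2)%:C + 2 * w * al%:C + w ^+ 2 ->
  [/\ D ^+ 2 / 2 <= complex.Re u, normc (sqrtc u - d%:C) <= 3 * normc w &
      D / 2 <= complex.Re (sqrtc u)].
Proof.
move=> D0 Dd ald w8 uE; set S := sqrtc u.
have d0 : 0 < d := lt_le_trans D0 Dd.
have S2 : S ^+ 2 = u := sqr_sqrtc u.
have nw := normc_ge0 w.
have ub : normc (u - (d ^+ 2)%:C) <= normc w * (2 * d + d / 8).
  have -> : u - (d ^+ 2)%:C = w * (2 * al%:C + w) by rewrite uE; ring.
  rewrite normcM ler_wpM2l// (le_trans (le_normcD _ _))//.
  by rewrite normcM normc_nat normcR; lra.
have h1 : normc (u - (d ^+ 2)%:C) <= d ^+ 2 / 2.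
  by apply: le_trans ub _; rewrite expr2; nra.
have Reu : D ^+ 2 / 2 <= complex.Re u.
  have : `|complex.Re (u - (d ^+ 2)%:C)| <= d ^+ 2 / 2 := le_trans (Re_le_normc _) h1.
  rewrite cReD cReN /= ler_norml => /andP[h _].
  have : D ^+ 2 <= d ^+ 2 by rewrite lerXn2r// nnegrE ltW.
  lra.
(* A square root with non-negative real part keeps S + d away from 0, so |u - d^2| controls |S - d|.
   The radius D/8 then leaves Re S >= d - 3D/8 >= D/2. *)
have Sd : d <= normc (S + d%:C).
  apply: le_trans (Re_le_normc _); apply: le_trans (ler_norm _).
  by rewrite cReD /= lerDr Re_sqrtc_ge0.
have h2 : normc (S - d%:C) <= 3 * normc w.
  have : normc (S - d%:C) * normc (S + d%:C) <= normc w * (2 * d + d / 8).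
    rewrite -normcM; have -> : (S - d%:C) * (S + d%:C) = u - (d ^+ 2)%:C.
      by rewrite -S2 rmorphXn; ring.
    exact: ub.
  have := ler_wpM2l (normc_ge0 (S - d%:C)) Sd => h3 h4.
  have {h3 h4}h5 := le_trans h3 h4.
  rewrite -(ler_pM2r d0); nra.
split=> //.
have : `|complex.Re (S - d%:C)| <= 3 * normc w := le_trans (Re_le_normc _) h2.
rewrite cReD cReN /= ler_norml => /andP[h _]; lra.
Qed.

(** Each distance alone may move by 3|w|; the gain is that the difference moves only by a multiple
    of |w| eta / D. Multiplied by a factor of modulus at least D, its deviation becomes a sum of two
    terms, one containing al - al' and the other d' - d. *)
Lemma dist_branch_diff (d al d' al' eta D : R) (w u u' : R[i]) : 0 < D ->
  D <= d -> D <= d' -> `|al| <= d -> `|al'| <= d' -> normc w <= D / 8 ->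
  `|d - d'| <= eta -> `|al - al'| <= eta ->
  u = (d ^+ 2)%:C + 2 * w * al%:C + w ^+ 2 ->
  u' = (d' ^+ 2)%:C + 2 * w * al'%:C + w ^+ 2 ->
  normc ((sqrtc u - sqrtc u') - (d - d')%:C) <= 8 * normc w * eta / D.
Proof.
move=> D0 Dd Dd' ald ald' w8 hd hal uE uE'.
have [_ h1 h2] := dist_branch D0 Dd ald w8 uE.
have [_ h1' h2'] := dist_branch D0 Dd' ald' w8 uE'.
have S2 : sqrtc u ^+ 2 = u := sqr_sqrtc u.
have S2' : sqrtc u' ^+ 2 = u' := sqr_sqrtc u'.
set S := sqrtc u in h1 h2 S2 *; set S' := sqrtc u' in h1' h2' S2' *.
set X := _ - _.
have E : X * (S + d%:C + (S' - d'%:C)) =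
   2 * w * (al - al')%:C + 2 * (S' - d'%:C) * (d' - d)%:C.
  have -> : X * (S + d%:C + (S' - d'%:C)) =
    (S ^+ 2 - (d ^+ 2)%:C) - (S' ^+ 2 - (d' ^+ 2)%:C) + 2 * (S' - d'%:C) * (d' - d)%:C.
    by rewrite /X !rmorphB !rmorphXn; ring.
  by rewrite S2 S2' uE uE' rmorphB; ring.
have nw := normc_ge0 w.
have lo : D <= normc (S + d%:C + (S' - d'%:C)).
  apply: le_trans (Re_le_normc _); apply: le_trans (ler_norm _).
  rewrite cReD [complex.Re (S + _)]cReD /=.
  have : `|complex.Re (S' - d'%:C)| <= 3 * normc w := le_trans (Re_le_normc _) h1'.
  rewrite ler_norml => /andP[h _]; lra.
rewrite ler_pdivlMr// (le_trans (ler_wpM2l (normc_ge0 X) lo))// -normcM E.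
rewrite (le_trans (le_normcD _ _))// !normcM !normcR !normc_nat [`|d' - d|]distrC.
have : normc w * `|al - al'| <= normc w * eta by rewrite ler_wpM2l.
have : normc (S' - d'%:C) * `|d - d'| <= 3 * normc w * eta.
  by rewrite ler_pM ?normc_ge0.
lra.
Qed.

(** Measured from a real point, as [dist_branch] requires; by [jouk_near_unit_itv] it contains the
    ellipse that is the image of the circle of radius 1 + de. *)
Definition near_unit_itv (de : R) : set R[i] :=
  [set t | exists2 t0 : R, -1 <= t0 <= 1 & normc (t - t0%:C) <= de].

(** c and r are the centre and half-length of a box edge, a is the coordinate of the outside point
    in the direction of the edge, and b its squared distance in the two other directions. *)
Definition line_dist (b a c r t : R) : R := Num.sqrt (b + (c + r * t - a) ^+ 2).

Definition line_sqdist (b a c r : R) (t : R[i]) : R[i] :=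
  b%:C + (c%:C + r%:C * t - a%:C) ^+ 2.

Lemma line_sqdistE (b a c r t0 : R) (t : R[i]) : 0 <= b ->
  line_sqdist b a c r t = (line_dist b a c r t0 ^+ 2)%:C +
    2 * (r%:C * (t - t0%:C)) * (c + r * t0 - a)%:C + (r%:C * (t - t0%:C)) ^+ 2.
Proof.
move=> b0; rewrite /line_dist sqr_sqrtr ?addr_ge0 ?sqr_ge0// /line_sqdist.
by rewrite !(rmorphB, rmorphD, rmorphM, rmorphXn); ring.
Qed.

Lemma poly_limit_line_sqdist (Om : set R[i]) b a c r :
  poly_limit Om (line_sqdist b a c r).
Proof.
apply: poly_limit_eq (poly_limit_poly Om
  ((b%:C)%:P + ((c%:C)%:P + r%:C *: 'X - (a%:C)%:P) ^+ 2)) => t _.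
by rewrite !(hornerD, hornerN, hornerXn, horner_exp, hornerZ, hornerC, hornerX).
Qed.

Lemma line_sqdist_bounded (de b a c r : R) : 0 <= de <= 1 -> 0 <= b -> exists K : R,
  forall t, near_unit_itv de t -> normc (line_sqdist b a c r t) <= K.
Proof.
move=> /andP[de0 de1] b0; exists (b + (`|c| + `|r| * 2 + `|a|) ^+ 2).
move=> t [t0 t01 tt0]; have t2 : normc t <= 2.
  have t0n : `|t0| <= 1 by rewrite ler_norml.
  have := normc_distD t 0 t0%:C; rewrite !subr0 normcR; lra.
rewrite (le_trans (le_normcD _ _))// normcR ger0_norm// lerD2l normcX.
rewrite lerXn2r ?nnegrE ?normc_ge0 ?addr_ge0 ?mulr_ge0//.
rewrite (le_trans (le_normcB _ _))// normcR lerD2r (le_trans (le_normcD _ _))//.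
by rewrite normcR lerD2l normcM normcR ler_wpM2l.
Qed.

Lemma line_dist_dir_le (b a c r t0 : R) : 0 <= b ->
  `|c + r * t0 - a| <= line_dist b a c r t0.
Proof. by move=> b0; rewrite -sqrtr_sqr ler_wsqrtr// lerDr. Qed.

Section Continuation.
Variables (D c r de : R).
Hypotheses (D0 : 0 < D) (r0 : 0 < r) (de1 : 0 < de <= 1) (rde : r * de <= D / 8).

Let Om := near_unit_itv de.

Lemma displacement_le t t0 : normc (t - t0%:C) <= de ->
  normc (r%:C * (t - t0%:C)) <= D / 8.
Proof.
by move=> h; rewrite normcM normcR gtr0_norm// (le_trans _ rde)// ler_pM2l.
Qed.

Section OnePoint.
Variables (b a : R).
Hypotheses (b0 : 0 <= b) (hd : forall t, -1 <= t <= 1 -> D <= line_dist b a c r t).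

Lemma Re_line_sqdist t : Om t -> D ^+ 2 / 2 <= complex.Re (line_sqdist b a c r t).
Proof.
move=> [t0 t01 tt0]; have [//] := dist_branch D0 (hd t01) (line_dist_dir_le _ _ _ _ b0)
  (displacement_le tt0) (line_sqdistE a c r t0 t b0).
Qed.

Lemma Re_line_sqrt t : Om t -> D / 2 <= complex.Re (sqrtc (line_sqdist b a c r t)).
Proof.
move=> [t0 t01 tt0]; have [//] := dist_branch D0 (hd t01) (line_dist_dir_le _ _ _ _ b0)
  (displacement_le tt0) (line_sqdistE a c r t0 t b0).
Qed.

Lemma line_sqrt_real t : sqrtc (line_sqdist b a c r t%:C) = (line_dist b a c r t)%:C.
Proof.
rewrite (line_sqdistE a c r t _ b0) subrr !mulr0 mul0r [0 ^+ 2]expr2 mulr0 !addr0.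
by rewrite sqrtc_sqrtr ?lecR ?sqr_ge0//= sqrtr_sqr ger0_norm// sqrtr_ge0.
Qed.

Lemma line_sqrt_bounded : exists K : R,
  forall t, Om t -> normc (sqrtc (line_sqdist b a c r t)) <= K.
Proof.
have [K hK] : exists K : R, forall t, Om t -> normc (line_sqdist b a c r t) <= K.
  by apply: line_sqdist_bounded => //; case/andP: de1 => /ltW -> ->.
exists (1 + K) => t Ot; have := hK t Ot.
rewrite -{1}(sqr_sqrtc (line_sqdist b a c r t)) normcX.
have := normc_ge0 (sqrtc (line_sqdist b a c r t)); nra.
Qed.

Lemma poly_limit_line_sqrt : poly_limit Om (fun t => sqrtc (line_sqdist b a c r t)).
Proof.
have [K hK] : exists K : R, forall t, Om t -> normc (line_sqdist b a c r t) <= K.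
  by apply: line_sqdist_bounded => //; case/andP: de1 => /ltW -> ->.
apply: (@poly_limit_sqrt _ _ _ (D ^+ 2 / 2) K) => //.
- by rewrite divr_gt0// exprn_gt0.
- exact: Re_line_sqdist.
- exact: poly_limit_line_sqdist.
Qed.

Lemma poly_limit_line_inv :
  poly_limit Om (fun t => (sqrtc (line_sqdist b a c r t))^-1).
Proof.
have [K hK] := line_sqrt_bounded.
apply: (@poly_limit_inv _ _ _ (D / 2) K) => //; first by rewrite divr_gt0.
- exact: Re_line_sqrt.
- exact: poly_limit_line_sqrt.
Qed.

Lemma line_inv_le t : Om t -> normc ((sqrtc (line_sqdist b a c r t))^-1) <= 2 / D.
Proof.
move=> Ot; rewrite normcV -[2 / D]invf_div.
have h : D / 2 <= normc (sqrtc (line_sqdist b a c r t)).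
  apply: le_trans (Re_line_sqrt Ot) _.
  exact: le_trans (ler_norm _) (Re_le_normc _).
by rewrite lef_pV2// posrE ?divr_gt0// (lt_le_trans _ h)// divr_gt0.
Qed.

End OnePoint.

Section TwoPoints.
Variables (b a b' a' eta kappa : R).
Hypotheses (b0 : 0 <= b) (hd : forall t, -1 <= t <= 1 -> D <= line_dist b a c r t).
Hypotheses (b0' : 0 <= b') (hd' : forall t, -1 <= t <= 1 -> D <= line_dist b' a' c r t).
Hypotheses (kappa0 : 0 <= kappa) (haa : `|a - a'| <= eta).
Hypothesis hdd : forall t, -1 <= t <= 1 ->
  `|line_dist b a c r t - line_dist b' a' c r t| <= eta.

Definition line_phase (t : R[i]) : R[i] := cexp ((0 +i* kappa) *
  (sqrtc (line_sqdist b a c r t) - sqrtc (line_sqdist b' a' c r t))).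

Lemma line_phase_real t :
  line_phase t%:C = expi (kappa * (line_dist b a c r t - line_dist b' a' c r t)).
Proof.
rewrite /line_phase !line_sqrt_real// -cexp_imag; congr cexp.
set x := line_dist b a c r t; set y := line_dist b' a' c r t.
have -> : x%:C - y%:C = (x - y)%:C by rewrite rmorphB.
by apply/eqP; rewrite eq_complex cReM cImM /= mul0r mulr0 subrr mul0r add0r !eqxx.
Qed.

Lemma poly_limit_line_phase : poly_limit Om line_phase.
Proof.
have [K hK] := line_sqrt_bounded a b0; have [K' hK'] := line_sqrt_bounded a' b0'.
apply: (@poly_limit_cexp _ _ _ (kappa * (K + K'))) => [t Ot|].
  rewrite normcM normcEsqrt /= expr0n add0r sqrtr_sqr ger0_norm// ler_wpM2l//.
  by rewrite (le_trans (le_normcB _ _))// lerD ?hK ?hK'.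
apply: poly_limitZ.
apply: (@poly_limit_eq _ _ (fun t => sqrtc (line_sqdist b a c r t) +
   (-1) * sqrtc (line_sqdist b' a' c r t))) => [t _|]; first by rewrite mulN1r.
apply: poly_limitD; first exact: poly_limit_line_sqrt.
by apply: poly_limitZ; exact: poly_limit_line_sqrt.
Qed.

(** The modulus of the exponential sees only imaginary parts, where the real difference of the
    distances drops out; [dist_branch_diff] bounds the rest. Thus kappa enters only in the product
    kappa r eta, which (A2) controls. *)
Lemma line_phase_le t : Om t ->
  normc (line_phase t) <= expR (8 * (kappa * r * eta) * de / D).
Proof.
move=> [t0 t01 tt0]; rewrite normc_cexp ler_expR.
have h := dist_branch_diff D0 (hd t01) (hd' t01) (line_dist_dir_le _ _ _ _ b0)
  (line_dist_dir_le _ _ _ _ b0') (displacement_le tt0) (hdd t01)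
  (_ : `|c + r * t0 - a - (c + r * t0 - a')| <= eta)
  (line_sqdistE a c r t0 t b0) (line_sqdistE a' c r t0 t b0').
rewrite cReM /= mul0r add0r.
have eta0 : 0 <= eta := le_trans (normr_ge0 _) haa.
have {}h : `|complex.Im (sqrtc (line_sqdist b a c r t) - sqrtc (line_sqdist b' a' c r t))|
    <= 8 * (r * de) * eta / D.
  have {}h := h (_ : _); apply: le_trans (_ : _ <= 8 * normc (r%:C * (t - t0%:C)) * eta / D) _.
    have := le_trans (Im_le_normc _) (h _); rewrite cImD cImN /= subr0; apply.
    by rewrite opprB addrC subrKA distrC.
  rewrite ler_wpM2r ?invr_ge0 ?(ltW D0)// ler_wpM2r// ler_wpM2l//.
  by rewrite normcM normcR gtr0_norm// ler_pM2l.
apply: le_trans (ler_norm _) _; rewrite normrN normrM ger0_norm//.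
apply: le_trans (ler_wpM2l kappa0 h) _.
by rewrite [leLHS](_ : _ = 8 * (kappa * r * eta) * de / D)//; ring.
Qed.

End TwoPoints.
End Continuation.

End LineDistance.

(** * Best approximation on lines and tensor interpolation *)

Section BestApproximation.
Context {R : realType}.
Implicit Types (z : R[i]).

(** The nearby real point is the image of u = z / rho on the unit circle; jouk z - jouk u consists
    of terms of modulus (rho - 1)/2 and (1 - 1/rho)/2. *)
Lemma jouk_near_unit_itv (de : R) z : 0 < de -> normc z = 1 + de ->
  near_unit_itv de (jouk z).
Proof.
move=> de0 zde; set rho := 1 + de in zde *.
have rho0 : 0 < rho by rewrite addr_gt0.
have rn : rho%:C != 0 :> R[i] by rewrite -normc_eq0 normcR gtr0_norm// gt_eqF.
pose u : R[i] := z / rho%:C.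
have u1 : normc u = 1 by rewrite normc_div zde normcR gtr0_norm// divff// gt_eqF.
have un : u != 0 by rewrite -normc_eq0 u1 oner_neq0.
exists (complex.Re u); first by rewrite -ler_norml -u1 Re_le_normc.
rewrite -jouk_unit//.
have zE : z = rho%:C * u by rewrite /u mulrC divfK.
clearbody u.
have -> : jouk z - jouk u = ((rho - 1)%:C * u - (1 - rho^-1)%:C * u^-1) / 2.
  rewrite /jouk zE !rmorphB rmorph1 fmorphV; by field; rewrite un rn.
rewrite normc_div normc_nat ler_pdivrMr// (le_trans (le_normcB _ _))//.
rewrite !normcM !normcR normcV u1 invr1 !mulr1.
have r1 : rho^-1 <= 1 by rewrite invf_le1// lerDl ltW.
have r2 : 1 - rho^-1 <= de.
  have : rho * rho^-1 = 1 by rewrite mulfV// gt_eqF.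
  have : 0 < rho^-1 by rewrite invr_gt0.
  by rewrite /rho => ? ?; nra.
rewrite !ger0_norm ?subr_ge0//; last by rewrite lerDl ltW.
by rewrite /rho in r2 *; lra.
Qed.

Lemma real_near_unit_itv (de t : R) : 0 < de -> -1 <= t <= 1 ->
  near_unit_itv de t%:C.
Proof. by move=> de0 t1; exists t => //; rewrite subrr normc0 ltW. Qed.

Lemma poly_bounded_near (de : R) (P : {poly R[i]}) : 0 < de -> exists K : R,
  forall t, near_unit_itv de t -> normc P.[t] <= K.
Proof.
move=> de0; elim/poly_ind: P => [|P c [K hK]].
  by exists 0 => t _; rewrite horner0 normc0.
exists (`|K| * (1 + de) + normc c) => t Ot.
rewrite hornerMXaddC (le_trans (le_normcD _ _))// lerD2r normcM.
apply: ler_pM; rewrite ?normc_ge0 ?(le_trans (hK t Ot)) ?ler_norm//.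
case: Ot => t0 t01 tt0; have t0n : `|t0| <= 1 by rewrite ler_norml.
have := normc_distD t 0 t0%:C; rewrite !subr0 normcR; lra.
Qed.

Lemma limit_truncation (de M : R) (F : R[i] -> R[i]) (m : nat) : 0 < de <= 1 ->
  0 < M -> poly_limit (near_unit_itv de) F ->
  (forall z, normc z = 1 + de -> normc (F (jouk z)) <= M) ->
  exists2 Q : {poly R[i]}, (size Q <= m.+1)%N &
    forall t : R, -1 <= t <= 1 ->
      normc (F t%:C - Q.[t%:C]) <= 5 * M / de * (1 + de)^-1 ^+ m.
Proof.
move=> /andP[de0 de1] M0 hF FM; set x := (1 + de)^-1.
have x0 : 0 < x by rewrite invr_gt0 addr_gt0.
have x1 : x <= 1 by rewrite invf_le1 ?addr_gt0// lerDl ltW.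
have xm0 : 0 < x ^+ m by rewrite exprn_gt0.
have xm1 : x ^+ m <= 1 by rewrite exprn_ile1// ltW.
(* At accuracy M x^m the polynomial is still bounded by 2M on the ellipse. Truncating it costs 4M/de
   x^m, and the approximation itself makes the 4 a 5. *)
have [P hP] := hF _ (mulr_gt0 M0 xm0).
have PM z : normc z = 1 + de -> normc P.[jouk z] <= 2 * M.
  move=> zde; have h1 := hP _ (jouk_near_unit_itv de0 zde).
  have h2 := FM z zde; have := normc_distD P.[jouk z] 0 (F (jouk z)).
  have : M * x ^+ m <= M by rewrite ler_piMr// ltW.
  rewrite !subr0; lra.
have rho1 : 1 < 1 + de by rewrite ltrDl.
have [Q sQ hQ] := cheb_truncation m rho1 PM.
exists Q => // t t1; rewrite (le_trans (normc_distD _ _ P.[t%:C]))//.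
have h1 := hP _ (real_near_unit_itv de0 t1); rewrite normcBC in h1.
have := hQ t t1; rewrite -/x addrAC subrr add0r => h2.
have h3 : M * x ^+ m <= M * x ^+ m / de.
  by rewrite ler_peMr ?mulr_ge0 ?(ltW M0) ?(ltW xm0)// invf_ge1.
rewrite (le_trans (lerD h1 h2))// (le_trans (lerD h3 (lexx _)))//.
by rewrite [leLHS](_ : _ = 5 * M / de * x ^+ m)//; ring.
Qed.

End BestApproximation.

Section LineApproximation.
Context {R : realType}.
Variables (D c r de b a b' a' eta kappa : R).
Hypotheses (D0 : 0 < D) (r0 : 0 < r) (de1 : 0 < de <= 1) (rde : r * de <= D / 8).
Hypotheses (b0 : 0 <= b) (hd : forall t, -1 <= t <= 1 -> D <= line_dist b a c r t).
Hypotheses (b0' : 0 <= b') (hd' : forall t, -1 <= t <= 1 -> D <= line_dist b' a' c r t).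
Hypotheses (kappa0 : 0 <= kappa) (haa : `|a - a'| <= eta).
Hypothesis hdd : forall t, -1 <= t <= 1 ->
  `|line_dist b a c r t - line_dist b' a' c r t| <= eta.

Let x := (1 + de)^-1.
Let G := expR (8 * (kappa * r * eta) * de / D).
Let phase t : R[i] := expi (kappa * (line_dist b a c r t - line_dist b' a' c r t)).

Let phaseG t : near_unit_itv de t -> normc (line_phase c r b a b' a' kappa t) <= G.
Proof. exact: (line_phase_le D0 r0 rde b0 hd b0' hd' kappa0 haa hdd). Qed.

Let invG t : near_unit_itv de t -> normc (sqrtc (line_sqdist b a c r t))^-1 <= 2 / D.
Proof. exact: (line_inv_le D0 r0 rde b0 hd). Qed.

Lemma helmholtz_line_approx m : exists2 Q : {poly R[i]}, (size Q <= m.+1)%N &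
  forall t : R, -1 <= t <= 1 ->
    normc (phase t / (line_dist b a c r t)%:C - Q.[t%:C]) <=
    5 * (G * (2 / D)) / de * x ^+ m.
Proof.
have /andP[de0 _] := de1.
pose F t := line_phase c r b a b' a' kappa t * (sqrtc (line_sqdist b a c r t))^-1.
have [||z zde|Q sQ hQ] := @limit_truncation _ de (G * (2 / D)) F m de1.
- by rewrite !mulr_gt0 ?expR_gt0 ?invr_gt0.
- apply: (@poly_limitM _ _ _ _ (G + 2 / D)) => [t Ot|t Ot||].
  + have h : 0 <= 2 / D by rewrite divr_ge0// ltW.
    by apply: le_trans (phaseG Ot) _; rewrite lerDl.
  + by apply: le_trans (invG Ot) _; rewrite lerDr expR_ge0.
  + exact: (poly_limit_line_phase (D := D)).
  + exact: (poly_limit_line_inv (D := D)).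
- have Ot := jouk_near_unit_itv de0 zde.
  rewrite normcM ler_pM ?normc_ge0//; first exact: phaseG.
  exact: invG.
- exists Q => // t t1; have := hQ t t1.
  by rewrite /F line_phase_real// line_sqrt_real// fmorphV.
Qed.

(** p is given in the reference coordinate of the larger box, and al t + be converts from that of
    the smaller one. [jouk_affine] shrinks the radius 1 + de to 1 + sqrt(q) de, where
    [bernstein_growth] applies to p. *)
Lemma phase_poly_line_approx (p : {poly R[i]}) (al be q A : R) m :
  (size p <= m.+1)%N -> 0 < A ->
  (forall s : R, -1 <= s <= 1 -> normc p.[s%:C] <= A) ->
  0 < al -> al <= q -> q < 1 -> `|be| <= 1 - al ->
  exists2 Q : {poly R[i]}, (size Q <= m.+1)%N &
  forall t : R, -1 <= t <= 1 ->
    normc (phase t * p.[(al * t + be)%:C] - Q.[t%:C]) <=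
    5 * (G * (2 * m.+1%:R * A * (1 + Num.sqrt q * de) ^+ m)) / de * x ^+ m.
Proof.
move=> sp A0 pA al0 alq q1 hbe; have /andP[de0 _] := de1.
pose p' := p \Po (al%:C *: 'X + be%:C%:P).
have p'E t : p'.[t] = p.[al%:C * t + be%:C].
  by rewrite horner_comp hornerD hornerZ hornerX hornerC.
pose F t := line_phase c r b a b' a' kappa t * p'.[t].
set B := 2 * m.+1%:R * A * (1 + Num.sqrt q * de) ^+ m.
have R0 : 0 < 1 + Num.sqrt q * de by rewrite ltr_pwDl// mulr_ge0 ?sqrtr_ge0 ?ltW.
have B0 : 0 < B by rewrite !mulr_gt0// ?ltr0n// exprn_gt0.
have [||z zde|Q sQ hQ] := @limit_truncation _ de (G * B) F m de1.
- by rewrite mulr_gt0 ?expR_gt0.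
- have [K hK] := poly_bounded_near p' de0.
  apply: (@poly_limitM _ _ _ _ (Num.max G K)) => [t Ot|t Ot||].
  + by rewrite le_max phaseG.
  + by rewrite le_max hK ?orbT.
  + exact: (poly_limit_line_phase (D := D)).
  + exact: poly_limit_poly.
- have Ot := jouk_near_unit_itv de0 zde.
  rewrite normcM ler_pM ?normc_ge0//; first exact: phaseG.
  have [|u u1 ju] := jouk_affine al0 alq q1 hbe _ zde; first by rewrite ltrDl.
  rewrite p'E -ju; apply: bernstein_growth => //.
  by move: u1; rewrite [X in Num.sqrt q * X]addrAC subrr add0r.
- exists Q => // t t1; have := hQ t t1.
  by rewrite /F line_phase_real// p'E rmorphD rmorphM.
Qed.

End LineApproximation.

(** * Lagrange interpolation in one variable *)

Section Lagrange.
Context {R : realType}.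
Variables (m : nat) (xi : 'I_m.+1 -> R).
Hypotheses (xi_inj : injective xi) (xi_range : forall j, xi j \in `[-1, 1]).

Lemma size_lagrange j : (size (lagrange xi j) <= m.+1)%N.
Proof.
rewrite (leq_trans (size_poly_prod_leq _ _))// leq_subLR.
apply: (@leq_trans (\sum_(k < m.+1 | k != j) 2).+1).
  rewrite ltnS leq_sum// => k _; rewrite (leq_trans (size_scale_leq _ _))//.
  by rewrite size_XsubC.
have cj : #|[pred k : 'I_m.+1 | k != j]| = m by rewrite cardC1 card_ord.
by rewrite sum_nat_const cj muln2 -addnn addnS ltnS.
Qed.

Lemma lagrange_node j k : (lagrange xi j).[xi k] = (j == k)%:R.
Proof.
rewrite horner_prod; case: eqVneq => [<-|jk].
  apply: big1 => l lj; rewrite hornerZ hornerXsubC mulVf// subr_eq0.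
  by apply: contra lj => /eqP/xi_inj ->.
rewrite (bigD1 k) 1?eq_sym//= hornerZ hornerXsubC subrr mulr0 mul0r//.
Qed.

(** The difference has degree at most m and m + 1 distinct roots. *)
Lemma interp_poly (Q : {poly R[i]}) (t : R) : (size Q <= m.+1)%N ->
  \sum_(j < m.+1) Q.[(xi j)%:C] * ((lagrange xi j).[t])%:C = Q.[t%:C].
Proof.
move=> sQ.
pose P := \sum_(j < m.+1) Q.[(xi j)%:C] *: map_poly (real_complex R) (lagrange xi j) - Q.
have PE s : P.[s%:C] = \sum_(j < m.+1) Q.[(xi j)%:C] * ((lagrange xi j).[s])%:C - Q.[s%:C].
  rewrite hornerD hornerN horner_sum; congr (_ - _); apply: eq_bigr => j _.
  by rewrite hornerZ (horner_map (real_complex R)).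
have P0 : P = 0.
  apply: (@roots_geq_poly_eq0 _ P [seq (xi k)%:C | k <- enum 'I_m.+1]).
  - apply/allP => _ /mapP[k _ ->]; rewrite /root PE subr_eq0 (bigD1 k)//=.
    rewrite lagrange_node eqxx mulr1 big1 ?addr0// => l lk.
    by rewrite lagrange_node (negbTE lk) mulr0.
  - by rewrite map_inj_uniq ?enum_uniq// => k l /complexI/xi_inj.
  - rewrite size_map size_enum_ord (leq_trans (size_polyD _ _))// geq_max size_polyN sQ andbT.
    rewrite (leq_trans (size_sum _ _ _))//; apply/bigmax_leqP => j _.
    rewrite (leq_trans (size_scale_leq _ _))// size_map_poly size_lagrange//.
by apply/eqP; rewrite -subr_eq0 -PE P0 horner0.
Qed.

(** The operator norm is tested with a continuous function whose value at node k is the sign of the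
    k-th Lagrange polynomial at t: the interpolant of these signs, clamped to [-1, 1], which keeps
    the node values. *)
Lemma lebesgue_sum (La t : R) : (lebesgue_const xi <= La%:E)%E -> -1 <= t <= 1 ->
  \sum_(j < m.+1) `|(lagrange xi j).[t]| <= La.
Proof.
move=> hLa t1.
pose P := \sum_(j < m.+1) Num.sg (lagrange xi j).[t] *: lagrange xi j.
have PE k : P.[xi k] = Num.sg (lagrange xi k).[t].
  rewrite horner_sum (bigD1 k)//= hornerZ lagrange_node eqxx mulr1 big1 ?addr0//.
  by move=> l lk; rewrite hornerZ lagrange_node (negbTE lk) mulr0.
pose g (s : R) : R := Num.min 1 (Num.max (-1) P.[s]).
have gle s : -1 <= g s <= 1 by rewrite le_min ge_min le_max !lexx /= (le_trans (lerN10 _) ler01).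
have cg : continuous g.
  move=> s.
  apply: (@continuous_min R R (cst 1 : R -> R^o) (fun s => Num.max (-1) P.[s] : R^o)).
    exact: cvg_cst.
  apply: (@continuous_max R R (cst (-1) : R -> R^o) (horner P : R -> R^o)).
    exact: cvg_cst.
  exact: continuous_horner.
have h : ((normc (interp xi (fun s => (g s)%:C) t))%:E <= La%:E)%E.
  apply: le_trans hLa; apply: ereal_sup_ubound.
  exists (fun s => (g s)%:C, t) => //; split => //=.
  - exact: continuous_subspaceT.
  - by apply: continuous_subspaceT => s; exact: cvg_cst.
  - by move=> s _; have := gle s; rewrite -ler_norml -normcR.
rewrite lee_fin in h; apply: le_trans h.
have -> : interp xi (fun s => (g s)%:C) t = (\sum_(j < m.+1) `|(lagrange xi j).[t]|)%:C.
  rewrite /interp rmorph_sum; apply: eq_bigr => j _ /=; rewrite -rmorphM; congr (_%:C).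
  rewrite /g PE normrEsg; congr (_ * _).
  have := normr_sg (lagrange xi j).[t].
  have : `|Num.sg (lagrange xi j).[t]| <= 1 by rewrite normr_sg; case: eqP.
  rewrite ler_norml => /andP[s1 s2] _.
  by rewrite (max_idPr s1) (min_idPr s2).
by rewrite normcR ler_norm.
Qed.

End Lagrange.

(** * Stability and error of tensor interpolation *)

Section TensorInterpolation.
Context {R : realType}.

Definition upd (x : 'rV[R]_3) (i : 'I_3) (v : R) : 'rV[R]_3 :=
  \row_k if k == i then v else x 0 k.

Lemma updE x i v k : upd x i v 0 k = if k == i then v else x 0 k.
Proof. by rewrite mxE. Qed.

Lemma to_box_bounds (B : box R) i t : -1 <= t <= 1 ->
  lo B 0 i <= to_box B i t <= hi B 0 i.
Proof.
by move=> /andP[t1 t2]; have := lo_lt_hi B i; rewrite /to_box => lh; apply/andP; split; nra.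
Qed.

Lemma upd_box (B : box R) x i t : box_set B x -> -1 <= t <= 1 -> box_set B (upd x i (to_box B i t)).
Proof.
by move=> Bx t1 k; rewrite updE; case: eqP => [->|_]; [exact: to_box_bounds|exact: Bx].
Qed.

Lemma from_boxK (B : box R) i v : to_box B i (from_box B i v) = v.
Proof.
rewrite /to_box /from_box; field; rewrite subr_eq0 gt_eqF//; exact: lo_lt_hi.
Qed.

Lemma to_boxK (B : box R) i t : from_box B i (to_box B i t) = t.
Proof.
rewrite /to_box /from_box; field; rewrite subr_eq0 gt_eqF//; exact: lo_lt_hi.
Qed.

Lemma from_box_bounds (B : box R) (x : 'rV[R]_3) i : box_set B x ->
  -1 <= from_box B i (x 0 i) <= 1.
Proof.
move=> /(_ i) /andP[x1 x2]; have lh := lo_lt_hi B i.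
have d0 : 0 < hi B 0 i - lo B 0 i by rewrite subr_gt0.
by rewrite /from_box ler_pdivlMr// ler_pdivrMr//; apply/andP; split; lra.
Qed.

Lemma upd_from_box (B : box R) x i : upd x i (to_box B i (from_box B i (x 0 i))) = x.
Proof. by apply/rowP => k; rewrite updE from_boxK; case: eqP => [->|]. Qed.

Variables (m : nat) (xi : 'I_m.+1 -> R) (B : box R).
Hypotheses (xi_inj : injective xi) (xi_range : forall j, xi j \in `[-1, 1]).

Definition interp1 (i : 'I_3) (f : 'rV[R]_3 -> R[i]) (x : 'rV[R]_3) : R[i] :=
  \sum_(j < m.+1) f (upd x i (to_box B i (xi j))) *
    ((lagrange xi j).[from_box B i (x 0 i)])%:C.

Let o0 : 'I_3 := @Ordinal 3 0 isT.
Let o1 : 'I_3 := @Ordinal 3 1 isT.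
Let o2 : 'I_3 := @Ordinal 3 2 isT.

(** Reduces the operator to one coordinate direction at a time. *)
Lemma tensor_interpE f x :
  tensor_interp xi B f x = interp1 o0 (interp1 o1 (interp1 o2 f)) x.
Proof.
pose h (p : 'I_m.+1 * ('I_m.+1 * 'I_m.+1)) : {ffun 'I_3 -> 'I_m.+1} :=
  [ffun i : 'I_3 => if i == o0 then p.1 else if i == o1 then p.2.1 else p.2.2].
pose h' (nu : {ffun 'I_3 -> 'I_m.+1}) := (nu o0, (nu o1, nu o2)).
rewrite /tensor_interp (reindex h); last first.
  exists h' => [[a [b c]] _|nu _]; first by rewrite /h' !ffunE.
  apply/ffunP => i; rewrite ffunE /=.
  by case: i => [[|[|[|//]]] p]; rewrite /= ?(eqE, mxE) /=; congr (nu _); apply: val_inj.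
rewrite -(pair_big xpredT xpredT (fun a bc => f (\row_i to_box B i (xi (h (a, bc) i))) *
   (\prod_(i < 3) (lagrange xi (h (a, bc) i)).[from_box B i (x 0 i)])%:C)) /=.
apply: eq_bigr => a _; rewrite [interp1 o1 _ _]/interp1 mulr_suml.
rewrite -(pair_big xpredT xpredT (fun b c => f (\row_i to_box B i (xi (h (a, (b, c)) i))) *
   (\prod_(i < 3) (lagrange xi (h (a, (b, c)) i)).[from_box B i (x 0 i)])%:C)) /=.
apply: eq_bigr => b _; rewrite [interp1 o2 _ _]/interp1 !mulr_suml.
apply: eq_bigr => c _; rewrite -!mulrA; congr (f _ * _).
  apply/rowP => i; rewrite !mxE ffunE /=.
  by case: i => [[|[|[|//]]] p] /=; congr (to_box B _ _); apply: val_inj.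
rewrite !big_ord_recl big_ord0 mulr1 !updE !ffunE /= !rmorphM /=.
have -> : lift ord0 ord0 = o1 by apply: val_inj.
have -> : lift ord0 (lift ord0 ord0) = o2 by apply: val_inj.
have -> : ord0 = o0 by apply: val_inj.
by rewrite [RHS]mulrCA [RHS]mulrA [RHS]mulrC mulrA.
Qed.

Variable La : R.
Hypothesis hLa : forall t : R, -1 <= t <= 1 -> \sum_(j < m.+1) `|(lagrange xi j).[t]| <= La.

Lemma xi_bounds j : -1 <= xi j <= 1.
Proof. by have := xi_range j; rewrite in_itv. Qed.

Lemma La_ge0 : 0 <= La.
Proof. by apply: le_trans (hLa (_ : -1 <= 0 <= 1)); rewrite ?sumr_ge0// lerN10 ler01. Qed.

Lemma interp1_le i f (A : R) : (forall x, box_set B x -> normc (f x) <= A) ->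
  forall x, box_set B x -> normc (interp1 i f x) <= La * A.
Proof.
move=> fA x Bx; have A0 : 0 <= A := le_trans (normc_ge0 _) (fA x Bx).
apply: le_trans (ler_sum_normc _ _ _) _.
apply: le_trans (ler_wpM2r A0 (hLa (from_box_bounds i Bx))).
rewrite mulr_suml; apply: ler_sum => j _; rewrite normcM normcR mulrC ler_wpM2l//.
by apply: fA; apply: upd_box => //; exact: xi_bounds.
Qed.

Lemma interp1B i f g x : interp1 i f x - interp1 i g x = interp1 i (fun y => f y - g y) x.
Proof. by rewrite /interp1 -sumrB; apply: eq_bigr => j _; rewrite mulrBl. Qed.

(** The polynomial may depend on the axis-parallel segment; the direction-by-direction argument asks
    for no joint approximant in three variables. *)
Definition line_approx (f : 'rV[R]_3 -> R[i]) (E : R) := forall x, box_set B x -> forall i,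
  exists2 Q : {poly R[i]}, (size Q <= m.+1)%N &
    forall t, -1 <= t <= 1 -> normc (f (upd x i (to_box B i t)) - Q.[t%:C]) <= E.

(** Interpolation reproduces Q, so the error for f is the error for f - Q. *)
Lemma interp1_error i f E x : line_approx f E -> box_set B x ->
  normc (f x - interp1 i f x) <= (1 + La) * E.
Proof.
move=> hf Bx; have [Q sQ hQ] := hf x Bx i.
have t1 := from_box_bounds i Bx.
have h1 := hQ _ t1; rewrite upd_from_box in h1.
have E0 : 0 <= E := le_trans (normc_ge0 _) h1.
rewrite mulrDl mul1r (le_trans (normc_distD _ _ Q.[(from_box B i (x 0 i))%:C]))// lerD//.
rewrite -(interp_poly xi_inj (from_box B i (x 0 i)) sQ) -sumrB (le_trans (ler_sum_normc _ _ _))//.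
apply: le_trans (ler_wpM2r E0 (hLa t1)).
rewrite mulr_suml; apply: ler_sum => j _; rewrite -mulrBl normcM normcR mulrC ler_wpM2l//.
by rewrite normcBC; apply: hQ; exact: xi_bounds.
Qed.

Lemma tensor_interp_le f (A : R) : (forall x, box_set B x -> normc (f x) <= A) ->
  forall x, box_set B x -> normc (tensor_interp xi B f x) <= La ^+ 3 * A.
Proof.
move=> fA x Bx; rewrite tensor_interpE 3!exprS expr0 mulr1 -!mulrA.
by do 3![apply: interp1_le => // {Bx} x Bx || apply: fA].
Qed.

Lemma tensor_interp_error f (E : R) : line_approx f E ->
  forall x, box_set B x -> normc (f x - tensor_interp xi B f x) <= (1 + La) ^+ 3 * E.
Proof.
move=> hf x Bx; rewrite tensor_interpE.
have L0 := La_ge0.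
have E0 : 0 <= E.
  have [Q _ hQ] := hf x Bx o0; apply: le_trans (hQ 0 _); first exact: normc_ge0.
  by rewrite lerN10 ler01.
have e i y : box_set B y -> normc (f y - interp1 i f y) <= (1 + La) * E by exact: interp1_error.
have h0 := e o0 x Bx.
have h1 : normc (interp1 o0 f x - interp1 o0 (interp1 o1 f) x) <= La * ((1 + La) * E).
  by rewrite interp1B; apply: interp1_le => // y By; exact: e.
have h2 : normc (interp1 o0 (interp1 o1 f) x - interp1 o0 (interp1 o1 (interp1 o2 f)) x) <=
    La * (La * ((1 + La) * E)).
  rewrite interp1B; apply: interp1_le => // y By; rewrite interp1B.
  by apply: interp1_le => // z Bz; exact: e.
(* Telescoping over the directions: the three errors carry the factors 1, La and La^2, with sum at
   most (1 + La)^2. *)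
apply: le_trans (normc_distD _ _ (interp1 o0 f x)) _.
apply: le_trans (lerD (lexx _) (normc_distD _ _ (interp1 o0 (interp1 o1 f) x))) _.
apply: le_trans (lerD h0 (lerD h1 h2)) _.
have : 0 <= (1 + La) * E * La by rewrite !mulr_ge0// addr_ge0.
by rewrite 3!exprS expr0 mulr1; lra.
Qed.

(** Supplies the polynomial whose growth on the ellipse is estimated at the next step of a chain. *)
Lemma tensor_line_poly g x i : exists2 p : {poly R[i]}, (size p <= m.+1)%N &
  forall v : R, tensor_interp xi B g (upd x i v) = p.[(from_box B i v)%:C].
Proof.
exists (\sum_(nu : {ffun 'I_3 -> 'I_m.+1})
  (g (\row_i to_box B i (xi (nu i))) *
   (\prod_(k < 3 | k != i) (lagrange xi (nu k)).[from_box B k (x 0 k)])%:C) *: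
   map_poly (real_complex R) (lagrange xi (nu i))).
  rewrite (leq_trans (size_sum _ _ _))//; apply/bigmax_leqP => nu _.
  by rewrite (leq_trans (size_scale_leq _ _))// size_map_poly size_lagrange.
move=> v; rewrite horner_sum; apply: eq_bigr => nu _.
rewrite hornerZ (horner_map (real_complex R)) -mulrA -rmorphM; congr (_ * _%:C).
rewrite (bigD1 i)//= updE eqxx mulrC; congr (_ * _).
by apply: eq_bigr => k ki; rewrite updE (negbTE ki).
Qed.

End TensorInterpolation.

(** * Chains of interpolation operators *)

Section EuclideanNorm.
Context {R : realType}.
Implicit Types x y z : 'rV[R]_3.

Lemma enorm_ge0 x : 0 <= enorm x. Proof. exact: sqrtr_ge0. Qed.

Lemma sqr_enorm x : enorm x ^+ 2 = \sum_(i < 3) x 0 i ^+ 2.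
Proof. by rewrite sqr_sqrtr// sumr_ge0// => i _; rewrite sqr_ge0. Qed.

Lemma enormN x : enorm (- x) = enorm x.
Proof. by congr Num.sqrt; apply: eq_bigr => i _; rewrite mxE sqrrN. Qed.

Lemma PhiC x y : Phi x y = Phi y x.
Proof. by rewrite /Phi -enormN opprB. Qed.

Lemma Phi_ge0 x y : 0 <= Phi x y. Proof. exact: enorm_ge0. Qed.

Lemma coord_le_enorm x i : `|x 0 i| <= enorm x.
Proof.
rewrite -sqrtr_sqr ler_wsqrtr// (bigD1 i)//= lerDl sumr_ge0// => j _.
by rewrite sqr_ge0.
Qed.

Lemma enormD x y : enorm (x + y) <= enorm x + enorm y.
Proof.
rewrite -(ger0_norm (addr_ge0 (enorm_ge0 x) (enorm_ge0 y))) -sqrtr_sqr ler_wsqrtr//.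
rewrite sqrrD !sqr_enorm; under eq_bigr do rewrite mxE sqrrD.
rewrite !big_split /= lerD2r lerD2l.
rewrite -mulr2n lerMn2r /= (le_trans (ler_norm _))// -sqrtr_sqr.
rewrite /enorm -sqrtrM; last by rewrite sumr_ge0// => i _; rewrite sqr_ge0.
rewrite ler_wsqrtr// !big_ord_recl !big_ord0 !addr0.
set a := x _ _; set b := x _ _; set c := x _ _.
set a' := y _ _; set b' := y _ _; set c' := y _ _.
(* Cauchy-Schwarz by Lagrange's identity. *)
have := sqr_ge0 (a * b' - b * a'); have := sqr_ge0 (a * c' - c * a').
have := sqr_ge0 (b * c' - c * b'); rewrite !expr2; lra.
Qed.

Lemma Phi_triangle x y z : Phi x z <= Phi x y + Phi y z.
Proof. by have := enormD (x - y) (y - z); rewrite addrA subrK. Qed.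

Lemma Phi_dist x y z : `|Phi x y - Phi x z| <= Phi y z.
Proof.
have := Phi_triangle x y z; have := Phi_triangle x z y; rewrite (PhiC z y).
by rewrite ler_norml => *; apply/andP; split; lra.
Qed.

Lemma Phi_upd (B : box R) x z i t : Phi (upd x i (to_box B i t)) z =
  line_dist (\sum_(k < 3 | k != i) (x 0 k - z 0 k) ^+ 2) (z 0 i)
    ((lo B 0 i + hi B 0 i) / 2) (diam_dir i B / 2) t.
Proof.
rewrite /Phi /enorm /line_dist (bigD1 i)//= addrC; congr Num.sqrt; congr (_ + _).
  by apply: eq_bigr => k ki; rewrite !mxE (negbTE ki).
by rewrite !mxE eqxx.
Qed.

Lemma lo_in_box (B : box R) : box_set B (lo B).
Proof. by move=> i; rewrite lexx ltW// lo_lt_hi. Qed.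

Lemma hi_in_box (B : box R) : box_set B (hi B).
Proof. by move=> i; rewrite lexx ltW// lo_lt_hi. Qed.

Lemma diam_dir_gt0 i (B : box R) : 0 < diam_dir i B.
Proof. by rewrite subr_gt0 lo_lt_hi. Qed.

Lemma kHelm_le kappa D x y : 0 < D -> D <= Phi x y -> normc (kHelm kappa x y) <= D^-1.
Proof.
move=> D0 Du; rewrite normc_div normc_expi mul1r normcR.
have pi1 : 1 <= 4 * pi :> R by have := pi_ge2 R; lra.
have P0 : 0 < Phi x y := lt_le_trans D0 Du.
have h : D <= 4 * pi * Phi x y by apply: le_trans Du _; rewrite ler_peMl// ltW.
by rewrite ger0_norm ?(le_trans (ltW D0) h)// lef_pV2// posrE (lt_le_trans D0 h).
Qed.

End EuclideanNorm.

(** * Errors along a single chain *)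

Section Reinterpolation.
Context {R : realType}.
Variables (kappa D de eta2 q : R) (m : nat) (xi : 'I_m.+1 -> R).
Hypotheses (kappa0 : 0 <= kappa) (D0 : 0 < D) (de1 : 0 < de <= 1).
Hypotheses (q1 : 0 < q < 1).
Hypothesis xi_inj : injective xi.
Hypothesis xi_range : forall j, xi j \in `[-1, 1].

Let x1 := (1 + de)^-1.
(** Relative to the scale 1/D. The 10 is the 5 of [limit_truncation] times the 2 of [line_inv_le],
    and [expR (4 * eta2)] bounds the continued phase. In [step_error] the 2 is that of
    [bernstein_growth], which also brings the factor m + 1. *)
Definition init_error : R := 10 * expR (4 * eta2) / de * x1 ^+ m.
Definition step_error : R :=
  10 * expR (4 * eta2) / de * m.+1%:R * ((1 + Num.sqrt q * de) * x1) ^+ m.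

Section Lines.
Variables (B : box R) (z z' : 'rV[R]_3).
Hypotheses (hz : forall x, box_set B x -> D <= Phi x z).
Hypotheses (hz' : forall x, box_set B x -> D <= Phi x z').
Hypothesis hB : forall i, diam_dir i B * de <= D / 4.
Hypothesis hk : forall i, kappa * diam_dir i B * Phi z z' <= eta2 * D.

Lemma growth_le i : expR (8 * (kappa * (diam_dir i B / 2) * Phi z z') * de / D) <=
  expR (4 * eta2).
Proof.
rewrite ler_expR ler_pdivrMr// mulrAC.
have := hk i; have /andP[d0 d1] := de1.
have h0 : 0 <= kappa * diam_dir i B * Phi z z'.
  by rewrite !mulr_ge0// ?Phi_ge0// ltW// diam_dir_gt0.
move=> h; have : kappa * diam_dir i B * Phi z z' * de <= eta2 * D.
  by rewrite (le_trans _ h)// ler_piMr.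
lra.
Qed.

Let c i := (lo B 0 i + hi B 0 i) / 2.
Let r i := diam_dir i B / 2.
Let b (x : 'rV[R]_3) i (w : 'rV[R]_3) := \sum_(k < 3 | k != i) (x 0 k - w 0 k) ^+ 2.

Let r0 i : 0 < r i. Proof. by rewrite divr_gt0// diam_dir_gt0. Qed.
Let rde i : r i * de <= D / 8. Proof. by have := hB i; rewrite /r; lra. Qed.
Let b0 x i w : 0 <= b x i w. Proof. by rewrite sumr_ge0// => k _; rewrite sqr_ge0. Qed.
Let hd x i w : (forall y, box_set B y -> D <= Phi y w) -> box_set B x ->
  forall t, -1 <= t <= 1 -> D <= line_dist (b x i w) (w 0 i) (c i) (r i) t.
Proof. by move=> hw Bx t t1; rewrite -Phi_upd; apply/hw/upd_box. Qed.
Let haa i : `|z 0 i - z' 0 i| <= Phi z z'.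
Proof. by have := coord_le_enorm (z - z') i; rewrite !mxE. Qed.
Let hdd x i t : -1 <= t <= 1 -> `|line_dist (b x i z) (z 0 i) (c i) (r i) t -
  line_dist (b x i z') (z' 0 i) (c i) (r i) t| <= Phi z z'.
Proof. by move=> _; rewrite -!Phi_upd; exact: Phi_dist. Qed.

(** z is the source point and z' the point that supplies the modulation, so the remaining phase is a
    difference of two distances. *)
Lemma helmholtz_box_approx : line_approx m B
  (fun x => expi (- (kappa * Phi x z')) * kHelm kappa x z) (init_error / D).
Proof.
move=> x Bx i.
have [Q sQ hQ] := helmholtz_line_approx D0 (r0 i) de1 (rde i) (b0 x i z) (hd i hz Bx)
  (b0 x i z') (hd i hz' Bx) kappa0 (haa i) (@hdd x i) m.
exists ((4 * pi)^-1%:C *: Q); first by rewrite (leq_trans (size_scale_leq _ _)).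
move=> t t1; set u := upd x i _.
have pi1 : 1 <= 4 * pi :> R by have := pi_ge2 R; lra.
have pi0 : 0 < 4 * pi :> R by apply: lt_le_trans pi1.
have -> : expi (- (kappa * Phi u z')) * kHelm kappa u z - ((4 * pi)^-1%:C *: Q).[t%:C] =
   (4 * pi)^-1%:C * (expi (kappa * (Phi u z - Phi u z')) / (Phi u z)%:C - Q.[t%:C]).
  have -> : kappa * (Phi u z - Phi u z') = - (kappa * Phi u z') + kappa * Phi u z by ring.
  rewrite hornerZ expiD /kHelm; set a := 4 * pi.
  by rewrite rmorphM invfM (fmorphV (real_complex R) a); ring.
rewrite normcM normcR ger0_norm ?invr_ge0 ?(ltW pi0)//.
have h := hQ t t1; rewrite -!Phi_upd -/u in h.
apply: le_trans (ler_piMl (normc_ge0 _) _) _; first by rewrite invf_le1.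
apply: le_trans h _.
have G := growth_le i; have /andP[d0 _] := de1.
rewrite /init_error -/x1.
have p : 0 <= 10 / D / de * x1 ^+ m.
  by rewrite mulr_ge0 ?exprn_ge0 ?divr_ge0 ?(ltW D0) ?(ltW d0)// invr_ge0 addr_ge0// ltW.
have := ler_wpM2r p G; lra.
Qed.

(** z belongs to the previous operator of the chain and z' to the next: restoring one modulation and
    removing the other leaves a slowly varying phase. *)
Lemma reinterp_box_approx (B0 : box R) g (A : R) : 0 < A -> B `<=` B0 ->
  (forall i, diam_dir i B <= q * diam_dir i B0) ->
  (forall x, box_set B0 x -> normc (tensor_interp xi B0 g x) <= A) ->
  line_approx m B (fun x => expi (- (kappa * Phi x z')) *
    (expi (kappa * Phi x z) * tensor_interp xi B0 g x)) (step_error * A).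
Proof.
move=> A0 BB0 hq hA x Bx i.
have [p sp hp] := tensor_line_poly xi B0 g x i.
have d0 := diam_dir_gt0 i B; have d00 := diam_dir_gt0 i B0.
have /andP[qp qlt] := q1.
(* [from_box B0] after [to_box B] is the affine map t -> al t + be; the bound on [be] expresses the
   inclusion of the boxes. *)
pose al := diam_dir i B / diam_dir i B0.
pose be := (lo B 0 i + hi B 0 i - lo B0 0 i - hi B0 0 i) / diam_dir i B0.
have al0 : 0 < al by rewrite divr_gt0.
have alq : al <= q by rewrite ler_pdivrMr.
have hbe : `|be| <= 1 - al.
  have /(_ i)/andP[l1 _] := BB0 _ (lo_in_box B).
  have /(_ i)/andP[_ h1] := BB0 _ (hi_in_box B).
  have -> : 1 - al = (diam_dir i B0 - diam_dir i B) / diam_dir i B0.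
    by rewrite /al; field; rewrite gt_eqF.
  rewrite normrM [`|_^-1|]ger0_norm ?invr_ge0 ?(ltW d00)// ler_wpM2r ?invr_ge0 ?(ltW d00)//.
  by rewrite /diam_dir ler_norml; apply/andP; split; lra.
have fE t : from_box B0 i (to_box B i t) = al * t + be.
  rewrite /from_box /to_box /al /be /diam_dir; field.
  by rewrite subr_eq0 gt_eqF// lo_lt_hi.
have pA s : -1 <= s <= 1 -> normc p.[s%:C] <= A.
  move=> s1; rewrite -[s](to_boxK B0 i) -hp; apply/hA/upd_box => //.
  exact: BB0.
have [Q sQ hQ] := phase_poly_line_approx D0 (r0 i) de1 (rde i) (b0 x i z) (hd i hz Bx)
  (b0 x i z') (hd i hz' Bx) kappa0 (haa i) (@hdd x i) sp A0 pA al0 alq qlt hbe.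
exists Q => // t t1; set u := upd x i _.
have h := hQ t t1; rewrite -!Phi_upd -/u -fE -hp -/u in h.
rewrite mulrA -expiD.
have -> : - (kappa * Phi u z') + kappa * Phi u z = kappa * (Phi u z - Phi u z') by ring.
apply: le_trans h _.
have G := growth_le i; have /andP[e0 _] := de1.
rewrite /step_error -/x1 exprMn.
have p0 : 0 <= 10 / de * m.+1%:R * (1 + Num.sqrt q * de) ^+ m * x1 ^+ m * A.
  have s0 : 0 <= 1 + Num.sqrt q * de by rewrite addr_ge0// mulr_ge0 ?sqrtr_ge0// ltW.
  have x0 : 0 <= x1 by rewrite invr_ge0 addr_ge0// ltW.
  by rewrite !mulr_ge0 ?(ltW A0) ?exprn_ge0// invr_ge0 ltW.
have := ler_wpM2r p0 G; lra.
Qed.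

End Lines.

Section Chain.
Variable La : R.
Hypothesis hLa : forall t : R, -1 <= t <= 1 -> \sum_(j < m.+1) `|(lagrange xi j).[t]| <= La.
Variables (B : nat -> box R) (z : nat -> 'rV[R]_3) (L : nat).
Hypothesis hz : forall r x, (r <= L)%N -> box_set (B r) x -> D <= Phi x (z r).
Hypothesis hzS : forall r x, (r < L)%N -> box_set (B r.+1) x -> D <= Phi x (z r).
Hypothesis hB : forall r i, (r <= L)%N -> diam_dir i (B r) * de <= D / 4.
Hypothesis hk : forall r i, (r < L)%N ->
  kappa * diam_dir i (B r.+1) * Phi (z r) (z r.+1) <= eta2 * D.
Hypothesis nested : forall r, (r < L)%N -> B r.+1 `<=` B r.
Hypothesis shrink : forall r i, (r < L)%N -> diam_dir i (B r.+1) <= q * diam_dir i (B r).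

Let op r := phase_interp xi kappa (B r) (fun x => Phi x (z r)).
(** The identity contributes 1 and the interpolation error the rest. In this form, unlike La^3, the
    factor can be raised to the power of the chain length. *)
Definition chain_factor : R := 1 + (1 + La) ^+ 3 * step_error.

Let L0 : 0 <= La := La_ge0 hLa.

Lemma phase_interp_error (C : box R) (w x : 'rV[R]_3) f (E : R) :
  line_approx m C (fun x => expi (- (kappa * Phi x w)) * f x) E -> box_set C x ->
  normc (phase_interp xi kappa C (fun x => Phi x w) f x - f x) <= (1 + La) ^+ 3 * E.
Proof.
move=> hf Cx; have := tensor_interp_error xi_inj xi_range hLa hf Cx.
rewrite normcBC /phase_interp; set I := tensor_interp _ _ _ _ => h.
have -> : expi (kappa * Phi x w) * I - f x =
  expi (kappa * Phi x w) * (I - expi (- (kappa * Phi x w)) * f x).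
  by rewrite mulrBr mulrA -expiD subrr expi0 mul1r.
by rewrite normcM normc_expi mul1r.
Qed.

Lemma phase_interp_le (C : box R) psi f (A : R) x :
  (forall x, box_set C x -> normc (f x) <= A) -> box_set C x ->
  normc (phase_interp xi kappa C psi f x) <= La ^+ 3 * A.
Proof.
move=> fA Cx; rewrite normcM normc_expi mul1r.
apply: tensor_interp_le (x) Cx => // y Cy; rewrite normcM normc_expi mul1r; exact: fA.
Qed.

Lemma step_error_ge0 : 0 <= step_error.
Proof.
have /andP[e0 _] := de1; have /andP[qp _] := q1.
rewrite !mulr_ge0 ?expR_ge0 ?exprn_ge0 ?invr_ge0 ?(ltW e0)//.
by rewrite divr_ge0 ?addr_ge0 ?mulr_ge0 ?sqrtr_ge0 ?(ltW e0).
Qed.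

Lemma chain_factor_ge1 : 1 <= chain_factor.
Proof. by rewrite lerDl mulr_ge0 ?step_error_ge0// exprn_ge0// addr_ge0. Qed.

(** The three claims need each other in the induction: the first provides the polynomial for the
    next step, the second its size, and the third sums the step errors. As each error is relative to
    the current size, the sum telescopes to chain_factor^r - 1; the full stability constant is paid
    once, at r = 0. *)
Lemma chain_bound f (A : R) : 0 < A ->
  (forall x, box_set (B 0) x -> normc (f x) <= A) -> forall r, (r <= L)%N ->
  [/\ exists g, forall x, chain op r f x =
        expi (kappa * Phi x (z r)) * tensor_interp xi (B r) g x,
      forall x, box_set (B r) x ->
        normc (chain op r f x) <= chain_factor ^+ r * ((1 + La) ^+ 3 * A) &
      forall x, box_set (B r) x -> normc (chain op r f x - chain op 0 f x) <=
        (chain_factor ^+ r - 1) * ((1 + La) ^+ 3 * A)].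
Proof.
move=> A0 fA; set A1 := _ * A.
have A10 : 0 < A1 by rewrite mulr_gt0// exprn_gt0// ltr_pwDl.
have s0 := step_error_ge0.
elim=> [|r IH] rL.
  split=> [|x Bx|x Bx].
  - by exists (fun x => expi (- (kappa * Phi x (z 0%N))) * f x).
  - rewrite expr0 mul1r; apply: le_trans (phase_interp_le _ fA Bx) _.
    by rewrite ler_wpM2r ?(ltW A0)// lerXn2r ?nnegrE ?addr_ge0// lerDr.
  - by rewrite subrr normc0 expr0 subrr mul0r.
have [[g hg] h1 h2] := IH (ltnW rL); set Ar := _ * A1 in h1.
have Ar0 : 0 < Ar.
  by rewrite mulr_gt0// exprn_gt0// (lt_le_trans ltr01 chain_factor_ge1).
have gA x : box_set (B r) x -> normc (tensor_interp xi (B r) g x) <= Ar.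
  by move=> Bx; have := h1 x Bx; rewrite hg normcM normc_expi mul1r.
have stepe x : box_set (B r.+1) x ->
    normc (chain op r.+1 f x - chain op r f x) <= (1 + La) ^+ 3 * (step_error * Ar).
  move=> Bx; apply: phase_interp_error => //.
  have -> : (fun x => expi (- (kappa * Phi x (z r.+1))) * chain op r f x) =
    (fun x => expi (- (kappa * Phi x (z r.+1))) *
       (expi (kappa * Phi x (z r)) * tensor_interp xi (B r) g x)).
    by apply/funext => y; rewrite hg.
  apply: reinterp_box_approx => //.
  - by move=> y; exact: hzS.
  - by move=> y; exact: hz.
  - by move=> i; exact: hB.
  - by move=> i; exact: hk.
  - exact: nested.
  - by move=> i; exact: shrink.
have fE : chain_factor ^+ r.+1 * A1 = Ar + (1 + La) ^+ 3 * (step_error * Ar).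
  by rewrite exprS /Ar /chain_factor; ring.
split=> [|x Bx|x Bx].
- by exists (fun x => expi (- (kappa * Phi x (z r.+1))) * chain op r f x).
- rewrite fE -[chain op r.+1 f x](subrK (chain op r f x)) (le_trans (le_normcD _ _))//.
  by rewrite addrC lerD ?stepe// h1//; exact: nested.
- apply: le_trans (normc_distD _ _ (chain op r f x)) _.
  apply: le_trans (lerD (stepe x Bx) (h2 x (nested rL Bx))) _.
  rewrite [leRHS]mulrBl fE mul1r [X in _ + X <= _]mulrBl -/Ar mul1r; lra.
Qed.

Lemma chain_le f (A : R) x : 0 < A ->
  (forall x, box_set (B 0) x -> normc (f x) <= A) -> box_set (B L) x ->
  normc (chain op L f x) <= chain_factor ^+ L * (1 + La) ^+ 3 * A.
Proof.
by move=> A0 fA Bx; have [_ h _] := chain_bound A0 fA (leqnn L); rewrite -mulrA; exact: h.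
Qed.

Lemma nested0 r : (r <= L)%N -> B r `<=` B 0.
Proof.
elim: r => [_ x //|r IH rL x Bx]; exact: (IH (ltnW rL) x (nested rL Bx)).
Qed.

Lemma chain_helmholtz_error (y x : 'rV[R]_3) :
  (forall x, box_set (B 0) x -> D <= Phi x y) ->
  (forall i, kappa * diam_dir i (B 0) * Phi y (z 0) <= eta2 * D) ->
  box_set (B L) x ->
  normc (chain op L (fun x' => kHelm kappa x' y) x - kHelm kappa x y) <=
    (1 + La) ^+ 3 * (init_error + (chain_factor ^+ L - 1)) / D.
Proof.
move=> hy hky Bx; have Bx0 := nested0 (leqnn L) Bx.
have kA u : box_set (B 0) u -> normc (kHelm kappa u y) <= D^-1.
  by move=> /hy; exact: kHelm_le.
have D1 : 0 < D^-1 by rewrite invr_gt0.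
have [_ _ h2] := chain_bound D1 kA (leqnn L).
have h1 : normc (chain op 0 (fun x' => kHelm kappa x' y) x - kHelm kappa x y) <=
   (1 + La) ^+ 3 * (init_error / D).
  apply: phase_interp_error => //; apply: helmholtz_box_approx => //.
  - by move=> u; exact: hz.
  - by move=> i; exact: hB.
apply: le_trans (normc_distD _ _ (chain op 0 (fun x' => kHelm kappa x' y) x)) _.
by apply: le_trans (lerD (h2 x Bx) h1) _; lra.
Qed.

End Chain.
End Reinterpolation.

(** * Cluster trees and the butterfly kernel *)

Section Trees.
Local Notation root := Defs.root.
Context {N : nat} (T : cluster_tree N) (hT : is_cluster_tree T).
Implicit Types (s t : T) (i : 'I_N).

Lemma sons_parent t : t != root T -> t \in sons (parent t).
Proof. by move=> tr; rewrite inE tr eqxx. Qed.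

Lemma parent_sons s t : s \in sons t -> parent s = t.
Proof. by rewrite inE => /andP[_ /eqP]. Qed.

Lemma level_sons s t : s \in sons t -> level s = (level t).+1.
Proof. by rewrite inE => /andP[sr /eqP <-]; exact: (level_parent hT). Qed.

Lemma level_gt0 t : (0 < level t)%N -> t != root T.
Proof. by apply: contraTneq => ->; rewrite (level_root hT). Qed.

Lemma parent_notleaf t : t != root T -> ~~ leaf (parent t).
Proof. by move=> tr; apply/set0Pn; exists t; exact: sons_parent. Qed.

Lemma idx_parent t i : t != root T -> i \in idx t -> i \in idx (parent t).
Proof.
move=> tr it; rewrite (idx_sons hT (parent_notleaf tr)).
by apply/bigcupP; exists t => //; exact: sons_parent.
Qed.

Lemma level_iter_parent t k : (k <= level t)%N ->
  level (iter k (@parent N T) t) = (level t - k)%N.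
Proof.
elim: k => [|k IH] kt; first by rewrite subn0.
have := IH (ltnW kt) => e; set u := iter k _ t in e.
have ur : u != root T by apply: level_gt0; rewrite e subn_gt0.
by apply: succn_inj; rewrite -(level_parent hT ur) e subnSK.
Qed.

Lemma idx_iter_parent t k i : (k <= level t)%N -> i \in idx t ->
  i \in idx (iter k (@parent N T) t).
Proof.
elim: k => [//|k IH] kt it; have iu := IH (ltnW kt) it.
apply: idx_parent => //; apply: level_gt0.
by rewrite level_iter_parent ?subn_gt0// ltnW.
Qed.

Lemma level_ancestor t l : (l <= level t)%N -> level (ancestor t l) = l.
Proof. by move=> lt; rewrite level_iter_parent ?leq_subr// subKn. Qed.

Lemma idx_ancestor t l i : i \in idx t -> i \in idx (ancestor t l).
Proof. by move=> it; apply: idx_iter_parent => //; exact: leq_subr. Qed.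

Lemma ancestor_self t : ancestor t (level t) = t.
Proof. by rewrite /ancestor subnn. Qed.

Lemma parent_ancestor t l : (l < level t)%N -> parent (ancestor t l.+1) = ancestor t l.
Proof. by move=> lt; rewrite /ancestor -(subnSK lt). Qed.

Lemma ancestor_sons t l : (l < level t)%N -> ancestor t l.+1 \in sons (ancestor t l).
Proof.
move=> lt; rewrite -(parent_ancestor lt); apply: sons_parent; apply: level_gt0.
by rewrite level_ancestor.
Qed.

Lemma ancestor_of_son s t l : s \in sons t -> (l <= level t)%N -> ancestor s l = ancestor t l.
Proof.
by move=> st lt; rewrite /ancestor (level_sons st) subSn// iterSr (parent_sons st).
Qed.

(** Induction along the parents: they share the index too, hence coincide, and sons of one cluster
    are disjoint. *)
Lemma cluster_unique s t i : level s = level t -> i \in idx s -> i \in idx t -> s = t.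
Proof.
elim: {s}(level s) {-2}s (erefl (level s)) t => [|n IH] s sn t st is_ it.
  have z u : level u = 0%N -> u = root T.
    by move=> u0; apply/eqP; apply: contraT => /(level_parent hT); rewrite u0.
  by rewrite (z s)// (z t)// -st.
have sr : s != root T by apply: level_gt0; rewrite sn.
have tr : t != root T by apply: level_gt0; rewrite -st sn.
have e : parent s = parent t.
  apply: IH; rewrite ?idx_parent//.
    by apply: succn_inj; rewrite -(level_parent hT sr).
  by apply: succn_inj; rewrite -(level_parent hT sr) -(level_parent hT tr).
apply/eqP; apply: contraT => st'.
have := idx_disjoint hT (sons_parent sr) _ st'; rewrite e => /(_ (sons_parent tr)).
by move/setP/(_ i); rewrite !inE is_ it.
Qed.

Lemma level_le_depth t : (level t <= depth T)%N.
Proof. exact: (leq_bigmax (F := fun t : T => level t)). Qed.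

Lemma exists_leaf s i : i \in idx s -> exists t : T, leaf t && (i \in idx t).
Proof.
have [n] := ubnP (depth T - level s); elim: n s => // n IH s sn is_.
have [sl|sl] := boolP (leaf s); first by exists s; rewrite sl.
move: is_; rewrite (idx_sons hT sl) => /bigcupP[t ts it]; apply: IH it.
have := level_le_depth t; rewrite (level_sons ts) => h.
by rewrite subnS -ltnS prednK ?subn_gt0.
Qed.

Lemma leaf_ofP i : leaf (leaf_of T i) /\ i \in idx (leaf_of T i).
Proof.
rewrite /leaf_of; case: pickP => [t /andP[] //|h].
have [|t] := @exists_leaf (root T) i; first by rewrite (idx_root hT) inE.
by rewrite h.
Qed.

Lemma level_leaf_of i : level (leaf_of T i) = depth T.
Proof. by apply: (leaf_level hT); have [] := leaf_ofP i. Qed.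

Lemma idx_leaf_ancestor i l : i \in idx (ancestor (leaf_of T i) l).
Proof. by apply: idx_ancestor; have [] := leaf_ofP i. Qed.

Lemma level_leaf_ancestor i l : (l <= depth T)%N -> level (ancestor (leaf_of T i) l) = l.
Proof. by move=> ld; rewrite level_ancestor// level_leaf_of. Qed.

(** Links the clusters of a block to the ancestors of leaves in terms of which [kBF] is defined. *)
Lemma leaf_ancestor s i : i \in idx s -> ancestor (leaf_of T i) (level s) = s.
Proof.
move=> is_; apply: (@cluster_unique _ _ i) => //; last exact: idx_leaf_ancestor.
by rewrite level_leaf_ancestor// level_le_depth.
Qed.

Lemma descendant_leaf_ancestor s i l : i \in idx s -> (level s <= l <= depth T)%N ->
  descendant s (ancestor (leaf_of T i) l).
Proof.
move=> is_ /andP[sl ld]; rewrite /descendant level_leaf_ancestor// sl /=; apply/eqP.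
apply: (@cluster_unique _ _ i) => //; last exact/idx_ancestor/idx_leaf_ancestor.
by rewrite level_ancestor// level_leaf_ancestor.
Qed.

Lemma leaf_ancestor_sons i l : (l < depth T)%N ->
  ancestor (leaf_of T i) l.+1 \in sons (ancestor (leaf_of T i) l).
Proof. by move=> ld; apply: ancestor_sons; rewrite level_leaf_of. Qed.

Lemma nested_leaf_ancestor (R : realType) (B : T -> box R) i l l' :
  (forall s s' : T, s' \in sons s -> B s' `<=` B s) ->
  (l <= l' <= depth T)%N ->
  B (ancestor (leaf_of T i) l') `<=` B (ancestor (leaf_of T i) l).
Proof.
move=> nest /andP[]; elim: l' => [|l' IH]; first by rewrite leqn0 => /eqP -> _ x.
rewrite leq_eqVlt => /predU1P[-> _ x //|ll' ld] x Bx.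
by apply: IH => //; [exact: ltnW|exact: nest (leaf_ancestor_sons i ld) _ Bx].
Qed.

Lemma leaf_box_sub (R : realType) (B : T -> box R) i s :
  (forall s s' : T, s' \in sons s -> B s' `<=` B s) -> i \in idx s ->
  B (leaf_of T i) `<=` B s.
Proof.
move=> nest is_; rewrite -[leaf_of T i]ancestor_self -[s in _ `<=` box_set (B s)](leaf_ancestor is_).
by apply: nested_leaf_ancestor => //; rewrite level_leaf_of level_le_depth leqnn.
Qed.

End Trees.

(** * Uniqueness of the leaf block of a matrix entry *)

Section BlockPartition.
Context {R : realType} {N : nat} {TI TJ : cluster_tree N}.
Hypotheses (hTI : is_cluster_tree TI) (hTJ : is_cluster_tree TJ).
Variables (eta1 : R) (BI : TI -> box R) (BJ : TJ -> box R).
Local Notation block := (block eta1 BI BJ).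
Local Notation admissible := (admissible eta1 BI BJ).

Lemma block_level s t : block s t -> level s = level t.
Proof.
elim=> [|s1 t1 s' t' _ e _ _ ss tt]; first by rewrite (level_root hTI) (level_root hTJ).
by rewrite (level_sons hTI ss) (level_sons hTJ tt) e.
Qed.

(** Every proper ancestor pair of a block was itself a block that had to be subdivided. *)
Lemma block_ancestors s t : block s t -> forall l, (l < level s)%N ->
  ~ admissible (ancestor s l) (ancestor t l) /\
  ~~ (leaf (ancestor s l) && leaf (ancestor t l)).
Proof.
elim=> [|s1 t1 s' t' b IH na nl ss tt] l; first by rewrite (level_root hTI).
rewrite (level_sons hTI ss) ltnS leq_eqVlt => lt.
have ls : (l <= level s1)%N by rewrite leq_eqVlt.
rewrite (ancestor_of_son hTI ss)// (ancestor_of_son hTJ tt) -?(block_level b)//.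
move: lt => /predU1P[->|]; last exact: IH.
by rewrite ancestor_self (block_level b) ancestor_self.
Qed.

(** On different levels one of the blocks would be a proper ancestor of the other and hence
    subdivided; on one level an index determines its cluster. So the choice made by [pick] in
    [butterfly] is immaterial. *)
Lemma leaf_block_unique s t s' t' i j : block s t -> block s' t' ->
  admissible s t \/ leaf s && leaf t -> admissible s' t' \/ leaf s' && leaf t' ->
  i \in idx s -> i \in idx s' -> j \in idx t -> j \in idx t' -> s = s' /\ t = t'.
Proof.
have aux a b a' b' : block a b -> block a' b' -> admissible a b \/ leaf a && leaf b ->
    i \in idx a -> i \in idx a' -> j \in idx b -> j \in idx b' -> ~ (level a < level a')%N.
  move=> bab bab' h ia ia' jb jb' lt.
  have [na nl] := block_ancestors bab' lt.
  have ea : ancestor a' (level a) = a.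
    apply: (@cluster_unique _ _ hTI _ _ i) => //; last exact: idx_ancestor.
    by rewrite level_ancestor// ltnW.
  have eb : ancestor b' (level a) = b.
    apply: (@cluster_unique _ _ hTJ _ _ j) => //; last exact: idx_ancestor.
    by rewrite level_ancestor ?(block_level bab)// -(block_level bab) -(block_level bab') ltnW.
  rewrite ea eb in na nl; case: h => [//|h].
  by rewrite h in nl.
move=> b1 b2 h1 h2 i1 i2 j1 j2.
have e : level s = level s'.
  case: (ltngtP (level s) (level s')) => // lt.
    by case: (aux s t s' t' b1 b2 h1 i1 i2 j1 j2 lt).
  by case: (aux s' t' s t b2 b1 h2 i2 i1 j2 j1 lt).
split; first exact: (cluster_unique hTI (i := i)).
by apply: (cluster_unique hTJ (i := j)) => //; rewrite -(block_level b1) -(block_level b2).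
Qed.

End BlockPartition.

Section DiamDist.
Context {R : realType}.
Implicit Types (B : box R).

Lemma box_diam_bound B x y : box_set B x -> box_set B y -> enorm (x - y) <= diam B.
Proof.
move=> Bx By; apply: ub_le_sup; last by exists (x, y).
(* The supremum in [diam] needs an upper bound; the length of the diagonal is one. *)
exists (enorm (hi B - lo B)) => _ [[u v] [/= Bu Bv] <-].
rewrite ler_wsqrtr//; apply: ler_sum => i _; rewrite !mxE.
have /andP[u1 u2] := Bu i; have /andP[v1 v2] := Bv i.
rewrite -[leLHS]real_normK ?num_real// lerXn2r// ?nnegrE//.
  by rewrite subr_ge0 ltW// lo_lt_hi.
by rewrite ler_norml; apply/andP; split; lra.
Qed.

Lemma box_dist_le (B B' : box R) x y : box_set B x -> box_set B' y -> dist B B' <= enorm (x - y).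
Proof.
move=> Bx By; apply: ge_inf; last by exists (x, y).
by exists 0 => _ [[u v] _ <-]; exact: enorm_ge0.
Qed.

Lemma diam_dir_le B (A : set 'rV[R]_3) i : (forall x y, A x -> A y -> enorm (x - y) <= diam A) ->
  B `<=` A -> diam_dir i B <= diam A.
Proof.
move=> hA BA; apply: le_trans (hA _ _ (BA _ (hi_in_box B)) (BA _ (lo_in_box B))).
apply: le_trans (coord_le_enorm _ i); rewrite !mxE; exact: ler_norm.
Qed.

Lemma diam_gt0 B : 0 < diam B.
Proof.
apply: lt_le_trans (diam_dir_gt0 0 B) _; apply: diam_dir_le => // x y.
exact: box_diam_bound.
Qed.

End DiamDist.

Lemma upper_level_range (M L p l r : nat) : (M + L = p)%N -> (l + L + L <= p)%N ->
  (r <= L)%N -> (l <= M + r <= p)%N.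
Proof. by lia. Qed.

Lemma lower_level_range (M L p l r : nat) : (M + L = p)%N -> (l + L + L <= p)%N ->
  (r <= L)%N -> (l <= M - r <= p)%N.
Proof. by lia. Qed.

Lemma upper_int_range (M L l : nat) : (M <= l <= M + L)%N ->
  - (L%:Z) <= l%:Z - M%:Z <= L%:Z.
Proof. by lia. Qed.

Lemma lower_int_range (M L l l' : nat) : (l + l' = M + M)%N -> (M <= l <= M + L)%N ->
  - (L%:Z) <= l'%:Z - M%:Z <= L%:Z.
Proof. by lia. Qed.

Lemma mirror_int (M l l' : nat) : (l + l' = M + M)%N -> l'%:Z = M%:Z - (l%:Z - M%:Z).
Proof. by lia. Qed.

(** * Kernel error of the two combined chains *)

Section KernelError.
Context {R : realType}.

Lemma phase_interpB m (xi : 'I_m.+1 -> R) kappa (B : box R) psi f g x :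
  phase_interp xi kappa B psi f x - phase_interp xi kappa B psi g x =
  phase_interp xi kappa B psi (fun y => f y - g y) x.
Proof.
rewrite /phase_interp -mulrBr /tensor_interp -sumrB; congr (_ * _).
by apply: eq_bigr => nu _; rewrite -mulrBl -mulrBr.
Qed.

Lemma chain_phase_interpB m (xi : 'I_m.+1 -> R) kappa (B : nat -> box R) psi L f g x :
  let op r := phase_interp xi kappa (B r) (psi r) in
  chain op L f x - chain op L g x = chain op L (fun y => f y - g y) x.
Proof.
move=> op; elim: L x => [|L IH] x; first exact: phase_interpB.
rewrite /= phase_interpB; congr (phase_interp _ _ _ _ _ _).
by apply/funext => y; exact: IH.
Qed.

Lemma kHelmC kappa (x y : 'rV[R]_3) : kHelm kappa x y = kHelm kappa y x.
Proof. by rewrite /kHelm PhiC. Qed.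

Variables (eta1 eta2 q kappa La : R) (m : nat) (xi : 'I_m.+1 -> R).
Hypotheses (eta10 : 0 < eta1) (q1 : 0 < q < 1) (kappa0 : 0 <= kappa).
Hypotheses (xi_inj : injective xi) (xi_range : forall j, xi j \in `[-1, 1]).
Hypothesis hLa : forall t : R, -1 <= t <= 1 -> \sum_(j < m.+1) `|(lagrange xi j).[t]| <= La.

(* Relative half-width of the neighbourhoods of the boxes to which distances
   to the opposite cluster extend. *)
Definition nbhd_width : R := Num.min 1 (eta1^-1 / 4).

Lemma nbhd_width_gt0 : 0 < nbhd_width <= 1.
Proof. by rewrite lt_min ltr01 divr_gt0 ?invr_gt0//= ge_min lexx. Qed.

Let de := nbhd_width.
Let hde : 0 < de <= 1 := nbhd_width_gt0.
Let Fac := chain_factor de eta2 q m La.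

Definition chain_error (L : nat) : R :=
  (1 + La) ^+ 3 * (init_error de eta2 m + (Fac ^+ L - 1)).

Section TwoChains.
Variables (D : R) (L : nat) (SX SY : box R) (BX BY : nat -> box R).
Variables (zX zY : nat -> 'rV[R]_3).
Hypotheses (D0 : 0 < D) (hD : forall x y, box_set SX x -> box_set SY y -> D <= Phi x y).
Hypotheses (subX : forall r, (r <= L)%N -> BX r `<=` SX)
           (subY : forall r, (r <= L)%N -> BY r `<=` SY).
Hypotheses (zXS : forall r, (r <= L)%N -> box_set SY (zX r))
           (zYS : forall r, (r <= L)%N -> box_set SX (zY r)).
Hypotheses (diamX : forall r i, (r <= L)%N -> diam_dir i (BX r) <= eta1 * D)
           (diamY : forall r i, (r <= L)%N -> diam_dir i (BY r) <= eta1 * D).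
Hypotheses (nestX : forall r, (r < L)%N -> BX r.+1 `<=` BX r)
           (nestY : forall r, (r < L)%N -> BY r.+1 `<=` BY r).
Hypotheses
  (shrinkX : forall r i, (r < L)%N -> diam_dir i (BX r.+1) <= q * diam_dir i (BX r))
  (shrinkY : forall r i, (r < L)%N -> diam_dir i (BY r.+1) <= q * diam_dir i (BY r)).
Hypotheses
  (kX : forall r i, (r < L)%N ->
    kappa * diam_dir i (BX r.+1) * Phi (zX r) (zX r.+1) <= eta2 * D)
  (kY : forall r i, (r < L)%N ->
    kappa * diam_dir i (BY r.+1) * Phi (zY r) (zY r.+1) <= eta2 * D).
Hypotheses
  (kX0 : forall i y, box_set (BY 0) y -> kappa * diam_dir i (BX 0) * Phi y (zX 0) <= eta2 * D)
  (kY0 : forall i x, box_set (BX 0) x -> kappa * diam_dir i (BY 0) * Phi x (zY 0) <= eta2 * D).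

Let opX r := phase_interp xi kappa (BX r) (fun x => Phi x (zX r)).
Let opY r := phase_interp xi kappa (BY r) (fun y => Phi y (zY r)).

(** Admissibility bounds the edges by eta1 D; half an edge times [de] is then at most D/8, the
    radius allowed in [dist_branch]. *)
Lemma nbhd_width_le (d : R) : d <= eta1 * D -> d * de <= D / 4.
Proof.
move=> dD; have /andP[w0 _] := hde.
have h : de <= eta1^-1 / 4 by rewrite ge_min lexx orbT.
apply: le_trans (ler_wpM2r (ltW w0) dD) _.
have p0 : 0 <= eta1 * D by rewrite mulr_ge0 ?ltW.
apply: le_trans (ler_wpM2l p0 h) _.
by rewrite [leLHS](_ : _ = D / 4)//; field; rewrite gt_eqF.
Qed.

Let L0 : 0 <= La := La_ge0 hLa.

Lemma init_error_gt0 : 0 < init_error de eta2 m.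
Proof.
have /andP[w0 _] := hde.
by rewrite !mulr_gt0 ?expR_gt0 ?invr_gt0 ?exprn_gt0 ?invr_gt0 ?addr_gt0.
Qed.

Lemma factor_ge1 : 1 <= Fac.
Proof. exact: (chain_factor_ge1 _ hde q1 hLa). Qed.

Lemma chain_error_gt0 : 0 < chain_error L.
Proof.
by rewrite mulr_gt0 ?exprn_gt0 ?ltr_pwDl ?init_error_gt0// subr_ge0 exprn_ege1// factor_ge1.
Qed.

(** y ranges over the middle-level box [BY 0] and not only over the leaf box, because the Y chain
    samples the error of the X chain at nodes of [BY 0]. *)
Lemma chainX_error x y : box_set (BX L) x -> box_set (BY 0) y ->
  normc (chain opX L (fun x' => kHelm kappa x' y) x - kHelm kappa x y) <= chain_error L / D.
Proof.
move=> Bx By.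
apply: (chain_helmholtz_error kappa0 D0 hde q1 xi_inj xi_range hLa _ _ _ _ _ _ _ _ Bx).
- by move=> r u rL Bu; apply: hD; [exact: subX Bu|exact: zXS].
- by move=> r u rL Bu; apply: hD; [exact: subX Bu|exact/zXS/ltnW].
- by move=> r i rL; apply/nbhd_width_le/diamX.
- exact: kX.
- exact: nestX.
- exact: shrinkX.
- by move=> u Bu; apply: hD; [exact: subX Bu|exact: subY By].
- by move=> i; exact: kX0.
Qed.

Lemma chainY_error x y : box_set (BX 0) x -> box_set (BY L) y ->
  normc (chain opY L (fun y' => kHelm kappa x y') y - kHelm kappa x y) <= chain_error L / D.
Proof.
move=> Bx By; have -> : kHelm kappa x = (fun y' => kHelm kappa y' x).
  by apply/funext => y'; exact: kHelmC.
apply: (chain_helmholtz_error kappa0 D0 hde q1 xi_inj xi_range hLa _ _ _ _ _ _ _ _ By).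
- by move=> r u rL Bu; rewrite PhiC; apply: hD; [exact: zYS|exact: subY Bu].
- by move=> r u rL Bu; rewrite PhiC; apply: hD; [exact/zYS/ltnW|exact: subY Bu].
- by move=> r i rL; apply/nbhd_width_le/diamY.
- exact: kY.
- exact: nestY.
- exact: shrinkY.
- by move=> u Bu; rewrite PhiC; apply: hD; [exact: subX Bx|exact: subY Bu].
- by move=> i; exact: kY0.
Qed.

(* Id - Y X = (Id - Y) + Y (Id - X) for the two commuting chains X and Y. *)
Lemma two_chains_error x y : box_set (BX L) x -> box_set (BY L) y ->
  normc (kHelm kappa x y - chain opY L (fun y' =>
     chain opX L (fun x' => kHelm kappa x' y') x) y) <=
  (1 + Fac ^+ L * (1 + La) ^+ 3) * (chain_error L / D).
Proof.
move=> Bx By.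
have Bx0 : box_set (BX 0) x by exact: (nested0 nestX (leqnn L) Bx).
apply: le_trans (normc_distD _ _ (chain opY L (fun y' => kHelm kappa x y') y)) _.
rewrite mulrDl mul1r lerD//; first by rewrite normcBC; exact: chainY_error.
rewrite (chain_phase_interpB xi kappa BY (fun r y => Phi y (zY r))).
have E0 : 0 < chain_error L / D by rewrite divr_gt0// chain_error_gt0.
apply: (chain_le kappa0 D0 hde q1 xi_inj xi_range hLa _ _ _ _ _ _ E0 _ By).
- by move=> r u rL Bu; rewrite PhiC; apply: hD; [exact: zYS|exact: subY Bu].
- by move=> r u rL Bu; rewrite PhiC; apply: hD; [exact/zYS/ltnW|exact: subY Bu].
- by move=> r i rL; apply/nbhd_width_le/diamY.
- exact: kY.
- exact: nestY.
- exact: shrinkY.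
- by move=> u Bu; rewrite normcBC; exact: chainX_error.
Qed.

End TwoChains.

Section Butterfly.
Context {N : nat} {TI TJ : cluster_tree N}.
Hypotheses (hTI : is_cluster_tree TI) (hTJ : is_cluster_tree TJ).
Hypothesis hdepth : depth TI = depth TJ.
Variables (BI : TI -> box R) (BJ : TJ -> box R).
Hypotheses (nestI : forall s s' : TI, s' \in sons s -> BI s' `<=` BI s)
           (nestJ : forall t t' : TJ, t' \in sons t -> BJ t' `<=` BJ t).
Variables (px : TI -> 'rV[R]_3) (py : TJ -> 'rV[R]_3).
Hypotheses (hpx : forall s, box_set (BI s) (px s)) (hpy : forall t, box_set (BJ t) (py t)).
Variables (s : TI) (t : TJ).
Let D := dist (BI s) (BJ t).
Let p := depth TI.
Let L := Lhalf p (level s).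
Let M := Lmid p (level s).
Hypothesis st : level s = level t.
Hypothesis adm : Num.max (diam (BI s)) (diam (BJ t)) <= eta1 * D.
Hypothesis A2 : forall r : int, - (L%:Z) <= r <= L%:Z ->
  forall (s' : TI) (t' : TJ), descendant s s' -> descendant t t' ->
  (level s')%:Z = M%:Z + r -> (level t')%:Z = M%:Z - r ->
  kappa * diam (BI s') * diam (BJ t') <= eta2 * D.
Hypotheses (A3I : forall s1 s2 : TI, descendant s s1 -> s2 \in sons s1 ->
             forall i, diam_dir i (BI s2) <= q * diam_dir i (BI s1))
  (A3J : forall t1 t2 : TJ, descendant t t1 -> t2 \in sons t1 ->
             forall i, diam_dir i (BJ t2) <= q * diam_dir i (BJ t1)).
Variables (i j : 'I_N).
Hypotheses (is_ : i \in idx s) (jt : j \in idx t).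

(** Boxes are nondegenerate, so their diameters are positive and admissible boxes cannot touch. *)
Lemma adm_dist_gt0 : 0 < D.
Proof.
have : 0 < eta1 * D by apply: lt_le_trans adm; rewrite lt_max diam_gt0.
by rewrite pmulr_rgt0.
Qed.

Lemma level_le_p : (level s <= p)%N.
Proof. exact: level_le_depth. Qed.

(** Thanks to the floor in [Lhalf], the coarsest clusters in use, on level M - L, are still
    descendants of the block clusters. *)
Lemma Lhalf_double : (level s + L + L <= p)%N.
Proof.
have h : (L.*2 <= p - level s)%N by rewrite -[leqRHS]odd_double_half leq_addl.
by rewrite -addnA addnn -leq_subRL ?level_le_p.
Qed.

Lemma Lmid_add : (M + L = p)%N.
Proof. by rewrite subnK// (leq_trans _ Lhalf_double)// leq_addl. Qed.

Lemma Lhalf_le_mid : (L <= M)%N.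
Proof.
by rewrite -(leq_add2r L) Lmid_add (leq_trans _ Lhalf_double)// leq_add2r leq_addl.
Qed.

Let sigma l : TI := ancestor (leaf_of TI i) l.
Let tau l : TJ := ancestor (leaf_of TJ j) l.

Lemma upper_range r : (r <= L)%N -> (level s <= M + r <= p)%N.
Proof.
by move=> rL; exact: upper_level_range Lmid_add Lhalf_double rL.
Qed.

Lemma lower_range r : (r <= L)%N -> (level s <= M - r <= p)%N.
Proof.
by move=> rL; exact: lower_level_range Lmid_add Lhalf_double rL.
Qed.

Lemma sigma_sub l : (level s <= l <= p)%N -> BI (sigma l) `<=` BI s.
Proof.
move=> lp; rewrite -[X in _ `<=` box_set (BI X)](leaf_ancestor hTI is_).
exact: nested_leaf_ancestor.
Qed.

Lemma tau_sub l : (level s <= l <= p)%N -> BJ (tau l) `<=` BJ t.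
Proof.
rewrite st /p hdepth => lp; rewrite -[X in _ `<=` box_set (BJ X)](leaf_ancestor hTJ jt).
exact: nested_leaf_ancestor.
Qed.

Lemma sigma_mono l l' : (l <= l' <= p)%N -> BI (sigma l') `<=` BI (sigma l).
Proof. exact: nested_leaf_ancestor. Qed.

Lemma tau_mono l l' : (l <= l' <= p)%N -> BJ (tau l') `<=` BJ (tau l).
Proof. rewrite /p hdepth; exact: nested_leaf_ancestor. Qed.

(** (A2) on levels l and l' mirrored at the middle level; the diameter of the opposite cluster
    bounds the distance of two of its points. *)
Lemma kappa_sigma_tau l l' k x y : (level s <= l <= p)%N -> (level s <= l' <= p)%N ->
  (l + l' = M + M)%N -> (M <= l)%N -> box_set (BJ (tau l')) x -> box_set (BJ (tau l')) y ->
  kappa * diam_dir k (BI (sigma l)) * Phi x y <= eta2 * D.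
Proof.
move=> lp lp' ll Ml Bx By.
have dl : descendant s (sigma l) by exact: descendant_leaf_ancestor.
have dl' : descendant t (tau l').
  by apply: descendant_leaf_ancestor => //; rewrite -st -hdepth.
have e1 : level (sigma l) = l by rewrite level_leaf_ancestor//; case/andP: lp.
have e2 : level (tau l') = l' by rewrite level_leaf_ancestor// -hdepth; case/andP: lp'.
have h := A2 (r := l%:Z - M%:Z) _ dl dl'.
apply: le_trans (h _ _ _); last 3 first.
- by apply: upper_int_range; rewrite Ml Lmid_add; case/andP: lp.
- by rewrite e1 addrC subrK.
- by rewrite e2; exact: mirror_int.
rewrite -!mulrA ler_wpM2l// ler_pM ?Phi_ge0 ?(ltW (diam_dir_gt0 _ _))//.
  by apply: diam_dir_le => // u v; exact: box_diam_bound.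
exact: box_diam_bound.
Qed.

(** The counterpart for the other chain, where (A2) is applied with a non-positive r. *)
Lemma kappa_tau_sigma l l' k x y : (level s <= l <= p)%N -> (level s <= l' <= p)%N ->
  (l + l' = M + M)%N -> (M <= l)%N -> box_set (BI (sigma l')) x -> box_set (BI (sigma l')) y ->
  kappa * diam_dir k (BJ (tau l)) * Phi x y <= eta2 * D.
Proof.
move=> lp lp' ll Ml Bx By.
have dl : descendant s (sigma l') by exact: descendant_leaf_ancestor.
have dl' : descendant t (tau l).
  by apply: descendant_leaf_ancestor => //; rewrite -st -hdepth.
have e1 : level (sigma l') = l' by rewrite level_leaf_ancestor//; case/andP: lp'.
have e2 : level (tau l) = l by rewrite level_leaf_ancestor// -hdepth; case/andP: lp.
have h := A2 (r := l'%:Z - M%:Z) _ dl dl'.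
apply: le_trans (h _ _ _); last 3 first.
- by apply: lower_int_range ll _; rewrite Ml Lmid_add; case/andP: lp.
- by rewrite e1 addrC subrK.
- by rewrite e2; apply: mirror_int; rewrite addnC.
rewrite -!mulrA ler_wpM2l// mulrC ler_pM ?Phi_ge0 ?(ltW (diam_dir_gt0 _ _))//.
  exact: box_diam_bound.
by apply: diam_dir_le => // u v; exact: box_diam_bound.
Qed.

Lemma kBF_error x y : box_set (BI (leaf_of TI i)) x -> box_set (BJ (leaf_of TJ j)) y ->
  normc (kHelm kappa x y - kBF kappa BI BJ px py xi (level s) i j x y) <=
  (1 + Fac ^+ L * (1 + La) ^+ 3) * (chain_error L / D).
Proof.
move=> Bx By; have D0 := adm_dist_gt0.
have ML : (M + L <= p)%N by rewrite Lmid_add.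
have diamI : diam (BI s) <= eta1 * D by apply: le_trans adm; rewrite le_max lexx.
have diamJ : diam (BJ t) <= eta1 * D by apply: le_trans adm; rewrite le_max lexx orbT.
have opYE : (fun r => phase_interp xi kappa (BJ (tau (M + r)))
      (fun y' => Phi (px (sigma (M - r))) y')) =
    (fun r => phase_interp xi kappa (BJ (tau (M + r)))
      (fun y' => Phi y' (px (sigma (M - r))))).
  apply/funext => r; congr phase_interp; apply/funext => y'; exact: PhiC.
rewrite /kBF -/p -/L -/M -/sigma -/tau opYE.
apply: (@two_chains_error D L (BI s) (BJ t) (fun r => BI (sigma (M + r)%N))
  (fun r => BJ (tau (M + r)%N)) (fun r => py (tau (M - r)%N)) (fun r => px (sigma (M - r)%N))) => //.
- by move=> u v Bu Bv; exact: box_dist_le.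
- by move=> r rL; apply/sigma_sub/upper_range.
- by move=> r rL; apply/tau_sub/upper_range.
- by move=> r rL; apply: tau_sub (hpy _); exact: lower_range.
- by move=> r rL; apply: sigma_sub (hpx _); exact: lower_range.
- move=> r k rL; apply: le_trans diamI; apply: diam_dir_le.
    by move=> u v; exact: box_diam_bound.
  exact/sigma_sub/upper_range.
- move=> r k rL; apply: le_trans diamJ; apply: diam_dir_le.
    by move=> u v; exact: box_diam_bound.
  exact/tau_sub/upper_range.
- move=> r rL; apply: sigma_mono; rewrite leq_add2l leqnSn /=.
  by case/andP: (upper_range rL).
- move=> r rL; apply: tau_mono; rewrite leq_add2l leqnSn /=.
  by case/andP: (upper_range rL).
- move=> r k rL; rewrite addnS; apply: A3I.
    exact/descendant_leaf_ancestor/upper_range/ltnW.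
  by apply: leaf_ancestor_sons => //; case/andP: (upper_range rL); rewrite addnS.
- move=> r k rL; rewrite addnS; apply: A3J.
    by apply: descendant_leaf_ancestor => //; rewrite -st -hdepth; exact/upper_range/ltnW.
  by apply: leaf_ancestor_sons => //; rewrite -hdepth; case/andP: (upper_range rL); rewrite addnS.
(* The points for r and r + 1 lie in nested boxes on levels M - r and M - r - 1. Both are in the
   larger one, whose level mirrors M + r + 1. *)
- move=> r k rL; apply: (kappa_sigma_tau _ (upper_range rL) (lower_range rL)) => //.
  + by rewrite -addnA subnKC// (leq_trans rL)// Lhalf_le_mid.
  + by rewrite leq_addr.
  + by apply: tau_mono (hpy _); rewrite leq_sub2l//=; case/andP: (lower_range (ltnW rL)).
- move=> r k rL; apply: (kappa_tau_sigma _ (upper_range rL) (lower_range rL)) => //.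
  + by rewrite -addnA subnKC// (leq_trans rL)// Lhalf_le_mid.
  + by rewrite leq_addr.
  + by apply: sigma_mono (hpx _); rewrite leq_sub2l//=; case/andP: (lower_range (ltnW rL)).
- move=> k u; have := upper_range (leq0n L); rewrite addn0 subn0 => h Bu.
  by apply: (kappa_sigma_tau _ h h).
- move=> k u; have := upper_range (leq0n L); rewrite addn0 subn0 => h Bu.
  by apply: (kappa_tau_sigma _ h h).
(* Level M + L = p is the leaf level, so the chain ends on the leaf box. *)
- by rewrite Lmid_add /p -(level_leaf_of hTI i) /sigma ancestor_self.
- by rewrite Lmid_add /p hdepth -(level_leaf_of hTJ j) /tau ancestor_self.
Qed.

End Butterfly.
End KernelError.

(** * Surface integrals *)

Section DoubleIntegral.
Context d (T : measurableType d) (R : realType).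
Variable mu : {sigma_finite_measure set T -> \bar R}.

Section Dominated.
Variables (a b : T -> R).
Hypotheses (ia : mu.-integrable setT (EFin \o a)) (ib : mu.-integrable setT (EFin \o b)).
Hypotheses (a0 : forall x, 0 <= a x) (b0 : forall x, 0 <= b x).

Let G (z : T * T) : R := a z.1 * b z.2.

Let ma : measurable_fun setT a.
Proof. by apply/measurable_EFinP; exact: measurable_int ia. Qed.

Let mb : measurable_fun setT b.
Proof. by apply/measurable_EFinP; exact: measurable_int ib. Qed.

Let mG : measurable_fun setT G.
Proof.
apply: measurable_funM.
  exact: (measurableT_comp ma measurable_fst).
exact: (measurableT_comp mb measurable_snd).
Qed.

Let inner x : (\int[mu]_y (a x * b y)%:E = (a x * \int[mu]_y b y)%:E)%E.
Proof.
rewrite -RintegralZl// /Rintegral fineK//; apply: integrable_fin_num => //.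
by apply: (eq_integrable _ (fun y => (a x)%:E * (b y)%:E)%E) => //; exact: integrableZl.
Qed.

Let iG : (mu \x mu)%E.-integrable setT (EFin \o G).
Proof.
apply/integrable12ltyP; first exact/measurable_EFinP.
rewrite (eq_integral (fun x => (a x * \int[mu]_y b y)%:E)); last first.
  move=> x _; rewrite -inner; apply: eq_integral => y _ /=.
  by rewrite ger0_norm// mulr_ge0.
have h : mu.-integrable setT (fun x => (a x * \int[mu]_y b y)%:E).
  apply: (eq_integrable _ (fun x => (\int[mu]_y b y)%:E * (a x)%:E)%E) => //.
    by move=> x _; rewrite -EFinM mulrC.
  exact: integrableZl.
by have := integrable_fin_num measurableT h; rewrite fin_numElt => /andP[].
Qed.

(** Domination by a product of integrable functions gives integrability for the product measure,
    hence Fubini's theorem. *)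
Lemma dominated_double_integral (h : T -> T -> R) (M : R) :
  measurable_fun setT (fun z : T * T => h z.1 z.2) ->
  (forall x y, `|h x y| <= M * (a x * b y)) ->
  (mu \x mu)%E.-integrable setT (EFin \o (fun z => h z.1 z.2)) /\
  \int[mu]_x \int[mu]_y h x y = \int[(mu \x mu)%E]_z h z.1 z.2.
Proof.
move=> mh hM.
have ih : (mu \x mu)%E.-integrable setT (EFin \o (fun z => h z.1 z.2)).
  apply: (@le_integrable _ _ _ _ _ measurableT _ (fun z => M%:E * (G z)%:E)%E).
  - exact/measurable_EFinP.
  - move=> z _; rewrite -EFinM !abse_EFin lee_fin (le_trans (hM _ _))//.
    exact: ler_norm.
  - exact: integrableZl.
split=> //; rewrite [RHS]/Rintegral -(integral12_prod_meas1 ih).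
rewrite [LHS]/Rintegral; congr fine; apply: eq_integral => x _.
(* The real-valued integral takes a finite part; the inner integral is finite for every x, not just
   almost every x, so nothing is lost. *)
rewrite /Rintegral fineK//; apply: integrable_fin_num => //.
apply: (@le_integrable _ _ _ _ _ measurableT _ (fun y => (M * a x)%:E * (b y)%:E)%E).
- apply/measurable_EFinP.
  exact: (measurableT_comp mh (pair1_measurable x)).
- by move=> y _; rewrite -EFinM !abse_EFin lee_fin (le_trans (hM _ _))// mulrA ler_norm.
- exact: integrableZl.
Qed.

Lemma double_integral_diff (h1 h2 : T -> T -> R) (M e : R) :
  measurable_fun setT (fun z : T * T => h1 z.1 z.2) ->
  measurable_fun setT (fun z : T * T => h2 z.1 z.2) ->
  (forall x y, `|h1 x y| <= M * (a x * b y)) ->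
  (forall x y, `|h2 x y| <= M * (a x * b y)) ->
  (forall x y, `|h1 x y - h2 x y| <= e * (a x * b y)) ->
  `|\int[mu]_x \int[mu]_y h1 x y - \int[mu]_x \int[mu]_y h2 x y| <=
    e * (\int[mu]_x a x * \int[mu]_x b x).
Proof.
move=> mh1 mh2 h1M h2M he.
have [i1 ->] := dominated_double_integral mh1 h1M.
have [i2 ->] := dominated_double_integral mh2 h2M.
have i12 : (mu \x mu)%E.-integrable setT (EFin \o (fun z => h1 z.1 z.2 - h2 z.1 z.2)).
  by apply: (eq_integrable _ (fun z => (h1 z.1 z.2)%:E - (h2 z.1 z.2)%:E)%E) => //; exact: integrableB.
rewrite -RintegralB// (le_trans (le_normr_Rintegral _ _))//.
have [|_ GE] := @dominated_double_integral (fun x y => a x * b y) 1 mG.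
  by move=> x y; rewrite mul1r ger0_norm// mulr_ge0.
have -> : \int[mu]_x a x * \int[mu]_x b x = \int[(mu \x mu)%E]_z (a z.1 * b z.2).
  rewrite -GE -RintegralZr//; apply: eq_Rintegral => x _.
  by rewrite RintegralZl.
rewrite -RintegralZl//; apply: le_Rintegral => //.
- apply: (eq_integrable _ (abse \o (EFin \o (fun z => h1 z.1 z.2 - h2 z.1 z.2)))) => //.
  exact: integrable_abse.
- apply: (eq_integrable _ (fun z => e%:E * (G z)%:E)%E) => //; exact: integrableZl.
Qed.

End Dominated.
End DoubleIntegral.

(** * Measurability of the kernels *)

Section ComplexMeasurable.
Context {R : realType} {d : measure_display} {Z : measurableType d}.
Implicit Types (f g : Z -> R[i]) (v w : Z -> 'rV[R]_3).

Definition cmeasurable f : Prop := measurable_fun setT (fun z => complex.Re (f z)) /\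
  measurable_fun setT (fun z => complex.Im (f z)).

Definition vmeasurable v : Prop := forall i, measurable_fun setT (fun z => v z 0 i).

Lemma cmeasurable_cst c : cmeasurable (fun=> c).
Proof. by split; exact: measurable_cst. Qed.

Lemma cmeasurable_real (f : Z -> R) : measurable_fun setT f -> cmeasurable (fun z => (f z)%:C).
Proof. by move=> mf; split => //=; exact: measurable_cst. Qed.

Lemma cmeasurableD f g : cmeasurable f -> cmeasurable g -> cmeasurable (fun z => f z + g z).
Proof.
move=> [rf if_] [rg ig]; split.
  by under eq_fun do rewrite cReD; exact: measurable_funD.
by under eq_fun do rewrite cImD; exact: measurable_funD.
Qed.

Lemma cmeasurableM f g : cmeasurable f -> cmeasurable g -> cmeasurable (fun z => f z * g z).
Proof.
move=> [rf if_] [rg ig]; split.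
  under eq_fun do rewrite cReM.
  by apply: measurable_funB; exact: measurable_funM.
under eq_fun do rewrite cImM.
by apply: measurable_funD; exact: measurable_funM.
Qed.

Lemma cmeasurable_sum (I : Type) (s : seq I) (f : I -> Z -> R[i]) :
  (forall i, cmeasurable (f i)) -> cmeasurable (fun z => \sum_(i <- s) f i z).
Proof.
move=> mf; elim: s => [|i s IH].
  by under eq_fun do rewrite big_nil; exact: cmeasurable_cst.
by under eq_fun do rewrite big_cons; exact: cmeasurableD.
Qed.

Lemma cmeasurable_expi (f : Z -> R) : measurable_fun setT f -> cmeasurable (fun z => expi (f z)).
Proof.
move=> mf; split => /=.
  exact: (measurableT_comp (continuous_measurable_fun (@continuous_cos R)) mf).
exact: (measurableT_comp (continuous_measurable_fun (@continuous_sin R)) mf).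
Qed.

Lemma measurable_Phi v w : vmeasurable v -> vmeasurable w ->
  measurable_fun setT (fun z => Phi (v z) (w z)).
Proof.
move=> mv mw; rewrite /Phi /enorm.
apply: (measurableT_comp (continuous_measurable_fun (@sqrt_continuous R))).
apply: measurable_sum => i; apply: measurable_funX.
by under eq_fun do rewrite !mxE; exact: measurable_funB.
Qed.

(** Zeros matter, since the distance vanishes on the diagonal; there the inverse and the power -1
    both take the value 0. *)
Lemma measurable_invr_ge0 (f : Z -> R) : (forall z, 0 <= f z) -> measurable_fun setT f ->
  measurable_fun setT (fun z => (f z)^-1).
Proof.
move=> f0 mf; under eq_fun do rewrite -powR_inv1//.
exact: (measurableT_comp (measurable_powR (-1)) mf).
Qed.

Lemma cmeasurable_kHelm kappa v w : vmeasurable v -> vmeasurable w ->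
  cmeasurable (fun z => kHelm kappa (v z) (w z)).
Proof.
move=> mv mw; have mP := measurable_Phi mv mw.
rewrite /kHelm; under eq_fun do rewrite -fmorphV.
apply: cmeasurableM.
  by apply: cmeasurable_expi; apply: measurable_funM => //; exact: measurable_cst.
apply/cmeasurable_real/measurable_invr_ge0.
  by move=> z; rewrite !mulr_ge0 ?pi_ge0 ?Phi_ge0.
by apply: measurable_funM => //; exact: measurable_cst.
Qed.

(** Measurability of [f] in z at each fixed point suffices, because the operator samples at finitely
    many nodes that do not depend on z. This covers the nested chains of [kBF]. *)
Lemma cmeasurable_phase_interp m (xi : 'I_m.+1 -> R) kappa B psi (f : Z -> 'rV[R]_3 -> R[i]) v :
  (forall x, cmeasurable (fun z => f z x)) ->
  measurable_fun setT (fun z => psi (v z)) -> vmeasurable v ->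
  cmeasurable (fun z => phase_interp xi kappa B psi (f z) (v z)).
Proof.
move=> mf mpsi mv; apply: cmeasurableM.
  by apply: cmeasurable_expi; apply: measurable_funM => //; exact: measurable_cst.
apply: cmeasurable_sum => nu; apply: cmeasurableM.
  by apply: cmeasurableM => //; exact: cmeasurable_cst.
apply: cmeasurable_real; apply: measurable_prod => i _.
apply: (measurableT_comp (continuous_measurable_fun (@continuous_horner R _))).
rewrite /from_box; apply: measurable_funM; last exact: measurable_cst.
apply: measurable_funB; last exact: measurable_cst.
by apply: measurable_funM => //; exact: measurable_cst.
Qed.

Lemma cmeasurable_chain m (xi : 'I_m.+1 -> R) kappa (B : nat -> box R)
    (psi : nat -> 'rV[R]_3 -> R) L (f : Z -> 'rV[R]_3 -> R[i]) v :
  (forall r w, vmeasurable w -> measurable_fun setT (fun z => psi r (w z))) ->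
  (forall x, cmeasurable (fun z => f z x)) -> vmeasurable v ->
  cmeasurable (fun z =>
    chain (fun r => phase_interp xi kappa (B r) (psi r)) L (f z) (v z)).
Proof.
move=> mpsi mf; elim: L v => [|L IH] v mv /=.
  by apply: cmeasurable_phase_interp => //; exact: mpsi.
apply: cmeasurable_phase_interp => //; last exact: mpsi.
by move=> x; apply: IH => i; exact: measurable_cst.
Qed.

End ComplexMeasurable.

Section SurfaceIntegral.
Context {R : realType}.
Local Notation T := (borel3 R).

Lemma measurable_coord (i : 'I_3) : measurable_fun setT (fun x : T => (x : 'rV[R]_3) 0 i).
Proof.
move=> _; apply: (measurability _ (RGenOpens.measurableE R)) => //.
move=> _ [_ [a [b ->] <-]]; rewrite setTI; apply: sub_sigma_algebra => /=.
have := @coord_continuous R 1 3 0 i.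
by move/continuousP; apply; exact: interval_open.
Qed.

Lemma vmeasurable_fst : vmeasurable (fun z : T * T => z.1).
Proof. by move=> i; exact: (measurableT_comp (measurable_coord i) measurable_fst). Qed.

Lemma vmeasurable_snd : vmeasurable (fun z : T * T => z.2).
Proof. by move=> i; exact: (measurableT_comp (measurable_coord i) measurable_snd). Qed.

Lemma cmeasurable_kBF kappa N (TI TJ : cluster_tree N) (BI : TI -> box R) (BJ : TJ -> box R)
    px py m (xi : 'I_m.+1 -> R) l i j :
  cmeasurable (fun z : T * T => kBF kappa BI BJ px py xi l i j z.1 z.2).
Proof.
rewrite /kBF; apply: cmeasurable_chain.
- by move=> r w mw; apply: measurable_Phi => // k; exact: measurable_cst.
- move=> y; apply: cmeasurable_chain.
  + by move=> r w mw; apply: measurable_Phi => // k; exact: measurable_cst.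
  + by move=> x; exact: cmeasurable_cst.
  + exact: vmeasurable_fst.
- exact: vmeasurable_snd.
Qed.

Variables (Gamma : set 'rV[R]_3) (mu : {sigma_finite_measure set T -> \bar R}).
Hypothesis mGamma : measurable (Gamma : set T).

(** Extension by 0 turns integrals over Gamma into integrals over the whole space, the setting of
    the double integral lemmas. *)
Definition crestrict (f : 'rV[R]_3 -> R[i]) (x : 'rV[R]_3) : R[i] :=
  if x \in Gamma then f x else 0.

Lemma patch_crestrict (F : R[i] -> R) f : F 0 = 0 ->
  ((fun x => F (f x)) : T -> R) \_ Gamma = (fun x => F (crestrict f x)).
Proof. by move=> F0; apply/funext => x; rewrite /patch /crestrict; case: ifP. Qed.

Lemma integrable_crestrict f : integrablec mu Gamma f ->
  mu.-integrable setT (fun x : T => (complex.Re (crestrict f x))%:E) /\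
  mu.-integrable setT (fun x : T => (complex.Im (crestrict f x))%:E).
Proof.
move=> [rf if_]; split.
  move/(integrable_mkcond _ mGamma): rf.
  by rewrite -[X in _ -> mu.-integrable _ X]/(EFin \o _) -patch_crestrict// -restrict_EFin.
move/(integrable_mkcond _ mGamma): if_.
by rewrite -[X in _ -> mu.-integrable _ X]/(EFin \o _) -patch_crestrict// -restrict_EFin.
Qed.

Lemma cmeasurable_crestrict f : integrablec mu Gamma f -> cmeasurable (crestrict f : T -> R[i]).
Proof.
move=> /integrable_crestrict[rf if_].
by split; apply/measurable_EFinP; [exact: measurable_int rf|exact: measurable_int if_].
Qed.

Lemma measurable_normc (f : T -> R[i]) : cmeasurable f -> measurable_fun setT (fun x => normc (f x)).
Proof.
move=> [rf if_]; under eq_fun do rewrite normcEsqrt.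
apply: (measurableT_comp (continuous_measurable_fun (@sqrt_continuous R))).
by apply: measurable_funD; exact: measurable_funX.
Qed.

Lemma integrable_normc f : integrablec mu Gamma f ->
  mu.-integrable setT (EFin \o (fun x : T => normc (crestrict f x))).
Proof.
move=> hf; have [rf if_] := integrable_crestrict hf.
apply: (@le_integrable _ _ _ _ _ measurableT _
  (fun x : T => `|(complex.Re (crestrict f x))%:E| + `|(complex.Im (crestrict f x))%:E|)%E).
- apply/measurable_EFinP; exact: (measurable_normc (cmeasurable_crestrict hf)).
- move=> x _; rewrite /= lee_fin ger0_norm ?normc_ge0// ger0_norm ?addr_ge0//.
  exact: normc_le_ReIm.
- by apply: integrableD => //; exact: integrable_abse.
Qed.

Lemma L1norm_crestrict f : L1norm mu Gamma f = \int[mu]_x normc (crestrict f x).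
Proof. by rewrite /L1norm Rintegral_mkcond patch_crestrict// normc0. Qed.

Lemma double_crestrict (F : R[i] -> R) (k : 'rV[R]_3 -> 'rV[R]_3 -> R[i]) f g : F 0 = 0 ->
  \int[mu]_(x in Gamma) \int[mu]_(y in Gamma) F (k x y * g y * f x) =
  \int[mu]_x \int[mu]_y F (k x y * crestrict g y * crestrict f x).
Proof.
move=> F0; rewrite Rintegral_mkcond; apply: eq_Rintegral => x _.
rewrite /patch /crestrict; case: ifP => xG; last first.
  have -> : (fun y : T => F (k x y * (if y \in Gamma then g y else 0) * 0)) = cst 0.
    by apply/funext => y; rewrite mulr0.
  by rewrite /Rintegral integral0.
rewrite Rintegral_mkcond; apply: eq_Rintegral => y _.
by rewrite /patch; case: ifP => // _; rewrite mulr0 mul0r.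
Qed.

Lemma Re_galerkin N (phi : 'I_N -> 'rV[R]_3 -> R[i]) k i j :
  complex.Re (galerkin Gamma mu phi k i j) = \int[mu]_x \int[mu]_y
    complex.Re (k x y * crestrict (phi j) y * crestrict (phi i) x).
Proof. exact: (double_crestrict (F := @complex.Re R)). Qed.

Lemma Im_galerkin N (phi : 'I_N -> 'rV[R]_3 -> R[i]) k i j :
  complex.Im (galerkin Gamma mu phi k i j) = \int[mu]_x \int[mu]_y
    complex.Im (k x y * crestrict (phi j) y * crestrict (phi i) x).
Proof. exact: (double_crestrict (F := @complex.Im R)). Qed.

(** Where a shape function vanishes so does the integrand, hence the restricted hypothesis on the
    kernels. M provides integrability; the 2 comes from treating real and imaginary parts
    separately. *)
Lemma galerkin_diff N (phi : 'I_N -> 'rV[R]_3 -> R[i]) k1 k2 i j (M e : R) :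
  (forall i, integrablec mu Gamma (phi i)) -> 0 <= M -> 0 <= e ->
  cmeasurable (fun z : T * T => k1 z.1 z.2) -> cmeasurable (fun z : T * T => k2 z.1 z.2) ->
  (forall x y, Gamma x -> Gamma y -> phi i x <> 0 -> phi j y <> 0 ->
     [/\ normc (k1 x y) <= M, normc (k2 x y) <= M & normc (k1 x y - k2 x y) <= e]) ->
  normc (galerkin Gamma mu phi k1 i j - galerkin Gamma mu phi k2 i j) <=
  2 * e * (L1norm mu Gamma (phi i) * L1norm mu Gamma (phi j)).
Proof.
move=> hphi M0 e0 mk1 mk2 hk.
set fi := crestrict (phi i); set fj := crestrict (phi j).
have hk' x y : [/\ normc (k1 x y * fj y * fi x) <= M * (normc (fi x) * normc (fj y)),
    normc (k2 x y * fj y * fi x) <= M * (normc (fi x) * normc (fj y)) &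
    normc (k1 x y * fj y * fi x - k2 x y * fj y * fi x) <= e * (normc (fi x) * normc (fj y))].
  have E (c A : R[i]) : normc (A * fj y * fi x) = normc A * (normc (fi x) * normc (fj y)).
    by rewrite !normcM -mulrA (mulrC (normc (fj y))).
  rewrite -!mulrBl !(E 0).
  have [z|z] := eqVneq (normc (fi x) * normc (fj y)) 0; first by rewrite z !mulr0.
  have [z1 z2] : fi x != 0 /\ fj y != 0.
    by move: z; rewrite mulf_eq0 negb_or !normc_eq0 => /andP.
  have xG : Gamma x.
    by move: z1; rewrite /fi /crestrict; case: ifP => [/set_mem//|_]; rewrite eqxx.
  have yG : Gamma y.
    by move: z2; rewrite /fj /crestrict; case: ifP => [/set_mem//|_]; rewrite eqxx.
  have n0 : 0 <= normc (fi x) * normc (fj y) by rewrite mulr_ge0 ?normc_ge0.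
  have [||h1 h2 h3] := hk x y xG yG.
  - by move: z1; rewrite /fi /crestrict mem_set// => /eqP.
  - by move: z2; rewrite /fj /crestrict mem_set// => /eqP.
  by split; rewrite ler_wpM2r.
have mprod k : cmeasurable (fun z : T * T => k z.1 z.2) ->
    cmeasurable (fun z : T * T => k z.1 z.2 * fj z.2 * fi z.1).
  move=> mk; have [rj ij] := cmeasurable_crestrict (hphi j).
  have [ri ii] := cmeasurable_crestrict (hphi i).
  apply: cmeasurableM; first apply: cmeasurableM => //.
    by split; [exact: (measurableT_comp rj measurable_snd)|exact: (measurableT_comp ij measurable_snd)].
  by split; [exact: (measurableT_comp ri measurable_fst)|exact: (measurableT_comp ii measurable_fst)].
have [m1r m1i] := mprod _ mk1; have [m2r m2i] := mprod _ mk2.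
have ii := integrable_normc (hphi i); have ij := integrable_normc (hphi j).
have n0 f x : 0 <= normc (crestrict f x) by exact: normc_ge0.
rewrite !L1norm_crestrict.
have := Im_galerkin phi k2 i j; have := Re_galerkin phi k2 i j.
have := Im_galerkin phi k1 i j; have := Re_galerkin phi k1 i j.
move: (galerkin _ _ _ k1 i j) (galerkin _ _ _ k2 i j) => g1 g2 R1 I1 R2 I2.
have HR : `|complex.Re g1 - complex.Re g2| <=
    e * (\int[mu]_x normc (fi x) * \int[mu]_x normc (fj x)).
  rewrite R1 R2.
  apply: (double_integral_diff ii ij (n0 _) (n0 _) m1r m2r (M := M)) => x y.
  + by have [h _ _] := hk' x y; exact: le_trans (Re_le_normc _) h.
  + by have [_ h _] := hk' x y; exact: le_trans (Re_le_normc _) h.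
  + have [_ _ h] := hk' x y; apply: le_trans h.
    by rewrite -cReN -cReD; exact: Re_le_normc.
have HI : `|complex.Im g1 - complex.Im g2| <=
    e * (\int[mu]_x normc (fi x) * \int[mu]_x normc (fj x)).
  rewrite I1 I2.
  apply: (double_integral_diff ii ij (n0 _) (n0 _) m1i m2i (M := M)) => x y.
  + by have [h _ _] := hk' x y; exact: le_trans (Im_le_normc _) h.
  + by have [_ h _] := hk' x y; exact: le_trans (Im_le_normc _) h.
  + have [_ _ h] := hk' x y; apply: le_trans h.
    by rewrite -cImN -cImD; exact: Im_le_normc.
move: HR HI; move: (\int[mu]_x normc (fi x) * _) => X.
rewrite -cReN -cReD -cImN -cImD => HR HI.
apply: le_trans (normc_le_ReIm _) _; rewrite -mulrA mulr_natl mulr2n.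
exact: lerD.
Qed.

End SurfaceIntegral.

(** * Constants *)

Section Constants.
Context {R : realType}.

Lemma nat_le_expR (g : R) (m : nat) : 0 < g -> m.+1%:R <= expR g / g * expR (g * m%:R).
Proof.
move=> g0; rewrite mulrAC ler_pdivlMr// -expRD.
have -> : g + g * m%:R = g * m.+1%:R by rewrite -[m.+1]addn1 natrD mulrDr mulr1 addrC.
rewrite mulrC (le_trans _ (expR_ge1Dx _))// lerDr//.
Qed.

Lemma powR_le_expR (lam g : R) : 0 < lam -> 0 < g -> exists2 K : R, 0 < K &
  forall m : nat, m.+1%:R `^ lam <= K * expR (g * m%:R).
Proof.
move=> lam0 g0; have gl : 0 < g / lam by rewrite divr_gt0.
exists ((expR (g / lam) / (g / lam)) `^ lam).
  by rewrite powR_gt0// divr_gt0 ?expR_gt0.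
move=> m; have h := nat_le_expR m gl.
have c0 : 0 <= expR (g / lam) / (g / lam) by rewrite divr_ge0 ?expR_ge0 ?ltW.
apply: le_trans (_ : _ <= (expR (g / lam) / (g / lam) * expR (g / lam * m%:R)) `^ lam) _.
  by apply: ge0_ler_powR; rewrite ?nnegrE ?(ltW lam0)// mulr_ge0 ?expR_ge0.
rewrite powRM ?expR_ge0// -expRM.
by rewrite (_ : g / lam * m%:R * lam = g * m%:R)//; field; rewrite gt_eqF.
Qed.

(** An arbitrarily small exponential rate g absorbs the Lebesgue constant and the factor m + 1 of
    [step_error]. *)
Lemma lebesgue_growth (CL lam g : R) : 0 < CL -> 0 < lam -> 0 < g ->
  exists2 K : R, 1 <= K & forall m : nat,
    1 + CL * m.+1%:R `^ lam <= K * expR (g * m%:R) /\ m.+1%:R <= K * expR (g * m%:R).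
Proof.
move=> CL0 lam0 g0; have [K K0 hK] := powR_le_expR lam0 g0.
have c0 : 0 <= expR g / g by rewrite divr_ge0 ?expR_ge0 ?ltW.
exists (1 + CL * K + expR g / g).
  by rewrite -addrA lerDl addr_ge0// mulr_ge0 ?ltW.
move=> m; have e1 : 1 <= expR (g * m%:R).
  by rewrite -expR0 ler_expR mulr_ge0// ltW.
have e0 : 0 <= expR (g * m%:R) := le_trans ler01 e1.
have h1 := ler_wpM2l (ltW CL0) (hK m); have h2 := nat_le_expR m g0.
have p1 : 0 <= expR g / g * expR (g * m%:R) by rewrite mulr_ge0.
have p2 : 0 <= CL * K * expR (g * m%:R).
  by have := ltW K0; have := ltW CL0 => *; rewrite !mulr_ge0.
by split; rewrite !mulrDl mul1r; lra.
Qed.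

Lemma power_le_linear (d : R) L : 0 <= d -> L%:R * d <= 1 / 2 ->
  (1 + d) ^+ L - 1 <= 2 * (L%:R * d).
Proof.
move=> d0 Ld; have x0 : 0 <= L%:R * d by rewrite mulr_ge0.
have h : (1 + d) ^+ L <= expR (L%:R * d).
  by rewrite expRM_natl lerXn2r ?nnegrE ?addr_ge0 ?expR_ge0 ?expR_ge1Dx.
have /andP[_] : 0 <= expR (L%:R * d) - 1 - L%:R * d <= 2 * (L%:R * d) ^+ 2.
  by apply: expRB1x_le; rewrite ger0_norm.
by rewrite expr2; nra.
Qed.

(** The budget in units of x = be m: a step decays like exp(-8x) and its factors W^3 (m + 1) cost at
    most K^4 exp(2x). The depth and the constant 2 A1 cost exp x each, which leaves exp(-4x) for all
    levels together. The factor W^6 of the two chains costs one more exp x, whence b = 3 be. *)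
Lemma error_constants (eta1 eta2 q CL lam : R) : 0 < eta1 -> 0 < q < 1 ->
  0 < CL -> 0 < lam ->
  exists C b b' : R, [/\ 0 < C, 0 < b, 0 < b' & forall (m p L : nat) (La : R),
    b' * ln (2 + p%:R) <= m%:R -> (L <= p)%N -> La = CL * m.+1%:R `^ lam ->
    (1 + chain_factor (nbhd_width eta1) eta2 q m La ^+ L * (1 + La) ^+ 3) *
      chain_error eta1 eta2 q La m L <= C * expR (- (b * m%:R))].
Proof.
move=> eta10 q1 CL0 lam0; have /andP[q0 qlt] := q1.
set de := nbhd_width eta1; have /andP[de0 de1] : 0 < de <= 1 := nbhd_width_gt0 eta10.
set s := Num.sqrt q; have s0 : 0 <= s by rewrite sqrtr_ge0.
have slt : s < 1 by rewrite -sqrtr1 ltr_sqrt.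
pose th := (1 + s * de) * (1 + de)^-1.
have r0 : 0 < 1 + de by rewrite addr_gt0.
have n0 : 0 < 1 + s * de by rewrite ltr_pwDl// mulr_ge0// ltW.
have th0 : 0 < th by rewrite mulr_gt0// invr_gt0.
have th1 : th < 1 by rewrite ltr_pdivrMr// mul1r ltrD2l gtr_pMl.
pose be := - ln th / 8.
have be0 : 0 < be by rewrite divr_gt0// oppr_gt0 ln_lt0// th0.
have thE m : th ^+ m = expR (- (8 * be * m%:R)).
  rewrite -[th in LHS]lnK ?posrE// -expRM_natl; congr expR.
  by rewrite /be; field.
(* The rate be/6 lets six stability factors cost exp x. *)
have [K K1 hK] := lebesgue_growth CL0 lam0 (divr_gt0 be0 (ltr0Sn R 5)).
have K0 : 0 < K := lt_le_trans ltr01 K1.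
pose A := 10 * expR (4 * eta2) / de.
have A0 : 0 < A by rewrite divr_gt0// mulr_gt0 ?expR_gt0.
have AE : 10 * expR (4 * eta2) / de = A by [].
clearbody A.
pose A1 := A * K ^+ 4; have A10 : 0 < A1 by rewrite mulr_gt0// exprn_gt0.
have l2 : 0 < ln 2 :> R by rewrite ln_gt0// ltr1n.
have bl2 : 0 < be * ln 2 by rewrite mulr_gt0.
(* The first summand of b' ensures p <= exp x and the second 2 A1 <= exp x; the latter relies on ln
   (2 + p) >= ln 2 > 0. *)
exists (3 * K ^+ 6 * (A + 1)), (3 * be), (be^-1 + `|ln (2 * A1)| / (be * ln 2)).
split.
- by rewrite !mulr_gt0 ?exprn_gt0// addr_gt0.
- by rewrite mulr_gt0.
- by rewrite ltr_pwDl ?invr_gt0// divr_ge0// ltW.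
move=> m p L La hm Lp LaE; set x := be * m%:R.
have x0 : 0 <= x by rewrite mulr_ge0// ltW.
have [hW hm1] := hK m; rewrite -LaE in hW.
set W := 1 + La in hW *; set ex := expR (be / 6%:R * m%:R) in hW hm1.
have La0 : 0 <= La by rewrite LaE mulr_ge0 ?powR_ge0 ?ltW.
have W1 : 1 <= W by rewrite lerDl.
have W0 : 0 <= W := le_trans ler01 W1.
have ex0 : 0 < ex by exact: expR_gt0.
have exE n : ex ^+ n = expR (n%:R * (x / 6)).
  by rewrite /ex -expRM_natl; congr expR; rewrite /x; ring.
have Wn n : W ^+ n <= K ^+ n * expR (n%:R * (x / 6)).
  by rewrite -exE -exprMn lerXn2r ?nnegrE// ltW// mulr_gt0.
have p2 : 0 < 2 + p%:R :> R by rewrite ltr_pwDl.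
have lnp : ln 2 <= ln (2 + p%:R) :> R by rewrite ler_ln ?posrE// lerDl.
have lnp0 : 0 < ln (2 + p%:R) :> R := lt_le_trans l2 lnp.
have px : p%:R <= expR x.
  apply: le_trans (_ : 2 + p%:R <= _); first by rewrite lerDr.
  rewrite -[leLHS]lnK ?posrE// ler_expR /x -ler_pdivrMl//.
  apply: le_trans hm; rewrite ler_wpM2r ?(ltW lnp0)// lerDl.
  by rewrite divr_ge0// ltW.
have Ax : 2 * A1 <= expR x.
  have A12 : 0 < 2 * A1 by rewrite mulr_gt0.
  rewrite -[leLHS]lnK ?posrE// ler_expR /x -ler_pdivrMl//.
  apply: le_trans (ler_norm _) _; rewrite normrM ger0_norm ?invr_ge0 ?(ltW be0)//.
  apply: le_trans hm.
  apply: le_trans (_ : `|ln (2 * A1)| / (be * ln 2) * ln (2 + p%:R) <= _); last first.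
    by rewrite ler_wpM2r ?(ltW lnp0)// lerDr invr_ge0 ltW.
  apply: le_trans (_ : `|ln (2 * A1)| / (be * ln 2) * ln 2 <= _).
    rewrite [leRHS](_ : _ = be^-1 * `|ln (2 * A1)|)//.
    by field; rewrite !gt_eqF.
  by rewrite ler_wpM2l// divr_ge0// ltW.
pose d := W ^+ 3 * step_error de eta2 q m.
have stepE : step_error de eta2 q m = A * m.+1%:R * expR (- (8 * x)).
  by rewrite /step_error -/s -/th thE AE /x mulrA.
have d0 : 0 <= d.
  by rewrite /d stepE !mulr_ge0 ?exprn_ge0 ?expR_ge0// ltW.
have dA : d <= A1 * expR (- (6 * x)).
  have h : W ^+ 3 * m.+1%:R <= K ^+ 3 * expR (3 * (x / 6)) * (K * ex).
    by rewrite ler_pM ?exprn_ge0.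
  have := ler_wpM2r (_ : 0 <= A * expR (- (8 * x))) h; rewrite /d stepE.
  move=> /(_ _)/le_trans h2.
  have -> : W ^+ 3 * (A * m.+1%:R * expR (- (8 * x))) =
    W ^+ 3 * m.+1%:R * (A * expR (- (8 * x))) by ring.
  apply: h2; first by rewrite mulr_ge0 ?expR_ge0 ?ltW.
  have -> : ex = expR (x / 6) by rewrite /ex /x; congr expR; ring.
  have -> : K ^+ 3 * expR (3 * (x / 6)) * (K * expR (x / 6)) * (A * expR (- (8 * x))) =
    A1 * (expR (3 * (x / 6)) * expR (x / 6) * expR (- (8 * x))) by rewrite /A1; ring.
  rewrite ler_wpM2l ?(ltW A10)// -!expRD ler_expR; lra.
have Ld : L%:R * d <= expR (- (4 * x)) / 2.
  apply: le_trans (_ : expR x * (A1 * expR (- (6 * x))) <= _).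
    by rewrite ler_pM// (le_trans _ px)// ler_nat.
  have -> : expR (- (4 * x)) = expR x * expR x * expR (- (6 * x)).
    by rewrite -!expRD; congr expR; ring.
  have := ler_wpM2l (_ : 0 <= expR x * expR (- (6 * x))) Ax.
  move=> /(_ _) h; have : 0 <= expR x * expR (- (6 * x)) by rewrite mulr_ge0 ?expR_ge0.
  by move=> /h; lra.
have e41 : expR (- (4 * x)) <= 1.
  by rewrite -expR0 ler_expR oppr_le0 mulr_ge0.
have Ld2 : L%:R * d <= 1 / 2 by apply: le_trans Ld _; lra.
have FL := power_le_linear d0 Ld2.
have FE : chain_factor de eta2 q m La = 1 + d by [].
rewrite /chain_error FE -/de -/W.
have initE : init_error de eta2 m <= A * expR (- (4 * x)).
  rewrite /init_error AE ler_wpM2l ?(ltW A0)//.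
  (* The ratio 1 / (1 + de) of the first interpolation is at most [th], so one rate serves both
     errors. *)
  apply: le_trans (_ : th ^+ m <= _).
    rewrite lerXn2r ?nnegrE ?invr_ge0 ?(ltW r0) ?(ltW th0)//.
    by rewrite /th ler_peMl ?invr_ge0 ?(ltW r0)// lerDl mulr_ge0// ltW.
  by rewrite thE ler_expR lerN2 -mulrA -/x ler_wpM2r// ler_nat.
have W3 : 1 <= W ^+ 3 by rewrite exprn_ege1.
have T1 : 1 + (1 + d) ^+ L * W ^+ 3 <= 3 * W ^+ 3.
  have : (1 + d) ^+ L <= 2 by lra.
  nra.
have T2 : init_error de eta2 m + ((1 + d) ^+ L - 1) <= (A + 1) * expR (- (4 * x)).
  by rewrite mulrDl mul1r; lra.
have F1 : 0 <= (1 + d) ^+ L - 1 by rewrite subr_ge0 exprn_ege1// lerDl.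
have I0 : 0 <= init_error de eta2 m.
  by rewrite /init_error AE mulr_ge0 ?(ltW A0)// exprn_ge0// invr_ge0 ltW.
apply: le_trans (_ : 3 * W ^+ 3 * (W ^+ 3 * ((A + 1) * expR (- (4 * x)))) <= _).
  apply: ler_pM => //.
  - by rewrite addr_ge0// mulr_ge0 ?exprn_ge0// addr_ge0.
  - by rewrite mulr_ge0 ?exprn_ge0// addr_ge0.
  - by rewrite ler_wpM2l ?exprn_ge0.
have -> : 3 * W ^+ 3 * (W ^+ 3 * ((A + 1) * expR (- (4 * x)))) =
  3 * (A + 1) * expR (- (4 * x)) * W ^+ 6 by ring.
have A11 : 0 <= 3 * (A + 1) * expR (- (4 * x)).
  by rewrite !mulr_ge0 ?expR_ge0// addr_ge0// ltW.
apply: le_trans (ler_wpM2l A11 (Wn 6%N)) _.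
rewrite [leLHS](_ : _ = 3 * K ^+ 6 * (A + 1) * (expR (- (4 * x)) * expR (6 * (x / 6)))); last by ring.
rewrite ler_wpM2l//; first by rewrite !mulr_ge0 ?exprn_ge0 ?(ltW K0)// addr_ge0// ltW.
have -> : 3 * be * m%:R = 3 * x by rewrite /x mulrA.
by rewrite -expRD ler_expR; lra.
Qed.

End Constants.

Close Scope complex_scope.
Unset Implicit Arguments.

Theorem theorem3p1 (R : realType) (eta1 eta2 q CL lam : R)
    (heta1 : 0 < eta1) (heta2 : 0 < eta2) (hq : 0 < q < 1)
    (hCL : 0 < CL) (hlam : 0 < lam) :
  exists C b b' : R, [/\ 0 < C, 0 < b, 0 < b' &
    forall (xi : forall m : nat, 'I_m.+1 -> R)
      (xi_inj : forall m, injective (xi m))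
      (xi_range : forall m j, xi m j \in `[-1, 1])
      (xi_lebesgue : forall m,
        (lebesgue_const (xi m) <= (CL * (m.+1)%:R `^ lam)%:E)%E)
      (Gamma : set 'rV[R]_3) (hGamma : bounded_surface Gamma)
      (mu : {sigma_finite_measure set (borel3 R) -> \bar R})
      (hmu : is_surface_measure Gamma mu)
      (kappa : R) (hkappa : 0 <= kappa)
      (N : nat) (phi : 'I_N -> 'rV[R]_3 -> R[i])
      (hphi : forall i, integrablec mu Gamma (phi i))
      (TI TJ : cluster_tree N)
      (hTI : is_cluster_tree TI) (hTJ : is_cluster_tree TJ)
      (hdepth : depth TI = depth TJ)
      (BI : TI -> box R) (BJ : TJ -> box R)
      (suppI : forall s i, i \in idx s -> supp Gamma (phi i) `<=` BI s)
      (suppJ : forall t j, j \in idx t -> supp Gamma (phi j) `<=` BJ t)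
      (nestI : forall s s' : TI, s' \in sons s -> BI s' `<=` BI s)
      (nestJ : forall t t' : TJ, t' \in sons t -> BJ t' `<=` BJ t)
      (px : TI -> 'rV[R]_3) (hpx : forall s, box_set (BI s) (px s))
      (py : TJ -> 'rV[R]_3) (hpy : forall t, box_set (BJ t) (py t))
      (A1 : forall s t, adm_leaf eta1 BI BJ s t ->
        Num.max (diam (BI s)) (diam (BJ t)) <= eta1 * dist (BI s) (BJ t))
      (A2 : forall s t, adm_leaf eta1 BI BJ s t ->
        let L := Lhalf (depth TI) (level s) in
        let M := Lmid (depth TI) (level s) in
        forall r : int, - (L%:Z) <= r <= L%:Z ->
        forall (s' : TI) (t' : TJ), descendant s s' -> descendant t t' ->
          (level s')%:Z = M%:Z + r -> (level t')%:Z = M%:Z - r ->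
          kappa * diam (BI s') * diam (BJ t') <= eta2 * dist (BI s) (BJ t))
      (A3 : forall s t, adm_leaf eta1 BI BJ s t ->
        (forall s1 s2 : TI, descendant s s1 -> s2 \in sons s1 ->
          forall i, diam_dir i (BI s2) <= q * diam_dir i (BI s1)) /\
        (forall t1 t2 : TJ, descendant t t1 -> t2 \in sons t1 ->
          forall i, diam_dir i (BJ t2) <= q * diam_dir i (BJ t1)))
      (m : nat) (hm : b' * ln (2 + (depth TI)%:R) <= m%:R),
    let K := stiffness kappa Gamma mu phi in
    let Kt := butterfly kappa Gamma mu phi eta1 BI BJ px py (xi m) in
    forall (s : TI) (t : TJ) (i j : 'I_N), i \in idx s -> j \in idx t ->
      (adm_leaf eta1 BI BJ s t ->
        normc (K i j - Kt i j) <=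
          C * (L1norm mu Gamma (phi i) * L1norm mu Gamma (phi j)
               / dist (BI s) (BJ t)) * expR (- (b * m%:R))) /\
      (inadm_leaf eta1 BI BJ s t -> K i j - Kt i j = 0)].
Proof.
have [C [b [b' [C0 b0 b'0 hC]]]] := error_constants eta2 heta1 hq hCL hlam.
(* The 2 is that of [galerkin_diff]. *)
exists (2 * C), b, b'; split => //; first by rewrite mulr_gt0.
move=> xi xi_inj xi_range xi_lebesgue Gamma hGamma mu hmu kappa hkappa N phi hphi.
move=> TI TJ hTI hTJ hdepth BI BJ suppI suppJ nestI nestJ px hpx py hpy A1 A2 A3 m hm.
move=> K Kt s t i j is_ jt; have [mGamma _ _] := hGamma.
pose pk (u : TI * TJ) := `[< adm_leaf eta1 BI BJ u.1 u.2 >] && (i \in idx u.1) && (j \in idx u.2).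
have KtE : Kt i j = if [pick u | pk u] is Some u
    then galerkin Gamma mu phi (kBF kappa BI BJ px py (xi m) (level u.1) i j) i j
    else stiffness kappa Gamma mu phi i j.
  by rewrite /Kt /butterfly mxE.
split=> [[bst adm]|[bst nadm ls lt]]; last first.
  (* An admissible leaf containing (i, j) would coincide with the given inadmissible one, so [pick]
     finds none and the entry is left unchanged. *)
  rewrite KtE; case: pickP => [[s' t']|_]; last by rewrite subrr.
  move=> /andP[/andP[/asboolP[/= bst' adm'] is'] jt'].
  have [||e1 e2] := leaf_block_unique hTI hTJ bst bst' _ _ is_ is' jt jt'.
  - by right; rewrite ls lt.
  - by left.
  - by case: nadm; rewrite e1 e2.
have KtE' : Kt i j = galerkin Gamma mu phi (kBF kappa BI BJ px py (xi m) (level s) i j) i j.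
  rewrite KtE; case: pickP => [[s' t']|].
    move=> /andP[/andP[/asboolP[/= bst' adm'] is'] jt'].
    by have [||-> _ //] := leaf_block_unique hTI hTJ bst bst' _ _ is_ is' jt jt'; left.
  by move/(_ (s, t)); rewrite /pk /= is_ jt !andbT => /asboolP[].
set D := dist (BI s) (BJ t).
have D0 : 0 < D by exact: (adm_dist_gt0 heta1 adm).
set La := CL * m.+1%:R `^ lam.
have hLa (u : R) : -1 <= u <= 1 -> \sum_(k < m.+1) `|(Defs.lagrange (xi m) k).[u]| <= La.
  exact: (lebesgue_sum (xi_inj m) (xi_lebesgue m)).
have [A3I A3J] := A3 _ _ (conj bst adm).
set L := Lhalf (depth TI) (level s).
have Lp : (L <= depth TI)%N by rewrite /L /Lhalf -divn2 (leq_trans (leq_div _ _))// leq_subr.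
have hE := hC m (depth TI) L La hm Lp erefl.
set E := C * expR (- (b * m%:R)) in hE.
have E0 : 0 <= E by rewrite mulr_ge0 ?expR_ge0 ?ltW.
have kerr x y : box_set (BI (leaf_of TI i)) x -> box_set (BJ (leaf_of TJ j)) y ->
    normc (kHelm kappa x y - kBF kappa BI BJ px py (xi m) (level s) i j x y) <= E / D.
  move=> Bx By.
  apply: le_trans (kBF_error heta1 hq hkappa (xi_inj m) (xi_range m) hLa hTI hTJ hdepth
    nestI nestJ hpx hpy (block_level hTI hTJ bst) adm (A2 _ _ (conj bst adm)) A3I A3J is_ jt Bx By) _.
  by rewrite mulrA ler_wpM2r// invr_ge0 ltW.
have ED : 0 <= E / D by rewrite divr_ge0// ltW.
rewrite /K /stiffness mxE KtE'.
have h : normc (galerkin Gamma mu phi (kHelm kappa) i j -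
    galerkin Gamma mu phi (kBF kappa BI BJ px py (xi m) (level s) i j) i j) <=
  2 * (E / D) * (L1norm mu Gamma (phi i) * L1norm mu Gamma (phi j)).
  apply: (galerkin_diff mGamma hphi (M := D^-1 + E / D)) => //.
  - by rewrite addr_ge0// invr_ge0 ltW.
  - by apply: cmeasurable_kHelm; [exact: vmeasurable_fst|exact: vmeasurable_snd].
  - exact: cmeasurable_kBF.
  (* By the support condition the points that matter lie in the leaf boxes, where the kernel error
     is known. *)
  move=> x y Gx Gy xi0 yj0.
  have [_ il] := leaf_ofP hTI i; have [_ jl] := leaf_ofP hTJ j.
  have Bx : box_set (BI (leaf_of TI i)) x by apply: (suppI _ _ il); exact: subset_closure.
  have By : box_set (BJ (leaf_of TJ j)) y by apply: (suppJ _ _ jl); exact: subset_closure.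
  have kD : normc (kHelm kappa x y) <= D^-1.
    apply: kHelm_le => //; apply: box_dist_le.
      exact: leaf_box_sub Bx.
    exact: leaf_box_sub By.
  have ke := kerr x y Bx By.
  split=> //; first by rewrite (le_trans kD)// lerDl.
  rewrite -[X in normc X](subKr (kHelm kappa x y)) (le_trans (le_normcB _ _))// lerD//.
apply: le_trans h _; rewrite le_eqVlt; apply/orP; left; apply/eqP.
by rewrite /E; ring.
Qed.
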